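(* The class of $1$-exact operator systems is not uniformly definable by a sequence of types in the language of operator systems.
   Context: A finite-dimensional operator system $E$ is $1$-exact if there are unital linear injections $\phi_i:E\to M_{n_i}$ such that $\|\phi_i\|_{\mathrm{cb}}\cdot\|\phi_i^{-1}\|_{\mathrm{cb}}\to 1$, where $\phi_i^{-1}:\phi_i(E)\to E$. A general operator system is $1$-exact if all of its finite-dimensional operator subsystems are $1$-exact. Language of operator systems (many-sorted continuous first-order logic): for each $k\ge 1$ there is a sort for $M_k(X)$, with domains of quantification the closed balls $\{x\in M_k(X):\|x\|_k\le r\}$, $r\in\mathbb N$, with metric given by the norm. There are function symbols for $0$, the unit of $M_k(X)$, the involution, addition, (rational complex) scalar multiplication, left and right multiplication by scalar matrices, direct sums $M_k(X)\times M_l(X)\to M_{k+l}(X)$, and there are predicate symbols for the norms. Formulae are built from atomic formulae (norms of terms) by continuous connectives $\mathbb R^p\to\mathbb R$ and by $\sup$ and $\inf$ quantifiers over domains of quantification. A class $\mathcal K$ of operator systems is uniformly definable by a sequence of types if, for each $(m,j)\in\mathbb N^2$, there is a formula $\phi_{m,j}(\vec x_m)$ in the language of operator systems such that: (1) each $\phi_{m,j}$ takes only nonnegative values; (2) for a fixed $m$, all the $\phi_{m,j}$ ($j\in\mathbb N$) have the same modulus of uniform continuity; (3) an operator system $X$ belongs to $\mathcal K$ if and only if, for each $m\in\mathbb N$, $\left(\sup_{\vec x_m}\inf_j\phi_{m,j}(\vec x_m)\right)^X=0$. *)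

(* Defs.v *)
From HB Require Import structures.
From mathcomp Require Import all_boot all_order all_algebra.
From mathcomp Require Import complex.
From mathcomp Require Import all_classical all_reals all_analysis.
Set Implicit Arguments.
Unset Strict Implicit.
Unset Printing Implicit Defensive.
Import Order.TTheory GRing.Theory Num.Theory.
Import numFieldNormedType.Exports.
Local Open Scope classical_set_scope.
Local Open Scope ring_scope.
Local Open Scope complex_scope.

(* Operator systems are the abstract operator systems of Choi and Effros:     *)
(* complex *-vector spaces with a matrix order and an Archimedean matrix      *)
(* order unit.  As structures of continuous logic they are norm complete.     *)

Record matrixOrder (R : realType) := MatrixOrder {
  mo_car :> lmodType R[i];
  mo_star : mo_car -> mo_car;
  mo_unit : mo_car;
  mo_pos : forall n, set 'M[mo_car]_n }.

Arguments mo_star {R} X _ : rename.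
Arguments mo_unit {R} X : rename.
Arguments mo_pos {R} X n _ : rename.

Section MatrixOrder.
Variables (R : realType) (X : matrixOrder R).

Definition mstar m n (x : 'M[X]_(m, n)) : 'M[X]_(n, m) :=
  map_mx (mo_star X) x^T.

Definition lmulm m n p (A : 'M[R[i]]_(m, n)) (x : 'M[X]_(n, p)) :
    'M[X]_(m, p) :=
  \matrix_(i, j) \sum_k A i k *: x k j.

Definition rmulm m n p (x : 'M[X]_(m, n)) (A : 'M[R[i]]_(n, p)) :
    'M[X]_(m, p) :=
  \matrix_(i, j) \sum_k A k j *: x i k.

Definition munit n : 'M[X]_n := (mo_unit X)%:M.

(* t times the unit of M_n(X), for t real *)
Definition munitZ n (t : R) : 'M[X]_n := (t%:C *: mo_unit X)%:M.

(* ||x|| <= t iff [[t e, x], [x^*, t e]] is positive in M_2n(X) *)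
Definition mnorm n (x : 'M[X]_n) : R :=
  inf [set t : R | 0 <= t /\
    mo_pos X _ (block_mx (munitZ n t) x (mstar x) (munitZ n t))].

Definition onorm (x : X) : R := mnorm (x%:M : 'M[X]_1).

Record operator_system_axioms : Prop := OperatorSystemAxioms {
  os_starK : involutive (mo_star X);
  os_starD : forall x y, mo_star X (x + y) = mo_star X x + mo_star X y;
  os_starZ : forall a x, mo_star X (a *: x) = conjc a *: mo_star X x;
  os_pos_sa : forall n x, mo_pos X n x -> mstar x = x;
  os_posD : forall n x y,
    mo_pos X n x -> mo_pos X n y -> mo_pos X n (x + y);
  (* compatibility; A scalar gives closure under nonnegative multiples *)
  os_pos_conj : forall n m (A : 'M[R[i]]_(n, m)) x, mo_pos X n x ->
    mo_pos X m (lmulm (map_mx conjc A^T) (rmulm x A));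
  os_pos_proper : forall n x, mo_pos X n x -> mo_pos X n (- x) -> x = 0;
  os_unit_neq0 : mo_unit X != 0;
  os_unit_sa : mo_star X (mo_unit X) = mo_unit X;
  os_order_unit : forall n (x : 'M[X]_n), mstar x = x ->
    exists2 t : R, 0 < t & mo_pos X n (x + munitZ n t);
  os_archimedean : forall n (x : 'M[X]_n),
    (forall t : R, 0 < t -> mo_pos X n (x + munitZ n t)) -> mo_pos X n x;
  os_complete : forall u : nat -> X,
    (forall e : R, 0 < e -> exists N, forall i j,
      (N <= i)%N -> (N <= j)%N -> onorm (u i - u j) < e) ->
    exists l, forall e : R, 0 < e -> exists N, forall i,
      (N <= i)%N -> onorm (u i - l) < e }.

End MatrixOrder.

Record operatorSystem (R : realType) := OperatorSystem {
  os_order :> matrixOrder R;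
  os_axioms : operator_system_axioms os_order }.

(* M_n(C); x in M_k(M_n) is positive if it is so as a matrix of size kn,      *)
(* with quadratic form evaluated at (xi_1, ..., xi_k), xi_i in C^n.           *)
Definition mx_order (R : realType) (n : nat) : matrixOrder R :=
  @MatrixOrder R 'M[R[i]]_n (fun A => map_mx conjc A^T) 1%:M
    (fun k => [set x : 'M['M[R[i]]_n]_k |
      (forall i j, x j i = map_mx conjc (x i j)^T) /\
      forall xi : 'I_k -> 'cV[R[i]]_n,
        0 <= \sum_i \sum_j
          (map_mx conjc (xi i)^T *m x i j *m xi j) 0 0]).

(* cb-norm of a map f defined on a subspace D of E *)
Definition cb_norm (R : realType) (E F : matrixOrder R) (D : set E)
    (f : E -> F) : \bar R :=
  ereal_sup [set r | exists k (x : 'M[E]_k),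
    [/\ forall i j, D (x i j), mnorm x <= 1
      & r = (mnorm (map_mx f x : 'M[F]_k))%:E]].

Definition finite_dim (R : realType) (E : operatorSystem R) : Prop :=
  exists n (b : 'I_n -> E), forall x, exists c : 'I_n -> R[i],
    x = \sum_i c i *: b i.

(* psi i, restricted to the range of phi i, is the inverse of phi i *)
Definition one_exact_fd (R : realType) (E : operatorSystem R) : Prop :=
  exists (n : nat -> nat) (phi : forall i, {linear E -> mx_order R (n i)})
    (psi : forall i, mx_order R (n i) -> E),
  [/\ forall i, phi i (mo_unit E) = 1%:M,
      forall i, cancel (phi i) (psi i)
    & (fun i => cb_norm setT (phi i) * cb_norm (range (phi i)) (psi i))%E
        @ \oo --> 1%E].

(* inclusion of an operator subsystem: the order of E is induced from X *)
Record os_embedding (R : realType) (E X : operatorSystem R)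
    (f : {linear E -> X}) : Prop := OsEmbedding {
  ose_inj : injective f;
  ose_unit : f (mo_unit E) = mo_unit X;
  ose_star : forall x, f (mo_star E x) = mo_star X (f x);
  ose_pos : forall n (x : 'M[E]_n), mo_pos E n x <-> mo_pos X n (map_mx f x) }.

Definition one_exact (R : realType) (X : operatorSystem R) : Prop :=
  forall (E : operatorSystem R) (f : {linear E -> X}),
    os_embedding f -> finite_dim E -> one_exact_fd E.

(* The language of operator systems.                                          *)

(* Domain k r is the ball of radius r of M_(k.+1)(X) *)
Record domain := Domain { dom_dim : nat; dom_rad : nat }.

Notation dsort d := (dom_dim d).+1.

(* free variables are listed in a context (de Bruijn) *)
Inductive var : seq domain -> domain -> Type :=
| VZ G d : var (d :: G) d
| VS G d d' : var G d -> var (d' :: G) d.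

(* terms of sort M_k(X) *)
Inductive term (R : realType) (G : seq domain) : nat -> Type :=
| TVar d : var G d -> term R G (dsort d)
| TZero k : term R G k.+1
| TUnit k : term R G k.+1
| TStar k : term R G k -> term R G k
| TAdd k : term R G k -> term R G k -> term R G k
| TScale k : rat -> rat -> term R G k -> term R G k
| TLmul k : 'M[R[i]]_k -> term R G k -> term R G k
| TRmul k : term R G k -> 'M[R[i]]_k -> term R G k
| TDsum k l : term R G k -> term R G l -> term R G (k + l).

Arguments TZero {R G} k.
Arguments TUnit {R G} k.

Inductive formula (R : realType) : seq domain -> Type :=
| FNorm G k : term R G k -> formula R G
| FConn G p (u : 'rV[R]_p -> R) :
    continuous u -> ('I_p -> formula R G) -> formula R G
| FSup G d : formula R (d :: G) -> formula R G
| FInf G d : formula R (d :: G) -> formula R G.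

Section Semantics.
Variables (R : realType) (X : operatorSystem R).

Fixpoint env (G : seq domain) : Type :=
  if G is d :: G' then ('M[X]_(dsort d) * env G')%type else unit.

Definition ball_dom (d : domain) : set 'M[X]_(dsort d) :=
  [set x | mnorm x <= (dom_rad d)%:R].

Fixpoint env_dom (G : seq domain) : set (env G) :=
  if G is d :: G' then [set v : env (d :: G') | ball_dom v.1 /\ env_dom v.2]
  else setT.

Fixpoint env_close (e : R) (G : seq domain) : env G -> env G -> Prop :=
  if G is d :: G' then fun v w : env (d :: G') =>
    mnorm (v.1 - w.1) < e /\ env_close e v.2 w.2
  else fun _ _ => True.

Fixpoint eval_var G d (x : var G d) : env G -> 'M[X]_(dsort d) :=
  match x in var G d return env G -> 'M[X]_(dsort d) with
  | VZ _ _ => fun v => v.1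
  | VS _ _ _ y => fun v => eval_var y v.2
  end.

Fixpoint eval_term G (v : env G) k (t : term R G k) : 'M[X]_k :=
  match t in term _ _ k return 'M[X]_k with
  | TVar _ x => eval_var x v
  | TZero _ => 0
  | TUnit _ => munit X _
  | TStar _ t => mstar (eval_term v t)
  | TAdd _ s t => eval_term v s + eval_term v t
  | TScale _ a b t => map_mx ( *:%R (ratr a +i* ratr b)) (eval_term v t)
  | TLmul _ A t => lmulm A (eval_term v t)
  | TRmul _ t A => rmulm (eval_term v t) A
  | TDsum _ _ s t => block_mx (eval_term v s) 0 0 (eval_term v t)
  end.

(* formulae are bounded on domains, so the real sup and inf are meaningful *)
Fixpoint eval G (phi : formula R G) : env G -> R :=
  match phi in formula _ G return env G -> R with
  | FNorm _ _ t => fun v => mnorm (eval_term v t)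
  | FConn _ p u _ f => fun v => u (\row_i eval (f i) v)
  | FSup _ d f => fun v =>
      sup [set r | exists2 a, @ball_dom d a & r = eval f (a, v)]
  | FInf _ d f => fun v =>
      inf [set r | exists2 a, @ball_dom d a & r = eval f (a, v)]
  end.

End Semantics.

Definition uniformly_definable (R : realType)
    (K : operatorSystem R -> Prop) : Prop :=
  exists (G : nat -> seq domain) (phi : forall m, nat -> formula R (G m)),
  [/\ forall m j (X : operatorSystem R) (v : env X (G m)),
        env_dom v -> 0 <= eval (phi m j) v,
      forall m, exists2 delta : R -> R, forall e, 0 < e -> 0 < delta e &
        forall j (X : operatorSystem R) (v w : env X (G m)) (e : R),
          env_dom v -> env_dom w -> 0 < e -> env_close (delta e) v w ->
          `|eval (phi m j) v - eval (phi m j) w| <= e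
    & forall X : operatorSystem R, K X <->
        forall m, sup [set r | exists2 v : env X (G m), env_dom v &
          r = inf (range (fun j => eval (phi m j) v))] = 0].

(* Main.v *)
From HB Require Import structures.
From mathcomp Require Import all_boot all_order all_algebra.
From mathcomp Require Import complex.
From mathcomp Require Import all_classical all_reals all_analysis.
From mathcomp Require Import ring lra zify.
Require Import Defs.
Set Implicit Arguments.
Unset Strict Implicit.
Unset Printing Implicit Defensive.
Import Order.TTheory GRing.Theory Num.Theory.
Import numFieldNormedType.Exports.
Local Open Scope classical_set_scope.
Local Open Scope ring_scope.
Local Open Scope complex_scope.

(* The cones of [M_k(X)] for [k <= K] determine the value of every formula
   whose sorts are at most [K/2].  So it is enough to put on one vector space
   [V = C^(n+1)] a family of operator system structures [E_T], [T] a set of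
   natural numbers, such that the cones of [E_T] at level [k] only depend on
   the beginning of [T], [E_T] is 1-exact for [T] finite and not 1-exact for
   [T] infinite: if the types were omitted by all [E_T] with [T] finite, one
   could add elements to [T] one at a time, each so large that the finitely
   many witnesses found so far (the balls are totally bounded and the moduli
   of continuity uniform) are preserved, and obtain an infinite [T] for which
   [E_T] omits the types.

   [E_T] is the intersection of a base cone, in which [(1, x_1, ..., x_n)] is
   positive when the [x_i] are selfadjoint with [sum_i x_i^2 <= 1], with the
   cones pulled back along [e_i |-> h_i^m / lam], [m] in [T], where [lam < 1] and the [h_i^m] are
   selfadjoint matrices with [sum_i (h_i^m)^2 = 1] such that
   [P |-> sum_i h_i^m P h_i^m] has a spectral gap on matrices of low rank.  The
   gap makes the [m]-th cone invisible at levels small with respect to the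
   size of [h^m], whereas the element given by the conjugates of the [h_i^m]
   has norm at most 1 for the cones before the [m]-th and at least [1/lam] for
   the [m]-th; by Smith's lemma this contradicts the existence of a map to
   some [M_d] with small distortion.  The matrices [h^m] come from the quantum
   version of Margulis' expanders. *)

(** * Complex numbers and matrix-valued forms *)

(** The map [P |-> sum_i h_i P h_i] fixes the identity, so a gap can only hold away from full rank,
    and both roles of a cone come from this dichotomy. A vector of C^k (x) C^N has Schmidt rank at
    most [k]: at low levels the gap gains the factor [lam] that the division by [lam] loses, and the
    cone is implied by the base cone. The maximally entangled vector of C^N (x) C^N has full rank
    and detects the whole factor [1/lam] at level [N]. That earlier cones do not detect the test
    element of [h^m] is a matter of symmetry: exchanging the tensor factors asks whether the [m]-th
    cone detects the test element of an earlier [h^j], whose level is too low for it. This forces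
    the fast growth of the dimensions. A norm at level [k] is read off the cone at level [2k], which
    explains the doubled levels throughout. *)

Section Complex.
Variable R : realType.
Local Notation C := R[i].
Implicit Types (z w : C).

Definition normsq z : R := complex.Re z ^+ 2 + complex.Im z ^+ 2.

Lemma normsq_ge0 z : 0 <= normsq z.
Proof. by rewrite addr_ge0 ?sqr_ge0. Qed.

Lemma normsq_eq0 z : (normsq z == 0) = (z == 0).
Proof.
case: z => a b; rewrite /normsq paddr_eq0 ?sqr_ge0 //= !sqrf_eq0.
by rewrite eq_complex.
Qed.

Lemma normsqM z w : normsq (z * w) = normsq z * normsq w.
Proof. by case: z w => [a b] [c d]; rewrite /normsq /=; ring. Qed.

Lemma normsqN z : normsq (- z) = normsq z.
Proof. by case: z => [a b]; rewrite /normsq /=; ring. Qed.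

Lemma normsq_conj z : normsq (conjc z) = normsq z.
Proof. by case: z => [a b]; rewrite /normsq /=; ring. Qed.

Lemma normsq_real (a : R) : normsq a%:C = a ^+ 2.
Proof. by rewrite /normsq /=; ring. Qed.

Lemma cReD z w : complex.Re (z + w) = complex.Re z + complex.Re w.
Proof. by case: z w => [a b] [c d]. Qed.

Lemma cReN z : complex.Re (- z) = - complex.Re z.
Proof. by case: z => [a b]. Qed.

Lemma cRe_sum (I : Type) (r : seq I) (P : pred I) (F : I -> C) :
  complex.Re (\sum_(i <- r | P i) F i) = \sum_(i <- r | P i) complex.Re (F i).
Proof. by apply: (big_morph (@complex.Re R)) => //; apply: cReD. Qed.

Lemma cRe_conj z : complex.Re (conjc z) = complex.Re z.
Proof. by case: z. Qed.

Lemma cReMl (a : R) z : complex.Re (a%:C * z) = a * complex.Re z.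
Proof. by case: z => [b c] /=; ring. Qed.

Lemma conjcM z w : conjc (z * w) = conjc z * conjc w.
Proof. by rewrite rmorphM. Qed.

Lemma conj_real (a : R) : conjc a%:C = a%:C.
Proof. by rewrite /= oppr0. Qed.

Lemma mulzconj z : z * conjc z = (normsq z)%:C.
Proof.
case: z => [a b]; rewrite /normsq /=; apply/eqP; rewrite eq_complex /=.
by apply/andP; split; apply/eqP; ring.
Qed.

Lemma le0cE z : (0 <= z) = (complex.Im z == 0) && (0 <= complex.Re z).
Proof. by case: z => a b; rewrite lecE /=. Qed.

Lemma real_ge0c z : conjc z = z -> (0 <= z) = (0 <= complex.Re z).
Proof.
case: z => a b; rewrite le0cE /= => -[] /esym/eqP; rewrite -addr_eq0 => /eqP h.
have -> : b = 0 by lra.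
by rewrite eqxx.
Qed.

Lemma ge0c_Re z : 0 <= z -> 0 <= complex.Re z.
Proof. by rewrite le0cE => /andP[]. Qed.

Lemma young z w (e : R) : 0 < e ->
  2 * complex.Re (z * w) <= e * normsq z + e^-1 * normsq w.
Proof.
move=> e0; case: z w => [a b] [c d]; rewrite /normsq /= -subr_ge0.
have -> : e * (a ^+ 2 + b ^+ 2) + e^-1 * (c ^+ 2 + d ^+ 2) - 2 * (a * c - b * d)
  = e * ((a - e^-1 * c) ^+ 2 + (b + e^-1 * d) ^+ 2).
  by field; rewrite gt_eqF.
by rewrite mulr_ge0 ?(ltW e0) // addr_ge0 ?sqr_ge0.
Qed.

(* a form value [z] is bounded by [t] as soon as [[t, z], [z^*, t]] is positive *)
Lemma normsq_le_of_forms z (t : R) : 0 <= t ->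
  (forall a b : C, 0 <= t * normsq a + t * normsq b + 2 * complex.Re (a * z * b)) ->
  normsq z <= t ^+ 2.
Proof.
move=> t0 h; have := h (- conjc z) t%:C; rewrite normsqN normsq_conj normsq_real.
rewrite !mulNr [conjc z * z]mulrC mulzconj cReN -rmorphM /= => h1.
have [->|z0] := eqVneq (normsq z) 0; first exact: sqr_ge0.
have nz : 0 < normsq z by rewrite lt_def z0 normsq_ge0.
have [t00|tn0] := eqVneq t 0.
  have := h (- conjc z) 1; rewrite mulr1 mulNr [conjc z * z]mulrC mulzconj cReN /= t00.
  by move=> h2; exfalso; lra.
have tp : 0 < t by rewrite lt_def tn0.
have : 0 <= t * (t ^+ 2 - normsq z) by nra.
by rewrite pmulr_rge0 // subr_ge0.
Qed.

End Complex.

Section Forms.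
Variable R : realType.
Local Notation C := R[i].

Definition adj m n (A : 'M[C]_(m, n)) : 'M[C]_(n, m) := map_mx (@conjc R) A^T.

Lemma adjE m n (A : 'M[C]_(m, n)) i j : adj A i j = conjc (A j i).
Proof. by rewrite !mxE. Qed.

Lemma adjK m n (A : 'M[C]_(m, n)) : adj (adj A) = A.
Proof. by apply/matrixP => i j; rewrite !adjE conjcK. Qed.

Lemma adjM m n p (A : 'M[C]_(m, n)) (B : 'M[C]_(n, p)) :
  adj (A *m B) = adj B *m adj A.
Proof. by rewrite /adj trmx_mul map_mxM. Qed.

Lemma adjD m n (A B : 'M[C]_(m, n)) : adj (A + B) = adj A + adj B.
Proof. by apply/matrixP => i j; rewrite !mxE rmorphD. Qed.

Lemma adjN m n (A : 'M[C]_(m, n)) : adj (- A) = - adj A.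
Proof. by apply/matrixP => i j; rewrite !mxE rmorphN. Qed.

Lemma adjZ m n a (A : 'M[C]_(m, n)) : adj (a *: A) = conjc a *: adj A.
Proof. by apply/matrixP => i j; rewrite !mxE rmorphM. Qed.

Lemma adj0 m n : adj (0 : 'M[C]_(m, n)) = 0.
Proof. by apply/matrixP => i j; rewrite !mxE rmorph0. Qed.

Lemma adj1 n : adj (1%:M : 'M[C]_n) = 1%:M.
Proof. by apply/matrixP => i j; rewrite !mxE eq_sym rmorph_nat. Qed.

Lemma adj_sum m n (I : Type) (r : seq I) (P : pred I) (F : I -> 'M[C]_(m, n)) :
  adj (\sum_(i <- r | P i) F i) = \sum_(i <- r | P i) adj (F i).
Proof. by apply: (big_morph _ (@adjD _ _) (@adj0 _ _)). Qed.

Definition hform N (A : 'M[C]_N) (u v : 'cV[C]_N) : C := (adj u *m A *m v) 0 0.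

Lemma hformE N (A : 'M[C]_N) u v :
  hform A u v = \sum_r \sum_s conjc (u r 0) * A r s * v s 0.
Proof.
rewrite /hform mxE exchange_big /=; apply: eq_bigr => s _; rewrite mxE mulr_suml.
by apply: eq_bigr => r _; rewrite adjE.
Qed.

Lemma hformDm N (A B : 'M[C]_N) u v : hform (A + B) u v = hform A u v + hform B u v.
Proof. by rewrite /hform mulmxDr mulmxDl mxE. Qed.

Lemma hformZm N a (A : 'M[C]_N) u v : hform (a *: A) u v = a * hform A u v.
Proof. by rewrite /hform -scalemxAr -scalemxAl mxE. Qed.

Lemma hform_summ N (I : Type) (r : seq I) (P : pred I) (F : I -> 'M[C]_N) u v :
  hform (\sum_(i <- r | P i) F i) u v = \sum_(i <- r | P i) hform (F i) u v.
Proof.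
apply: (big_morph (fun A => hform A u v)); first by move=> A B; rewrite hformDm.
by rewrite /hform mulmx0 mul0mx mxE.
Qed.

Lemma hformDr N (A : 'M[C]_N) u v w : hform A u (v + w) = hform A u v + hform A u w.
Proof. by rewrite /hform mulmxDr mxE. Qed.

Lemma hformZr N a (A : 'M[C]_N) u v : hform A u (a *: v) = a * hform A u v.
Proof. by rewrite /hform -scalemxAr mxE. Qed.

Lemma hformNr N (A : 'M[C]_N) u v : hform A u (- v) = - hform A u v.
Proof. by rewrite /hform mulmxN mxE. Qed.

Lemma hform_sumr N (I : Type) (r : seq I) (P : pred I) (A : 'M[C]_N) u
    (F : I -> 'cV[C]_N) :
  hform A u (\sum_(i <- r | P i) F i) = \sum_(i <- r | P i) hform A u (F i).
Proof.
apply: (big_morph (hform A u)); first by move=> v w; rewrite hformDr.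
by rewrite /hform mulmx0 mxE.
Qed.

Lemma hform_conj N (A : 'M[C]_N) u v : conjc (hform A u v) = hform (adj A) v u.
Proof.
have -> : conjc (hform A u v) = adj (adj u *m A *m v) 0 0 by rewrite adjE.
by rewrite !adjM adjK mulmxA.
Qed.

Lemma hformDl N (A : 'M[C]_N) u v w : hform A (u + v) w = hform A u w + hform A v w.
Proof. by rewrite /hform adjD !mulmxDl mxE. Qed.

Lemma hformZl N a (A : 'M[C]_N) u v : hform A (a *: u) v = conjc a * hform A u v.
Proof. by rewrite /hform adjZ -!scalemxAl mxE. Qed.

Lemma hformNl N (A : 'M[C]_N) u v : hform A (- u) v = - hform A u v.
Proof. by rewrite /hform adjN !mulNmx mxE. Qed.

Lemma hform_suml N (I : Type) (r : seq I) (P : pred I) (A : 'M[C]_N) u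
    (F : I -> 'cV[C]_N) :
  hform A (\sum_(i <- r | P i) F i) u = \sum_(i <- r | P i) hform A (F i) u.
Proof. by rewrite /hform adj_sum !mulmx_suml summxE. Qed.

Definition vnormsq N (u : 'cV[C]_N) : R := \sum_r normsq (u r 0).

Lemma vnormsq_ge0 N (u : 'cV[C]_N) : 0 <= vnormsq u.
Proof. by apply: sumr_ge0 => r _; apply: normsq_ge0. Qed.

Lemma hform1 N (u : 'cV[C]_N) : hform 1%:M u u = (vnormsq u)%:C.
Proof.
rewrite /hform mulmx1 mxE /vnormsq rmorph_sum /=; apply: eq_bigr => r _.
by rewrite adjE mulrC mulzconj.
Qed.

Lemma vnormsqN N (u : 'cV[C]_N) : vnormsq (- u) = vnormsq u.
Proof. by apply: eq_bigr => r _; rewrite mxE normsqN. Qed.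

Definition qform k N (x : 'M['M[C]_N]_k) (xi eta : 'I_k -> 'cV[C]_N) : C :=
  \sum_i \sum_j hform (x i j) (xi i) (eta j).

Definition fam_normsq k N (xi : 'I_k -> 'cV[C]_N) : R := \sum_i vnormsq (xi i).

Lemma fam_normsq_ge0 k N (xi : 'I_k -> 'cV[C]_N) : 0 <= fam_normsq xi.
Proof. by apply: sumr_ge0 => r _; apply: vnormsq_ge0. Qed.

Lemma fam_normsqN k N (xi : 'I_k -> 'cV[C]_N) : fam_normsq (fun i => - xi i) = fam_normsq xi.
Proof. by apply: eq_bigr => i _; rewrite vnormsqN. Qed.

Lemma qform_conj k N (x : 'M['M[C]_N]_k) xi eta :
  (forall i j, x j i = adj (x i j)) -> conjc (qform x xi eta) = qform x eta xi.
Proof.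
move=> h; rewrite /qform exchange_big rmorph_sum /=; apply: eq_bigr => i _.
by rewrite rmorph_sum /=; apply: eq_bigr => j _; rewrite hform_conj -h.
Qed.

(** In [R[i]] the relation [0 <= z] includes that [z] is real. Hermitian symmetry supplies this, so
    only real parts remain to be estimated. *)
Lemma mxposP k N (x : 'M['M[C]_N]_k) :
  mo_pos (mx_order R N) k x <->
  (forall i j, x j i = adj (x i j)) /\ forall xi, 0 <= complex.Re (qform x xi xi).
Proof.
split=> -[h1 h2]; split=> // xi; first exact: ge0c_Re (h2 xi).
by have := h2 xi; rewrite -real_ge0c //; exact: qform_conj.
Qed.

Lemma qformD k N (x y : 'M['M[C]_N]_k) xi eta :
  qform (x + y) xi eta = qform x xi eta + qform y xi eta.
Proof.
rewrite /qform -big_split /=; apply: eq_bigr => i _; rewrite -big_split /=.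
by apply: eq_bigr => j _; rewrite mxE hformDm.
Qed.

Lemma qformN k N (x : 'M['M[C]_N]_k) xi eta : qform (- x) xi eta = - qform x xi eta.
Proof.
rewrite /qform -sumrN; apply: eq_bigr => i _; rewrite -sumrN.
by apply: eq_bigr => j _; rewrite mxE -scaleN1r hformZm mulN1r.
Qed.

Lemma qformDr k N (x : 'M['M[C]_N]_k) xi eta zeta :
  qform x xi (fun i => eta i + zeta i) = qform x xi eta + qform x xi zeta.
Proof.
rewrite /qform -big_split /=; apply: eq_bigr => i _; rewrite -big_split /=.
by apply: eq_bigr => j _; rewrite hformDr.
Qed.

Lemma qformDl k N (x : 'M['M[C]_N]_k) xi eta zeta :
  qform x (fun i => eta i + zeta i) xi = qform x eta xi + qform x zeta xi.
Proof.
rewrite /qform -big_split /=; apply: eq_bigr => i _; rewrite -big_split /=.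
by apply: eq_bigr => j _; rewrite hformDl.
Qed.

Lemma qformNr k N (x : 'M['M[C]_N]_k) xi eta :
  qform x xi (fun i => - eta i) = - qform x xi eta.
Proof.
rewrite /qform -sumrN; apply: eq_bigr => i _; rewrite -sumrN.
by apply: eq_bigr => j _; rewrite hformNr.
Qed.

Lemma qformZr k N (x : 'M['M[C]_N]_k) a xi eta :
  qform x xi (fun i => a *: eta i) = a * qform x xi eta.
Proof.
rewrite /qform mulr_sumr; apply: eq_bigr => i _; rewrite mulr_sumr.
by apply: eq_bigr => j _; rewrite hformZr.
Qed.

Lemma qform_munitZ k N (t : R) (xi : 'I_k -> 'cV[C]_N) :
  complex.Re (qform (munitZ (mx_order R N) k t) xi xi) = t * fam_normsq xi.
Proof.
rewrite /qform cRe_sum /fam_normsq mulr_sumr; apply: eq_bigr => i _.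
rewrite (bigD1 i) //= big1 => [|j ne]; last first.
  by rewrite mxE eq_sym (negbTE ne) mulr0n /hform mulmx0 mul0mx mxE.
by rewrite addr0 mxE eqxx mulr1n hformZm hform1 cReMl.
Qed.

Definition pair_vecs k N (xi eta : 'I_k -> 'cV[C]_N) : 'I_(k + k) -> 'cV[C]_N :=
  fun i => match fintype.split i with inl i => xi i | inr i => eta i end.

Lemma qform_block k N (a b c d : 'M['M[C]_N]_k) xi eta xi' eta' :
  qform (block_mx a b c d) (pair_vecs xi eta) (pair_vecs xi' eta') =
  qform a xi xi' + qform b xi eta' + qform c eta xi' + qform d eta eta'.
Proof.
have splitl i : fintype.split (lshift k i) = inl i :> 'I_k + 'I_k.
  exact: (fintype.unsplitK (inl i)).
have splitr i : fintype.split (rshift k i) = inr i :> 'I_k + 'I_k.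
  exact: (fintype.unsplitK (inr i)).
rewrite -addrA /qform big_split_ord /=; congr (_ + _); rewrite -big_split /=.
  apply: eq_bigr => i _; rewrite big_split_ord /=; congr (_ + _).
    by apply: eq_bigr => j _; rewrite block_mxEul /pair_vecs !splitl.
  by apply: eq_bigr => j _; rewrite block_mxEur /pair_vecs splitl splitr.
apply: eq_bigr => i _; rewrite big_split_ord /=; congr (_ + _).
  by apply: eq_bigr => j _; rewrite block_mxEdl /pair_vecs splitl splitr.
by apply: eq_bigr => j _; rewrite block_mxEdr /pair_vecs !splitr.
Qed.

Lemma pair_vecs_split k N (xi : 'I_(k + k) -> 'cV[C]_N) :
  xi = pair_vecs (fun i => xi (lshift k i)) (fun i => xi (rshift k i)).
Proof.
apply/funext => i; rewrite /pair_vecs; case: fintype.splitP => j e; congr xi; exact/val_inj.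
Qed.

(** A witness that the norm of [x] is at most [t]. Cone membership passes through maps and
    compressions directly, without the infimum in [mnorm]. *)
Definition bpos (X : matrixOrder R) k (t : R) (x : 'M[X]_k) :=
  mo_pos X _ (block_mx (munitZ X k t) x (mstar x) (munitZ X k t)).

Lemma bpos_mx k N (t : R) (x : 'M['M[C]_N]_k) :
  bpos (X := mx_order R N) t x <->
  forall xi eta,
    0 <= t * fam_normsq xi + t * fam_normsq eta + 2 * complex.Re (qform x xi eta).
Proof.
have sa (i j : 'I_k) : mstar (X := mx_order R N) x i j = adj (x j i).
  by rewrite !mxE.
have -> : bpos (X := mx_order R N) t x <->
    forall xi, 0 <= complex.Re (qform (block_mx (munitZ (mx_order R N) k t) x
      (mstar (X := mx_order R N) x) (munitZ (mx_order R N) k t)) xi xi).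
  rewrite /bpos mxposP; split=> [[]//|h]; split=> // i j.
  have uZ (p q : 'I_k) : munitZ (mx_order R N) k t q p =
      adj (munitZ (mx_order R N) k t p q).
    rewrite !mxE eq_sym; case: eqP => _; last by rewrite !mulr0n adj0.
    by rewrite !mulr1n adjZ conj_real adj1.
  rewrite -(fintype.splitK i) -(fintype.splitK j); case: (fintype.split i) => p; case: (fintype.split j) => q /=.
  - by rewrite !block_mxEul.
  - by rewrite block_mxEdl block_mxEur sa.
  - by rewrite block_mxEdl block_mxEur sa adjK.
  - by rewrite !block_mxEdr.
have E xi eta : complex.Re (qform (block_mx (munitZ (mx_order R N) k t) x
      (mstar (X := mx_order R N) x) (munitZ (mx_order R N) k t))
      (pair_vecs xi eta) (pair_vecs xi eta)) =
   t * fam_normsq xi + t * fam_normsq eta + 2 * complex.Re (qform x xi eta).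
  rewrite qform_block !cReD !qform_munitZ.
  have -> : qform (mstar (X := mx_order R N) x) eta xi = conjc (qform x xi eta).
    rewrite /qform exchange_big rmorph_sum /=; apply: eq_bigr => i _.
    by rewrite rmorph_sum /=; apply: eq_bigr => j _; rewrite hform_conj sa.
  by rewrite cRe_conj; ring.
split=> h.
  by move=> xi eta; rewrite -E.
by move=> xi; rewrite (pair_vecs_split xi) E.
Qed.

End Forms.

(** * Operator systems defined by tuples of matrices *)

Section Norms.
Variable R : realType.
Local Notation C := R[i].

Lemma mnorm_le (X : matrixOrder R) k (x : 'M[X]_k) t :
  0 <= t -> bpos t x -> mnorm x <= t.
Proof.
by move=> t0 xt; apply: ge_inf; [exists 0 => s [] | split].
Qed.

(** The infimum of an empty set of reals is 0, so a bound on [mnorm] says nothing by itself; the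
    witness [s] shows that the set is inhabited. *)
Lemma mnorm_lt (X : matrixOrder R) k (x : 'M[X]_k) t s :
  0 <= s -> bpos s x -> mnorm x < t ->
  exists r, [/\ 0 <= r, r < t & bpos r x].
Proof.
move=> s0 xs lt.
have hi : has_inf [set r : R | 0 <= r /\
    mo_pos X _ (block_mx (munitZ X k r) x (mstar x) (munitZ X k r))].
  by split; [exists s | exists 0 => r []].
have e0 : 0 < t - mnorm x by rewrite subr_gt0.
have [r [r0 rx] rt] := inf_adherent e0 hi.
by exists r; split=> //; move: rt; rewrite -/(mnorm x) addrC subrK.
Qed.

Definition l1norm (z : C) : R := `|complex.Re z| + `|complex.Im z|.

Lemma l1norm_ge0 z : 0 <= l1norm z.
Proof. by rewrite addr_ge0. Qed.

(** Testing the bound on [w], [-w], [i w] and [-i w] controls real and imaginary parts of the form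
    separately, whence the [l1norm] of the scalar. *)
Lemma hform_scale_bound N (A : 'M[C]_N) (c : R) (z : C) :
  (forall u w, 2 * complex.Re (hform A u w) <= c * (vnormsq u + vnormsq w)) ->
  forall u w, 2 * complex.Re (z * hform A u w) <= l1norm z * c * (vnormsq u + vnormsq w).
Proof.
move=> h u w.
have vi : vnormsq ('i%C *: w) = vnormsq w.
  by apply: eq_bigr => r _; rewrite mxE normsqM [normsq 'i%C]/normsq /=; ring.
have h1 := h u w.
have h2 := h u (- w); rewrite vnormsqN hformNr cReN in h2.
have h3 := h u ('i%C *: w); rewrite vi hformZr in h3.
have h4 := h u (- ('i%C *: w)); rewrite vnormsqN hformNr cReN vi hformZr in h4.
move: (hform A u w) (vnormsq u + vnormsq w) h1 h2 h3 h4 => [p q] s /=.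
rewrite !mul0r mul1r sub0r => h1 h2 h3 h4.
case: z => a b; rewrite /l1norm /=.
have A1 : 2 * (a * p) <= `|a| * (c * s).
  by have [a0|a0] := ler0P a; nra.
have A2 : 2 * - (b * q) <= `|b| * (c * s).
  by have [b0|b0] := ler0P b; nra.
nra.
Qed.

Lemma hform_mx_bound N (A : 'M[C]_N) u w :
  2 * complex.Re (hform A u w) <= (\sum_r \sum_s l1norm (A r s)) * (vnormsq u + vnormsq w).
Proof.
rewrite hformE cRe_sum mulr_sumr mulr_suml; apply: ler_sum => r _.
rewrite cRe_sum mulr_sumr mulr_suml; apply: ler_sum => s _.
have vle (v : 'cV[C]_N) p : normsq (v p 0) <= vnormsq v.
  by rewrite /vnormsq (bigD1 p) //= lerDl; apply: sumr_ge0 => ? _; apply: normsq_ge0.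
pose d : 'M[C]_1 := 1%:M.
have h (u' w' : 'cV[C]_1) : 2 * complex.Re (hform d u' w') <= 1 * (vnormsq u' + vnormsq w').
  rewrite hformE !big_ord1 mxE eqxx mulr1 /vnormsq !big_ord1.
  by have := @young R (conjc (u' 0 0)) (w' 0 0) 1 ltr01; rewrite normsq_conj invr1 !mul1r.
have := @hform_scale_bound _ d 1 (A r s) h (const_mx (u r 0)) (const_mx (w s 0)).
rewrite hformE !big_ord1 !mxE eqxx mulr1 /vnormsq !big_ord1 !mxE mulr1 mulrCA mulrA.
move/le_trans; apply.
by apply: ler_wpM2l; rewrite ?l1norm_ge0 // lerD.
Qed.

Lemma qform_bound k N (x : 'M['M[C]_N]_k) (B : 'I_k -> 'I_k -> R) :
  (forall i j, 0 <= B i j) ->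
  (forall i j u w, 2 * complex.Re (hform (x i j) u w) <= B i j * (vnormsq u + vnormsq w)) ->
  forall xi eta, 2 * complex.Re (qform x xi eta) <=
    (\sum_i \sum_j B i j) * (fam_normsq xi + fam_normsq eta).
Proof.
move=> B0 h xi eta.
have vle (v : 'I_k -> 'cV[C]_N) p : vnormsq (v p) <= fam_normsq v.
  by rewrite /fam_normsq (bigD1 p) //= lerDl; apply: sumr_ge0 => ? _; apply: vnormsq_ge0.
rewrite /qform cRe_sum mulr_sumr mulr_suml; apply: ler_sum => i _.
rewrite cRe_sum mulr_sumr mulr_suml; apply: ler_sum => j _.
by rewrite (le_trans (h i j _ _)) // ler_wpM2l // lerD.
Qed.

Lemma bpos_of_bound k N (x : 'M['M[C]_N]_k) (t : R) :
  (forall xi eta, 2 * complex.Re (qform x xi eta) <= t * (fam_normsq xi + fam_normsq eta)) ->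
  bpos (X := mx_order R N) t x.
Proof.
move=> h; apply/bpos_mx => xi eta.
have := h xi (fun i => - eta i); rewrite qformNr cReN fam_normsqN => h1.
lra.
Qed.

Lemma mx_bpos_ex k N (x : 'M['M[C]_N]_k) :
  exists2 t, 0 <= t & bpos (X := mx_order R N) t x.
Proof.
exists (\sum_i \sum_j \sum_r \sum_s l1norm (x i j r s)).
  by do 4 (apply: sumr_ge0 => ? _); apply: l1norm_ge0.
apply: bpos_of_bound; apply: qform_bound => [i j|i j u w]; last exact: hform_mx_bound.
by do 2 (apply: sumr_ge0 => ? _); apply: l1norm_ge0.
Qed.

Definition mxact k m N (A : 'M[C]_(k, m)) (xi : 'I_m -> 'cV[C]_N) :
  'I_k -> 'cV[C]_N := fun p => \sum_i A p i *: xi i.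

Lemma qform_conjm k m N (A B : 'M[C]_(k, m)) (x : 'M['M[C]_N]_k) xi eta :
  qform (lmulm (X := mx_order R N) (adj A) (rmulm (X := mx_order R N) x B)) xi eta =
  qform x (mxact A xi) (mxact B eta).
Proof.
rewrite /qform /mxact.
under eq_bigr => i _ do under eq_bigr => j _ do
  rewrite mxE hform_summ.
under [RHS]eq_bigr => p _ do under eq_bigr => q _ do
  rewrite hform_suml.
under eq_bigr => i _ do rewrite exchange_big /=.
rewrite exchange_big /=; apply: eq_bigr => p _.
under eq_bigr => i _ do under eq_bigr => j _ do
  rewrite hformZm adjE mxE hform_summ mulr_sumr.
under eq_bigr => i _ do rewrite exchange_big /=.
rewrite exchange_big /=; apply: eq_bigr => q _.
apply: eq_bigr => i _; rewrite hform_sumr; apply: eq_bigr => j _.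
by rewrite hformZm hformZr hformZl; ring.
Qed.

Lemma conjmE (X : matrixOrder R) k m (A B : 'M[C]_(k, m)) (x : 'M[X]_k) i j :
  lmulm (adj A) (rmulm x B) i j =
  \sum_p \sum_q (conjc (A p i) * B q j) *: x p q.
Proof.
rewrite mxE; apply: eq_bigr => p _; rewrite [rmulm _ _ _ _]mxE scaler_sumr.
by apply: eq_bigr => q _; rewrite adjE scalerA.
Qed.

Lemma mx_pos_conj k m N (A : 'M[C]_(k, m)) (x : 'M['M[C]_N]_k) :
  mo_pos (mx_order R N) k x ->
  mo_pos (mx_order R N) m (lmulm (X := mx_order R N) (adj A)
     (rmulm (X := mx_order R N) x A)).
Proof.
move=> /mxposP[sa h]; apply/mxposP; split=> [i j|xi]; last by rewrite qform_conjm.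
rewrite !(@conjmE (mx_order R N)) adj_sum exchange_big /=; apply: eq_bigr => p _.
rewrite adj_sum; apply: eq_bigr => q _.
by rewrite adjZ -sa conjcM conjcK mulrC.
Qed.

Lemma mx_posD k N (x y : 'M['M[C]_N]_k) :
  mo_pos (mx_order R N) k x -> mo_pos (mx_order R N) k y ->
  mo_pos (mx_order R N) k (x + y).
Proof.
move=> /mxposP[sx px] /mxposP[sy py]; apply/mxposP; split=> [i j|xi].
  by rewrite !mxE adjD -sx -sy.
by rewrite qformD cReD addr_ge0.
Qed.

Lemma munitZ_sa k N (t : R) i j : munitZ (mx_order R N) k t j i =
  adj (munitZ (mx_order R N) k t i j).
Proof.
rewrite !mxE eq_sym; case: eqP => _; last by rewrite !mulr0n adj0.
by rewrite !mulr1n adjZ conj_real adj1.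
Qed.

Lemma mx_archi k N (x : 'M['M[C]_N]_k) :
  (forall t : R, 0 < t -> mo_pos (mx_order R N) k (x + munitZ (mx_order R N) k t)) ->
  mo_pos (mx_order R N) k x.
Proof.
move=> h; apply/mxposP; split=> [i j|xi].
  have /mxposP[sa _] := h 1 ltr01.
  have := sa i j; rewrite mxE [X in _ = adj X]mxE adjD -munitZ_sa.
  by move/addIr.
apply/ler_addgt0Pr => e e0.
have ns1 : 0 < fam_normsq xi + 1 by rewrite ltr_wpDl // fam_normsq_ge0.
have /mxposP[_ /(_ xi)] := h (e / (fam_normsq xi + 1)) (divr_gt0 e0 ns1).
rewrite qformD cReD qform_munitZ => h1; apply: (le_trans h1); rewrite lerD2l.
rewrite mulrAC ler_pdivrMr // ler_pM2l // lerDl; exact: ler01.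
Qed.

Lemma qform_delta k N (x : 'M['M[C]_N]_k) i j r s (a b : C) :
  qform x (fun p => if p == i then a *: delta_mx r 0 else 0)
       (fun q => if q == j then b *: delta_mx s 0 else 0) =
  conjc a * x i j r s * b.
Proof.
have hf0l (A : 'M[C]_N) v : hform A 0 v = 0 by rewrite /hform adj0 !mul0mx mxE.
have hf0r (A : 'M[C]_N) v : hform A v 0 = 0 by rewrite /hform !mulmx0 mxE.
rewrite /qform (bigD1 i) //= [X in _ + X]big1 ?addr0 => [|p pi]; last first.
  by apply: big1 => q _; rewrite (negbTE pi) hf0l.
rewrite (bigD1 j) //= [X in _ + X]big1 ?addr0 => [|q qj]; last first.
  by rewrite (negbTE qj) hf0r.
rewrite !eqxx hformZl hformZr hformE (bigD1 r) //= [X in _ + X]big1 ?addr0 => [|p pr]; last first.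
  by apply: big1 => q _; rewrite mxE (negbTE pr) rmorph0 !mul0r.
rewrite (bigD1 s) //= [X in _ + X]big1 ?addr0 => [|q qs]; last first.
  by rewrite [X in _ * X]mxE (negbTE qs) mulr0.
by rewrite !mxE !eqxx rmorph1 mul1r mulr1; ring.
Qed.

Lemma fam_normsq_delta k N (i : 'I_k) r (a : C) :
  fam_normsq (fun p => if p == i then a *: delta_mx r 0 else 0 : 'cV[C]_N) = normsq a.
Proof.
rewrite /fam_normsq (bigD1 i) //= eqxx big1 ?addr0 => [|p /negbTE ->]; last first.
  by rewrite /vnormsq big1 // => q _; rewrite mxE /normsq /= expr0n addr0.
rewrite /vnormsq (bigD1 r) //= big1 ?addr0 => [|q /negbTE qr].
  by rewrite !mxE !eqxx mulr1.
by rewrite !mxE qr mulr0 /normsq /= expr0n addr0.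
Qed.

(* polarization: a hermitian form that vanishes on the diagonal is zero *)
Lemma mx_proper k N (x : 'M['M[C]_N]_k) :
  mo_pos (mx_order R N) k x -> mo_pos (mx_order R N) k (- x) -> x = 0.
Proof.
move=> /mxposP[sa p1] /mxposP[_ p2].
have z xi : complex.Re (qform x xi xi) = 0.
  apply/eqP; rewrite eq_le p1 andbT.
  by have := p2 xi; rewrite qformN cReN oppr_ge0.
have z2 xi eta : complex.Re (qform x xi eta) = 0.
  have := z (fun i => xi i + eta i).
  rewrite qformDl !qformDr !cReD !z -(qform_conj eta xi sa) cRe_conj; lra.
have z3 xi eta : qform x xi eta = 0.
  apply/eqP; rewrite eq_complex z2 eqxx /=.
  have := z2 xi (fun i => 'i%C *: eta i); rewrite qformZr.
  case: (qform x xi eta) => a b /=; rewrite mul0r mul1r sub0r => /eqP.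
  by rewrite oppr_eq0.
apply/matrixP => i j; apply/matrixP => r s; rewrite mxE mxE.
by have := z3 (fun p => if p == i then 1 *: delta_mx r 0 else 0)
  (fun q => if q == j then 1 *: delta_mx s 0 else 0);
  rewrite qform_delta rmorph1 mul1r mulr1.
Qed.

End Norms.

Section Rep.
Variables (R : realType) (n : nat).
Local Notation C := R[i].
Local Notation V := 'rV[C]_n.+1.

Definition rep N (H : 'I_n.+1 -> 'M[C]_N) (v : V) : 'M[C]_N :=
  \sum_l v 0 l *: H l.

Lemma rep_is_linear N (H : 'I_n.+1 -> 'M[C]_N) : linear (rep H).
Proof.
move=> a u v; rewrite /rep scaler_sumr -big_split /=; apply: eq_bigr => l _.
by rewrite !mxE scalerDl scalerA.
Qed.

HB.instance Definition _ N (H : 'I_n.+1 -> 'M[C]_N) :=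
  GRing.isLinear.Build C V 'M[C]_N _ (rep H) (rep_is_linear H).

Definition vstar (v : V) : V := map_mx (@conjc R) v.
Definition vunit : V := delta_mx 0 0.

Lemma rep_star N (H : 'I_n.+1 -> 'M[C]_N) v :
  (forall l, adj (H l) = H l) -> rep H (vstar v) = adj (rep H v).
Proof.
move=> h; rewrite /rep adj_sum; apply: eq_bigr => l _.
by rewrite adjZ h mxE.
Qed.

Lemma rep_unit N (H : 'I_n.+1 -> 'M[C]_N) : rep H vunit = H 0.
Proof.
rewrite /rep (bigD1 0) //= big1 ?addr0 => [|l l0].
  by rewrite mxE !eqxx scale1r.
by rewrite mxE (negbTE l0) andbF scale0r.
Qed.

Lemma rep_bound N (H : 'I_n.+1 -> 'M[C]_N) (c : R) v :
  (forall l u w, 2 * complex.Re (hform (H l) u w) <= c * (vnormsq u + vnormsq w)) ->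
  forall u w, 2 * complex.Re (hform (rep H v) u w) <=
    (\sum_l l1norm (v 0 l)) * c * (vnormsq u + vnormsq w).
Proof.
move=> h u w; rewrite /rep hform_summ cRe_sum mulr_sumr !mulr_suml.
by apply: ler_sum => l _; rewrite hformZm; apply: hform_scale_bound.
Qed.

Lemma qform_rep k N (H : 'I_n.+1 -> 'M[C]_N) (x : 'M[V]_k) xi eta :
  qform (map_mx (rep H) x) xi eta =
  \sum_l \sum_i \sum_j x i j 0 l * hform (H l) (xi i) (eta j).
Proof.
rewrite exchange_big /=; apply: eq_bigr => i _.
rewrite exchange_big /=; apply: eq_bigr => j _.
by rewrite mxE hform_summ; apply: eq_bigr => l _; rewrite hformZm.
Qed.

End Rep.

(** * Operator systems from intersections of pulled-back cones *)

Section System.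
Variables (R : realType) (n : nat).
Local Notation C := R[i].
Local Notation V := 'rV[C]_n.+1.

Definition repPos N (H : 'I_n.+1 -> 'M[C]_N) k (x : 'M[V]_k) :=
  mo_pos (mx_order R N) k (map_mx (rep H) x).

Definition repB N (H : 'I_n.+1 -> 'M[C]_N) k t (x : 'M[V]_k) :=
  bpos (X := mx_order R N) t (map_mx (rep H) x).

(** The constant [c] will be common to all tuples of a family: one multiple of the unit then
    dominates an element in all cones at once, and infinite intersections still have an order
    unit. *)
Record bounded_tuple (c : R) N (H : 'I_n.+1 -> 'M[C]_N) : Prop := BoundedTuple {
  bounded_tuple0 : H 0 = 1%:M;
  bounded_tuple_sa : forall l, adj (H l) = H l;
  bounded_tuple_bound : forall l u w, 2 * complex.Re (hform (H l) u w) <= c * (vnormsq u + vnormsq w) }.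

(** The norm of a single cone controls all coordinates. One such tuple makes the intersection
    proper, its norm complete and its balls totally bounded, whatever the other cones are. *)
Definition separating N (H : 'I_n.+1 -> 'M[C]_N) :=
  forall k t (x : 'M[V]_k), 0 <= t -> repB H t x ->
    forall i j l, normsq (x i j 0 l) <= t ^+ 2.

Variables (I : Type) (N : I -> nat) (H : forall i, 'I_n.+1 -> 'M[C]_(N i)).
Variables (c : R) (i0 : I).
Hypothesis c0 : 0 <= c.
Hypothesis gH : forall i, bounded_tuple c (H i).
Hypothesis sep0 : separating (H i0).

(** The cone of [i0] is imposed for every [T], even the empty one. Carrier, involution and unit do
    not depend on [T]. *)
Definition tuple_order (T : set I) : matrixOrder R :=
  @MatrixOrder R V (@vstar R n) (@vunit R n)
    (fun k => [set x | forall i, i = i0 \/ T i -> repPos (H i) x]).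

Lemma map_rep_munitZ i k T t :
  map_mx (rep (H i)) (munitZ (tuple_order T) k t : 'M[V]_k) =
  munitZ (mx_order R (N i)) k t.
Proof.
apply/matrixP => p q; rewrite !mxE; case: eqP => _; last first.
  by rewrite !mulr0n raddf0.
by rewrite !mulr1n linearZ /= rep_unit (bounded_tuple0 (gH i)).
Qed.

Lemma map_rep_mstar i k T (x : 'M[V]_k) :
  map_mx (rep (H i)) (mstar (X := tuple_order T) x : 'M[V]_k) =
  mstar (X := mx_order R (N i)) (map_mx (rep (H i)) x).
Proof.
apply/matrixP => p q; rewrite !mxE /=.
by rewrite rep_star; [rewrite /adj | exact: (bounded_tuple_sa (gH i))].
Qed.

Lemma tuple_order_bpos T k t (x : 'M[V]_k) :
  bpos (X := tuple_order T) t x <-> forall i, i = i0 \/ T i -> repB (H i) t x.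
Proof.
suff E i : repPos (H i) (block_mx (munitZ (tuple_order T) k t) x (mstar (X := tuple_order T) x)
   (munitZ (tuple_order T) k t)) <-> repB (H i) t x.
  by split=> h i iT; have := h i iT; rewrite -E.
by rewrite /repPos /repB /bpos map_block_mx map_rep_munitZ map_rep_mstar.
Qed.

Definition nrm1 k (x : 'M[V]_k) : R := \sum_i \sum_j \sum_l l1norm (x i j 0 l).

Lemma nrm1_ge0 k (x : 'M[V]_k) : 0 <= nrm1 x.
Proof. by do 3 (apply: sumr_ge0 => ? _); apply: l1norm_ge0. Qed.

Lemma qform_rep_bound i k (x : 'M[V]_k) xi eta :
  2 * complex.Re (qform (map_mx (rep (H i)) x) xi eta) <=
    nrm1 x * c * (fam_normsq xi + fam_normsq eta).
Proof.
have -> : nrm1 x * c = \sum_p \sum_q (\sum_l l1norm (x p q 0 l)) * c.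
  by rewrite mulr_suml; apply: eq_bigr => p _; rewrite mulr_suml.
apply: qform_bound => [p q|p q u w].
  by rewrite mulr_ge0 //; apply: sumr_ge0 => ? _; apply: l1norm_ge0.
by rewrite mxE; apply: rep_bound; exact: (bounded_tuple_bound (gH i)).
Qed.

Lemma tuple_order_bpos_nrm1 T k (x : 'M[V]_k) : bpos (X := tuple_order T) (nrm1 x * c) x.
Proof.
by apply/tuple_order_bpos => i _; apply: bpos_of_bound => xi eta; apply: qform_rep_bound.
Qed.

Lemma mnorm_nrm1 T k (x : 'M[V]_k) : mnorm (X := tuple_order T) x <= nrm1 x * c.
Proof. by apply: (mnorm_le _ (tuple_order_bpos_nrm1 _)); rewrite mulr_ge0 ?nrm1_ge0. Qed.

Lemma tuple_order_lt T k (x : 'M[V]_k) t : mnorm (X := tuple_order T) x < t ->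
  exists r, [/\ 0 <= r, r < t & bpos (X := tuple_order T) r x].
Proof.
by apply: (mnorm_lt _ (tuple_order_bpos_nrm1 _)); rewrite mulr_ge0 ?nrm1_ge0.
Qed.

Lemma mnorm_coord T k (x : 'M[V]_k) t : mnorm (X := tuple_order T) x < t ->
  forall i j l, normsq (x i j 0 l) <= t ^+ 2.
Proof.
move=> /tuple_order_lt[r [r0 rt /tuple_order_bpos h]] i j l.
have /(_ i j l) := sep0 r0 (h _ (or_introl erefl)).
move/le_trans; apply; nra.
Qed.

Lemma rep_inj : injective (rep (H i0)).
Proof.
move=> u v /eqP; rewrite -subr_eq0 -raddfB /= => /eqP uv0.
have B : repB (H i0) 0 ((u - v)%:M : 'M[V]_1).
  apply/bpos_mx => xi eta; rewrite /qform !big_ord1 !mxE mulr1n uv0.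
  by rewrite /hform mulmx0 mul0mx mxE /= !mul0r mulr0 !addr0.
apply/rowP => l; apply/eqP; rewrite -subr_eq0 -normsq_eq0 eq_le normsq_ge0 andbT.
have := sep0 (lexx 0) B 0 0 l.
by rewrite [_%:M _ _]mxE mulr1n !mxE expr0n.
Qed.

Lemma map_rep_inj k (x y : 'M[V]_k) :
  map_mx (rep (H i0)) x = map_mx (rep (H i0)) y -> x = y.
Proof.
move=> e; apply/matrixP => p q; apply: rep_inj.
by have /matrixP/(_ p q) := e; rewrite !mxE.
Qed.

Lemma real_cauchy (u : nat -> R) :
  (forall e, 0 < e -> exists M, forall i j, (M <= i)%N -> (M <= j)%N ->
     `|u i - u j| < e) ->
  exists l, forall e, 0 < e -> exists M, forall i, (M <= i)%N -> `|u i - l| < e.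
Proof.
move=> h.
have cu : cvg (u @ \oo).
  apply/cauchy_cvgP/cauchy_exP => e e0; have [M hM] := h e e0.
  by exists (u M); exists M => // i /= Mi; exact: hM.
exists (lim (u @ \oo)) => e e0.
have /cvgrPdist_lt/(_ e e0)[M _ hM] := cu.
by exists M => i Mi; rewrite distrC; exact: hM.
Qed.

Lemma normRe_le (z : C) (t : R) : 0 <= t -> normsq z <= t ^+ 2 ->
  `|complex.Re z| <= t /\ `|complex.Im z| <= t.
Proof.
case: z => a b t0; rewrite /normsq /= => h; split.
  by rewrite -ler_sqr ?nnegrE // real_normK ?num_real //; apply: le_trans h; rewrite lerDl sqr_ge0.
by rewrite -ler_sqr ?nnegrE // real_normK ?num_real //; apply: le_trans h; rewrite lerDr sqr_ge0.
Qed.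

(** Norm and coordinates bound each other, by [mnorm_coord] and [mnorm_nrm1], so the limit can be
    taken in each real coordinate. *)
Lemma tuple_order_complete T (u : nat -> tuple_order T) :
    (forall e : R, 0 < e -> exists N, forall i j,
      (N <= i)%N -> (N <= j)%N -> onorm (u i - u j) < e) ->
    exists l, forall e : R, 0 < e -> exists N, forall i,
      (N <= i)%N -> onorm (u i - l) < e.
Proof.
move=> h.
have hc l : forall e : R, 0 < e -> exists M, forall i j, (M <= i)%N -> (M <= j)%N ->
     `|complex.Re ((u i : V) 0 l) - complex.Re ((u j : V) 0 l)| < e /\
     `|complex.Im ((u i : V) 0 l) - complex.Im ((u j : V) 0 l)| < e.
  move=> e e0; have e20 : 0 < e / 2 by rewrite divr_gt0.
  have [M hM] := h _ e20; exists M => i j Mi Mj.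
  have := mnorm_coord (hM i j Mi Mj) 0 0 l; rewrite mxE eqxx mulr1n !mxE.
  move=> /(normRe_le (ltW e20)).
  case: ((u i : V) 0 l) => a b; case: ((u j : V) 0 l) => a' b' /= -[h1 h2].
  by split; apply: le_lt_trans (_ : e / 2 < e); rewrite ?h1 ?h2 //; lra.
have /choice[lr hlr] : forall l, exists x, forall e : R, 0 < e -> exists M, forall i,
    (M <= i)%N -> `|complex.Re ((u i : V) 0 l) - x| < e.
  move=> l; apply: real_cauchy => e /(hc l)[M hM]; exists M => i j Mi Mj.
  by case: (hM i j Mi Mj).
have /choice[li hli] : forall l, exists x, forall e : R, 0 < e -> exists M, forall i,
    (M <= i)%N -> `|complex.Im ((u i : V) 0 l) - x| < e.
  move=> l; apply: real_cauchy => e /(hc l)[M hM]; exists M => i j Mi Mj.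
  by case: (hM i j Mi Mj).
exists (\row_l (lr l +i* li l) : V) => e e0.
(* The summand 1 keeps the denominator positive when [c = 0] and makes the final estimate strict. *)
pose d := e / (n.+1%:R * 2 * c + 1).
have D0 : 0 < n.+1%:R * 2 * c + 1 by rewrite ltr_wpDl // !mulr_ge0.
have d0 : 0 < d by rewrite divr_gt0.
have /choice[Mr hMr] : forall l, exists M, forall i, (M <= i)%N ->
  `|complex.Re ((u i : V) 0 l) - lr l| < d by move=> l; exact: hlr.
have /choice[Mi hMi] : forall l, exists M, forall i, (M <= i)%N ->
  `|complex.Im ((u i : V) 0 l) - li l| < d by move=> l; exact: hli.
exists (\sum_l (Mr l + Mi l))%N => i Mle.
apply: (@le_lt_trans _ _ (n.+1%:R * 2 * c * d)); last first.
  rewrite /d mulrCA -[ltRHS]mulr1 ltr_pM2l // ltr_pdivrMr // mul1r.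
  by rewrite ltrDl.
have := @mnorm_nrm1 T 1 ((u i - (\row_l (lr l +i* li l) : V) : V)%:M).
move/le_trans; apply; rewrite mulrAC ler_wpM2r //.
rewrite /nrm1 !big_ord1 mxE eqxx mulr1n.
apply: (@le_trans _ _ (\sum_(l < n.+1) (2 * d))).
  apply: ler_sum => l _; rewrite !mxE.
  have le1 : (Mr l + Mi l <= i)%N.
    by apply: leq_trans Mle; rewrite (bigD1 l) //= leq_addr.
  have := hMr l i (leq_trans (leq_addr _ _) le1).
  have := hMi l i (leq_trans (leq_addl _ _) le1).
  by case: ((u i : V) 0 l) => a b /=; rewrite /l1norm /=; lra.
by rewrite sumr_const card_ord -[leLHS](mulr_natl (2 * d) n.+1) mulrA.
Qed.

Lemma map_rep_conjm i k m (A B : 'M[C]_(k, m)) T (x : 'M[tuple_order T]_k) :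
  map_mx (rep (H i)) (lmulm (X := tuple_order T) (adj A) (rmulm (X := tuple_order T) x B)) =
  lmulm (X := mx_order R (N i)) (adj A)
    (rmulm (X := mx_order R (N i)) (map_mx (rep (H i)) x) B).
Proof.
apply/matrixP => p q; rewrite mxE (@conjmE R (tuple_order T)) (@conjmE R (mx_order R (N i))).
rewrite raddf_sum; apply: eq_bigr => r _; rewrite raddf_sum; apply: eq_bigr => s _.
by rewrite mxE; exact: linearZZ.
Qed.

Lemma tuple_order_axioms T : operator_system_axioms (tuple_order T).
Proof.
split.
- by move=> v; apply/rowP => l; rewrite !mxE conjcK.
- by move=> v w; apply/rowP => l; rewrite !mxE rmorphD.
- by move=> a v; apply/rowP => l; rewrite !mxE rmorphM.
- move=> k x /(_ i0 (or_introl erefl)) /mxposP[sa _].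
  apply: map_rep_inj; rewrite (map_rep_mstar i0 T).
  by apply/matrixP => p q; rewrite sa !mxE.
- move=> k x y hx hy i iT; rewrite /repPos map_mxD.
  by apply: mx_posD; [exact: hx|exact: hy].
- move=> k m A x hx i iT; rewrite /repPos (map_rep_conjm i A A x).
  by apply: mx_pos_conj; exact: hx.
- move=> k x /(_ i0 (or_introl erefl)) h1 /(_ i0 (or_introl erefl)) h2.
  apply: (@map_rep_inj k x 0); rewrite map_mx0; apply: mx_proper; first exact: h1.
  by rewrite -map_mxN; exact: h2.
- apply/negP => /eqP /rowP/(_ 0); rewrite !mxE !eqxx => /eqP.
  by rewrite oner_eq0.
- by apply/rowP => l; rewrite !mxE rmorph_nat.
- move=> k x sx; exists (nrm1 x * c + 1); first by rewrite ltr_wpDl // mulr_ge0 // nrm1_ge0.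
  move=> i iT; rewrite /repPos map_mxD (map_rep_munitZ i k T).
  apply/mxposP; split=> [p q|xi].
    rewrite mxE [in RHS]mxE adjD -munitZ_sa; congr (_ + _).
    by rewrite -[in LHS]sx (map_rep_mstar i T) !mxE.
  rewrite qformD cReD qform_munitZ.
  have := @qform_rep_bound i k x xi (fun i => - xi i); rewrite qformNr cReN fam_normsqN.
  have := fam_normsq_ge0 xi; move: (complex.Re _) (fam_normsq _) (nrm1 _ * _) => a s t; nra.
- move=> k x h i iT; apply: mx_archi => t t0.
  by have := h t t0 i iT; rewrite /repPos map_mxD (map_rep_munitZ i k T).
- exact: tuple_order_complete.
Qed.

Definition tuple_system T : operatorSystem R := OperatorSystem (tuple_order_axioms T).

End System.

(** * Locality of formulas *)

Section Locality.
Variable R : realType.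

Fixpoint formula_level (G : seq domain) (f : formula R G) : nat :=
  match f with
  | FNorm _ k _ => k
  | FConn _ p _ _ g => \max_(i < p) formula_level (g i)
  | FSup _ d g => maxn (dsort d) (formula_level g)
  | FInf _ d g => maxn (dsort d) (formula_level g)
  end.

Fixpoint context_level (G : seq domain) : nat :=
  if G is d :: G' then maxn (dsort d) (context_level G') else 0.

Variables (V : lmodType R[i]) (st : V -> V) (un : V).
Variables (p1 p2 : forall n, set 'M[V]_n).
Local Notation Y1 := (MatrixOrder st un p1).
Local Notation Y2 := (MatrixOrder st un p2).
Hypothesis a1 : operator_system_axioms Y1.
Hypothesis a2 : operator_system_axioms Y2.
Local Notation X1 := (OperatorSystem a1).
Local Notation X2 := (OperatorSystem a2).

(** As the two structures share carrier, involution and unit, their environments and the values of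
    terms coincide by conversion; cones enter only through [mnorm]. *)
Definition cones_agree K := forall k, (k <= K)%N -> @p1 k = @p2 k.

Lemma cones_agree_le K L : (L <= K)%N -> cones_agree K -> cones_agree L.
Proof. by move=> LK h k kL; apply: h; apply: leq_trans LK. Qed.

Lemma mnorm_agree k (x : 'M[V]_k) : cones_agree (k + k) ->
  mnorm (X := Y1) x = mnorm (X := Y2) x.
Proof. by move=> h; rewrite /mnorm /= h. Qed.

Lemma ball_agree d : cones_agree (dsort d + dsort d) -> @ball_dom R X1 d = @ball_dom R X2 d.
Proof.
move=> h; apply/funext => x; rewrite /ball_dom /=.
by apply/propext; rewrite (mnorm_agree x h).
Qed.

(** A norm at level [k] is read off the cone at level [k + k]. Terms are computed without the cones,
    so only the sorts under norms and of quantified balls count. *)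
Lemma eval_agree G (f : formula R G) : cones_agree (formula_level f + formula_level f) ->
  forall v : env X1 G, eval (X := X1) f v = eval (X := X2) f v.
Proof.
elim: f => {G} [G k t|G p u cu g IH|G d f IH|G d f IH] /= h v.
- exact: mnorm_agree.
- congr u; apply/rowP => i; rewrite !mxE; apply: IH; apply: cones_agree_le h.
  by apply: leq_add; apply: (leq_bigmax_cond (F := fun i => formula_level (g i))).
- have h1 : cones_agree (dsort d + dsort d).
    by apply: cones_agree_le h; rewrite leq_add // leq_maxl.
  have h2 : cones_agree (formula_level f + formula_level f).
    by apply: cones_agree_le h; rewrite leq_add // leq_maxr.
  congr sup; apply/seteqP; split=> r [a da ->]; exists a.
  + by rewrite -(ball_agree h1).
  + exact: (IH h2).
  + by rewrite (ball_agree h1).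
  + by symmetry; exact: (IH h2).
- have h1 : cones_agree (dsort d + dsort d).
    by apply: cones_agree_le h; rewrite leq_add // leq_maxl.
  have h2 : cones_agree (formula_level f + formula_level f).
    by apply: cones_agree_le h; rewrite leq_add // leq_maxr.
  congr inf; apply/seteqP; split=> r [a da ->]; exists a.
  + by rewrite -(ball_agree h1).
  + exact: (IH h2).
  + by rewrite (ball_agree h1).
  + by symmetry; exact: (IH h2).
Qed.

Lemma env_dom_agree G : cones_agree (context_level G + context_level G) ->
  forall v : env X1 G, @env_dom R X1 G v <-> @env_dom R X2 G v.
Proof.
elim: G => [//|d G IH] /= h [x v] /=.
have h1 : cones_agree (dsort d + dsort d).
  by apply: cones_agree_le h; rewrite leq_add // leq_maxl.
have h2 : cones_agree (context_level G + context_level G).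
  by apply: cones_agree_le h; rewrite leq_add // leq_maxr.
by rewrite (ball_agree h1); split=> -[? /(IH h2)].
Qed.

Lemma env_close_agree e G : cones_agree (context_level G + context_level G) ->
  forall v w : env X1 G, @env_close R X1 e G v w <-> @env_close R X2 e G v w.
Proof.
elim: G => [//|d G IH] /= h [x v] [y w] /=.
have h1 : cones_agree (dsort d + dsort d).
  by apply: cones_agree_le h; rewrite leq_add // leq_maxl.
have h2 : cones_agree (context_level G + context_level G).
  by apply: cones_agree_le h; rewrite leq_add // leq_maxr.
have -> : mnorm (X := Y1) (x - y) = mnorm (X := Y2) (x - y) by apply: mnorm_agree.
by split=> -[? /(IH h2)].
Qed.

End Locality.

(** * Total boundedness *)

Section Nets.
Variables (R : realType) (n : nat).
Local Notation C := R[i].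
Local Notation V := 'rV[C]_n.+1.

Lemma interval_net (M e : R) : 0 < e -> exists B (code : R -> 'I_B.+1),
  forall a b, `|a| <= M -> `|b| <= M -> code a = code b -> `|a - b| <= e.
Proof.
move=> e0; exists (Num.truncn (2 * M / e)).
exists (fun a => inord (Num.truncn ((a + M) / e))) => a b.
have B (x : R) : `|x| <= M -> 0 <= (x + M) / e /\ (x + M) / e <= 2 * M / e.
  rewrite ler_norml => /andP[h1 h2]; split; first by rewrite divr_ge0 ?(ltW e0) //; lra.
  by rewrite ler_pM2r ?invr_gt0 //; lra.
move=> /B[a0 aM] /B[b0 bM] /(congr1 val) /=.
rewrite !inordK; last 2 first.
- by rewrite ltnS; apply: le_truncn.
- by rewrite ltnS; apply: le_truncn.
move=> eq; have := truncn_itv a0; have := truncn_itv b0; rewrite eq.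
move=> /andP[h1 h2] /andP[h3 h4].
have -> : a - b = ((a + M) / e - (b + M) / e) * e by field; rewrite gt_eqF.
rewrite normrM (gtr0_norm e0) -[leRHS]mul1r ler_pM2r // ler_norml.
by rewrite -natr1 in h2 h4; apply/andP; split; lra.
Qed.

Variables (I : Type) (N : I -> nat) (H : forall i, 'I_n.+1 -> 'M[C]_(N i)).
Variables (c : R) (i0 : I).
Hypothesis c0 : 0 <= c.
Hypothesis gH : forall i, bounded_tuple c (H i).
Hypothesis sep0 : separating (H i0).
Variable T : set I.
Local Notation X := (tuple_system c0 gH sep0 T).

Lemma mnorm_0 k : mnorm (X := X) (0 : 'M[V]_k) <= 0.
Proof.
apply: le_trans (mnorm_nrm1 i0 c0 gH T (0 : 'M[V]_k)) _.
rewrite /nrm1 big1 ?mul0r // => i _; rewrite big1 // => j _; rewrite big1 // => l _.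
by rewrite !mxE /l1norm /= normr0 addr0.
Qed.

Lemma ball_net d (e : R) : 0 < e -> exists (F : finType) (w : F -> 'M[V]_(dsort d)),
  (forall f, @ball_dom R X d (w f)) /\
  forall x, @ball_dom R X d x -> exists f, mnorm (X := X) (x - w f) < e.
Proof.
move=> e0; pose k := dsort d; pose M : R := (dom_rad d)%:R + 1.
pose D : R := k%:R * (k%:R * (n.+1%:R * 2)) * c + 1.
have D0 : 0 < D by rewrite ltr_wpDl // !mulr_ge0.
have [B [code codeP]] := @interval_net M (e / D) (divr_gt0 e0 D0).
pose F : finType := {ffun 'I_k * 'I_k * 'I_n.+1 -> 'I_B.+1 * 'I_B.+1}.
pose cd (x : 'M[V]_k) : F := [ffun p =>
  (code (complex.Re (x p.1.1 p.1.2 0 p.2)), code (complex.Im (x p.1.1 p.1.2 0 p.2)))].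
have zero_in : @ball_dom R X d (0 : 'M[V]_k).
  by apply: le_trans (mnorm_0 _) _.
(* A code met by the ball gets a representative in the ball with the same code; the other codes get
   the default 0. *)
have /choice[w hw] : forall f : F, exists x : 'M[V]_k, @ball_dom R X d x /\
    ((exists2 y, @ball_dom R X d y & cd y = f) -> cd x = f).
  move=> f; have [[y yb yf]|no] := pselect (exists2 y, @ball_dom R X d y & cd y = f).
    by exists y.
  by exists 0.
exists F, w; split=> [f|x xb]; first by case: (hw f).
exists (cd x); have [wb /(_ (ex_intro2 _ _ _ xb erefl)) wx] := hw (cd x).
have M0 : 0 <= M by rewrite addr_ge0.
have cM (y : 'M[V]_k) : @ball_dom R X d y -> forall i j l,
    `|complex.Re (y i j 0 l)| <= M /\ `|complex.Im (y i j 0 l)| <= M.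
  move=> yb i j l; apply: normRe_le => //.
  apply: (mnorm_coord c0 gH sep0 (T := T)).
  by apply: (le_lt_trans yb); rewrite /M ltrDl.
apply: le_lt_trans (mnorm_nrm1 i0 c0 gH T (x - w (cd x) : 'M[V]_k)) _.
have : nrm1 (x - w (cd x) : 'M[V]_k) <= k%:R * (k%:R * (n.+1%:R * 2)) * (e / D).
  apply: (@le_trans _ _ (\sum_(i < k) \sum_(j < k) \sum_(l < n.+1) (2 * (e / D)))).
    apply: ler_sum => i _; apply: ler_sum => j _; apply: ler_sum => l _.
    rewrite !mxE /l1norm.
    have /ffunP/(_ (i, j, l)) := wx; rewrite !ffunE => -[/= e1 e2].
    have [x1 x2] := cM x xb i j l; have [w1 w2] := cM _ wb i j l.
    have := codeP _ _ x1 w1 (esym e1); have := codeP _ _ x2 w2 (esym e2).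
    case: (x i j 0 l) => ? ?; case: (w (cd x) i j 0 l) => ? ? /=; lra.
  rewrite !sumr_const !card_ord -!mulrnA -[leLHS](mulr_natl (2 * (e / D))) !natrM.
  by rewrite le_eqVlt; apply/orP; left; apply/eqP; ring.
move=> h; apply: le_lt_trans (ler_wpM2r c0 h) _.
rewrite mulrAC mulrCA -[ltRHS]mulr1 ltr_pM2l // ltr_pdivrMr // mul1r /D.
by rewrite ltrDl.
Qed.

Lemma env_net G (e : R) : 0 < e -> exists (F : finType) (w : F -> env X G),
  (forall f, env_dom (w f)) /\
  forall v, env_dom v -> exists f, env_close e v (w f).
Proof.
move=> e0; elim: G => [|d G [F [w [wd wc]]]] /=.
  by exists unit, (fun=> tt); split=> // v _; exists tt.
have [F' [w' [wd' wc']]] := ball_net d e0.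
exists (F' * F)%type, (fun f => (w' f.1, w f.2)); split=> [f|[x v] [/= xb vd]].
  by split=> /=; [exact: wd'|exact: wd].
have [f' hf'] := wc' x xb; have [f hform] := wc v vd.
by exists (f', f).
Qed.

End Nets.

(** * Exactness for finite index sets *)

Section UnitNorm.
Variable R : realType.
Local Notation C := R[i].

Lemma hform1_bound N (u w : 'cV[C]_N) :
  2 * complex.Re (hform 1%:M u w) <= vnormsq u + vnormsq w.
Proof.
have := vnormsq_ge0 (u - w).
have : vnormsq (u - w) = complex.Re (hform 1%:M (u - w) (u - w)) by rewrite hform1.
rewrite hformDl !hformDr !hformNr !hformNl opprK.
rewrite !cReD !cReN !hform1 -[hform 1%:M w u]conjcK hform_conj adj1 cRe_conj /= => -> h.
lra.
Qed.

Lemma bpos_mx_unit N (t : R) : (0 < N)%N ->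
  bpos (X := mx_order R N) t ((1%:M : 'M[C]_N)%:M : 'M[_]_1) -> 1 <= t.
Proof.
case: N => // N _ /bpos_mx h.
pose e : 'cV[C]_N.+1 := delta_mx 0 0.
have e1 : vnormsq e = 1.
  rewrite /vnormsq (bigD1 0) //= big1 ?addr0 => [|r r0].
    by rewrite mxE !eqxx /normsq /= expr1n expr0n addr0.
  by rewrite mxE (negbTE r0) /normsq /= expr0n addr0.
have := h (fun=> e) (fun=> - e); rewrite /qform /fam_normsq !big_ord1 mxE mulr1n.
by rewrite hformNr cReN hform1 vnormsqN e1 /=; lra.
Qed.

Lemma mnorm_mx_unit N : (0 < N)%N ->
  mnorm (X := mx_order R N) ((1%:M : 'M[C]_N)%:M : 'M[_]_1) = 1.
Proof.
move=> N0; have b1 : bpos (X := mx_order R N) 1 ((1%:M : 'M[C]_N)%:M : 'M[_]_1).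
  apply: bpos_of_bound => xi eta; rewrite mul1r /qform /fam_normsq !big_ord1 mxE mulr1n.
  exact: hform1_bound.
apply/eqP; rewrite eq_le mnorm_le //= leNgt; apply/negP => lt1.
have [r [_ r1 /(bpos_mx_unit N0)]] := mnorm_lt ler01 b1 lt1.
by rewrite leNgt r1.
Qed.

End UnitNorm.

Section Embedding.
Variables (R : realType) (E : operatorSystem R) (D : nat).
Local Notation C := R[i].
Variable phi : {linear E -> mx_order R D}.
Hypothesis phi_inj : injective phi.
Hypothesis phi1 : phi (mo_unit E) = 1%:M.
Hypothesis phi_star : forall v, phi (mo_star E v) = adj (phi v : 'M[C]_D).
Hypothesis phi_pos : forall k (x : 'M[E]_k),
  mo_pos E k x <-> mo_pos (mx_order R D) k (map_mx phi x).

Lemma mnorm_emb k (x : 'M[E]_k) : mnorm (map_mx phi x : 'M[mx_order R D]_k) = mnorm x.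
Proof.
rewrite /mnorm; congr inf; apply/seteqP.
have E1 t : map_mx phi (munitZ E k t) = munitZ (mx_order R D) k t.
  apply/matrixP => p q; rewrite !mxE; case: eqP => _; last first.
    by rewrite !mulr0n raddf0.
  by rewrite !mulr1n linearZ /= phi1.
have E2 : map_mx phi (mstar x) = mstar (X := mx_order R D) (map_mx phi x).
  by apply/matrixP => p q; rewrite !mxE phi_star.
have E3 t : mo_pos E _ (block_mx (munitZ E k t) x (mstar x) (munitZ E k t)) <->
   mo_pos (mx_order R D) _ (block_mx (munitZ (mx_order R D) k t) (map_mx phi x)
     (mstar (X := mx_order R D) (map_mx phi x)) (munitZ (mx_order R D) k t)).
  by rewrite phi_pos map_block_mx E1 E2.
by split=> t [t0 ht]; split=> //; apply/E3.
Qed.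

Lemma emb_dim_gt0 : (0 < D)%N.
Proof.
rewrite lt0n; apply/eqP => D0; have /eqP := os_unit_neq0 (os_axioms E); apply.
apply: phi_inj; apply/matrixP => i; have := ltn_ord i; by rewrite {2}D0.
Qed.

(** A unital complete order embedding is completely isometric, so a constant sequence works; both
    cb-norms equal 1 and are attained at the unit. *)
Lemma emb_one_exact_fd : one_exact_fd E.
Proof.
(* Off the range of [phi] the value is the default 0; the cb-norm of [psi] is taken on that range
   only. *)
pose psi (A : mx_order R D) : E := xget 0 [set v | phi v = A].
have psiK : cancel phi psi.
  move=> v; apply: phi_inj; rewrite /psi.
  exact: (xgetPex 0 (ex_intro [set w | phi w = phi v] v erefl)).
exists (fun=> D), (fun=> phi), (fun=> psi); split=> //.
have phi_u : map_mx phi ((mo_unit E)%:M : 'M[_]_1) = (1%:M : 'M[C]_D)%:M.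
  by apply/matrixP => i j; rewrite !ord1 !mxE !mulr1n.
have u1 : mnorm ((mo_unit E)%:M : 'M[_]_1) = 1.
  by rewrite -mnorm_emb phi_u mnorm_mx_unit // emb_dim_gt0.
have cb1 : cb_norm setT phi = 1%E.
  apply/eqP; rewrite eq_le; apply/andP; split.
    by apply: ge_ereal_sup => r [k [x [_ x1 ->]]]; rewrite mnorm_emb lee_fin.
  apply: ereal_sup_ubound; exists 1%N, ((mo_unit E)%:M : 'M[_]_1).
  by rewrite mnorm_emb u1.
have psi_map k (x : 'M[mx_order R D]_k) : (forall i j, range phi (x i j)) ->
    map_mx phi (map_mx psi x) = x.
  move=> rx; apply/matrixP => i j; rewrite !mxE.
  by have [v _ <-] := rx i j; rewrite psiK.
have cb2 : cb_norm (range phi) psi = 1%E.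
  apply/eqP; rewrite eq_le; apply/andP; split.
    apply: ge_ereal_sup => r [k [x [rx x1 ->]]].
    by rewrite -mnorm_emb psi_map // lee_fin.
  apply: ereal_sup_ubound; exists 1%N, (map_mx phi ((mo_unit E)%:M : 'M[_]_1)); split.
  - by move=> i j; rewrite mxE; exists ((mo_unit E)%:M i j).
  - by rewrite mnorm_emb u1.
  - rewrite -mnorm_emb psi_map ?mnorm_emb ?u1 // => i j.
    by rewrite mxE; exists ((mo_unit E)%:M i j).
by rewrite cb1 cb2 mule1; apply: cvg_cst.
Qed.

End Embedding.

Section FiniteSum.
Variables (R : realType) (n : nat).
Local Notation C := R[i].
Local Notation V := 'rV[C]_n.+1.

Definition dsum_tuple N1 N2 (H1 : 'I_n.+1 -> 'M[C]_N1) (H2 : 'I_n.+1 -> 'M[C]_N2) l :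
  'M[C]_(N1 + N2) := block_mx (H1 l) 0 0 (H2 l).

Lemma rep_dsum N1 N2 (H1 : 'I_n.+1 -> 'M[C]_N1) (H2 : 'I_n.+1 -> 'M[C]_N2) v :
  rep (dsum_tuple H1 H2) v = block_mx (rep H1 v) 0 0 (rep H2 v).
Proof.
rewrite /rep; apply/matrixP => i j; rewrite summxE.
rewrite -(fintype.splitK i) -(fintype.splitK j).
case: (fintype.split i) => p; case: (fintype.split j) => q /=;
  rewrite ?(block_mxEul, block_mxEur, block_mxEdl, block_mxEdr) ?summxE.
- by apply: eq_bigr => l _; rewrite [LHS]mxE block_mxEul [RHS]mxE.
- by rewrite [RHS]mxE big1 // => l _; rewrite mxE block_mxEur mxE mulr0.
- by rewrite [RHS]mxE big1 // => l _; rewrite mxE block_mxEdl mxE mulr0.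
- by apply: eq_bigr => l _; rewrite [LHS]mxE block_mxEdr [RHS]mxE.
Qed.

Lemma hform_block N1 N2 (A : 'M[C]_N1) (D : 'M[C]_N2) (u v : 'cV[C]_(N1 + N2)) :
  hform (block_mx A 0 0 D) u v = hform A (usubmx u) (usubmx v) + hform D (dsubmx u) (dsubmx v).
Proof.
rewrite /hform -{1}[u]vsubmxK -{1}[v]vsubmxK /adj tr_col_mx map_row_mx.
rewrite mul_row_block mul_row_col !mulmx0 addr0 add0r mxE.
by congr (_ + _).
Qed.

Lemma repPos_dsum N1 N2 (H1 : 'I_n.+1 -> 'M[C]_N1) (H2 : 'I_n.+1 -> 'M[C]_N2)
    k (x : 'M[V]_k) :
  repPos (dsum_tuple H1 H2) x <-> repPos H1 x /\ repPos H2 x.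
Proof.
have adjb (A : 'M[C]_N1) (D : 'M[C]_N2) :
  adj (block_mx A 0 0 D) = block_mx (adj A) 0 0 (adj D).
  by rewrite /adj tr_block_mx map_block_mx !trmx0 !map_mx0.
have Q xi eta : qform (map_mx (rep (dsum_tuple H1 H2)) x) xi eta =
   qform (map_mx (rep H1) x) (fun i => usubmx (xi i)) (fun i => usubmx (eta i)) +
   qform (map_mx (rep H2) x) (fun i => dsubmx (xi i)) (fun i => dsubmx (eta i)).
  rewrite /qform -big_split /=; apply: eq_bigr => i _; rewrite -big_split /=.
  by apply: eq_bigr => j _; rewrite !mxE rep_dsum hform_block.
split=> [/mxposP[sa h]|[/mxposP[s1 h1] /mxposP[s2 h2]]].
  split; apply/mxposP; split.
  - move=> i j; have := sa i j; rewrite !mxE !rep_dsum adjb.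
    by move=> /eq_block_mx[].
  - move=> xi; have := h (fun i => col_mx (xi i) 0); rewrite Q.
    under [X in qform _ X _ + _]eq_fun do rewrite col_mxKu.
    under [X in qform _ _ X + _]eq_fun do rewrite col_mxKu.
    under [X in _ + qform _ X _]eq_fun do rewrite col_mxKd.
    under [X in _ + qform _ _ X]eq_fun do rewrite col_mxKd.
    rewrite [X in _ + X]big1 ?addr0 // => i _; rewrite big1 // => j _.
    by rewrite /hform mulmx0 mxE.
  - move=> i j; have := sa i j; rewrite !mxE !rep_dsum adjb.
    by move=> /eq_block_mx[].
  - move=> xi; have := h (fun i => col_mx 0 (xi i)); rewrite Q.
    under [X in qform _ X _ + _]eq_fun do rewrite col_mxKu.
    under [X in qform _ _ X + _]eq_fun do rewrite col_mxKu.
    under [X in _ + qform _ X _]eq_fun do rewrite col_mxKd.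
    under [X in _ + qform _ _ X]eq_fun do rewrite col_mxKd.
    rewrite [X in X + _]big1 ?add0r // => i _; rewrite big1 // => j _.
    by rewrite /hform mulmx0 mxE.
apply/mxposP; split=> [i j|xi].
  rewrite !mxE !rep_dsum adjb.
  by have := s1 i j; have := s2 i j; rewrite !mxE => <- <-.
by rewrite Q cReD addr_ge0.
Qed.

Variables (I : Type) (N : I -> nat) (H : forall i, 'I_n.+1 -> 'M[C]_(N i)).
Variables (c : R) (i0 : I).
Hypothesis c0 : 0 <= c.
Hypothesis gH : forall i, bounded_tuple c (H i).
Hypothesis sep0 : separating (H i0).

Lemma finite_rep (s : seq I) : exists D (K : 'I_n.+1 -> 'M[C]_D),
  [/\ K 0 = 1%:M, forall l, adj (K l) = K l,
      forall v, rep K v = 0 -> rep (H i0) v = 0 &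
      forall k (x : 'M[V]_k), repPos K x <->
        forall i, i = i0 \/ List.In i s -> repPos (H i) x].
Proof.
elim: s => [|j s [D [K [K0 Ks Kz Kp]]]].
  exists (N i0), (H i0); split=> //; [exact: bounded_tuple0 (gH i0)|exact: bounded_tuple_sa (gH i0)|].
  by move=> k x; split=> [h i [->|]//|]; apply; left.
exists (N j + D)%N, (dsum_tuple (H j) K); split.
- by rewrite /dsum_tuple K0 (bounded_tuple0 (gH j)) -scalar_mx_block.
- move=> l; rewrite /dsum_tuple /adj tr_block_mx map_block_mx !trmx0 !map_mx0.
  by congr block_mx; [exact: (bounded_tuple_sa (gH j))|exact: Ks].
- by move=> v; rewrite rep_dsum => /(congr1 drsubmx); rewrite block_mxKdr => h; apply: Kz; rewrite h; apply/matrixP => p q; rewrite !mxE.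
- move=> k x; rewrite repPos_dsum Kp; split.
    by move=> [hj h] i [->|[<-|]]; [apply: h; left|done|move=> ?; apply: h; right].
  move=> h; split; first by apply: h; right; left.
  by move=> i [->|?]; apply: h; [left|right; right].
Qed.

Lemma finite_one_exact (s : seq I) :
  one_exact (tuple_system c0 gH sep0 [set i | List.In i s]).
Proof.
move=> E f fe _; have [D [K [K0 Ks Kz Kp]]] := finite_rep s.
pose phi : {linear E -> mx_order R D} := [the {linear E -> _} of rep K \o f].
apply: (@emb_one_exact_fd R E D phi).
- move=> u v /= /eqP; rewrite -subr_eq0 -raddfB -raddfB /= => /eqP /Kz h.
  have := @rep_inj _ _ _ _ _ _ sep0 (f (u - v)) 0; rewrite raddf0 => /(_ h).
  rewrite -[X in _ = X -> _](raddf0 f) => /(ose_inj fe) /eqP.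
  by rewrite subr_eq0 => /eqP.
- by rewrite /= (ose_unit fe) rep_unit K0.
- by move=> v; rewrite /= (ose_star fe) rep_star.
- move=> k x; rewrite (ose_pos fe).
  have -> : map_mx phi x = map_mx (rep K) (map_mx f x : 'M[V]_k).
    by apply/matrixP => p q; rewrite !mxE.
  by split=> h; [apply/Kp|apply/Kp]; exact: h.
Qed.

End FiniteSum.

(** * Low-rank spectral gaps *)

Section Spectral.
Variable R : realType.
Local Notation C := R[i].

Lemma trmxC_adj m n (A : 'M[C]_(m, n)) : map_mx Num.conj A^T = adj A.
Proof. by apply/matrixP => i j; rewrite !mxE. Qed.

Lemma spectral_adj n (G : 'M[C]_n) : adj G = G ->
  exists (W : 'M[C]_n) (g : 'rV[C]_n),
    [/\ W *m adj W = 1%:M, adj W *m W = 1%:M & W *m G *m adj W = diag_mx g].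
Proof.
move=> sG; have nG : G \is normalmx.
  by apply/normalmxP; rewrite trmxC_adj sG.
have /orthomx_spectralP E := nG; set W := spectralmx G in E.
have uW : W \is unitarymx by apply: spectral_unitarymx.
have WW : W *m adj W = 1%:M by rewrite -trmxC_adj; exact/unitarymxP.
have WW' : adj W *m W = 1%:M by apply: mulmx1C.
exists W, (spectral_diag G); split=> //.
by rewrite {1}E invmx_unitary // trmxC_adj -!mulmxA WW mulmx1 mulmxA WW mul1mx.
Qed.

(** Gram-Schmidt on the columns, completed to [k] orthonormal columns when they are dependent;
    [k <= m] leaves room for this. *)
Lemma thin_factor m k (A : 'M[C]_(m, k)) : (k <= m)%N ->
  exists (al : 'M[C]_(m, k)) (S : 'M[C]_k), A = al *m S /\ adj al *m al = 1%:M.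
Proof.
move=> km; have /submxP[D hD] := schmidt_sub A^T.
have /unitarymxP uB := schmidt_unitarymx A^T km.
exists (schmidt A^T)^T, D^T; split; first by rewrite -trmx_mul -hD trmxK.
apply: (can_inj (@trmxK _ _ _)); rewrite trmx_mul trmxK trmx1 -uB; congr (_ *m _).
by apply/matrixP => i j; rewrite !mxE.
Qed.

(** Keeping the rows and columns of the nonzero entries leaves an invertible diagonal block. *)
Lemma rank_diag_count n (g : 'rV[C]_n) : (#|[pred a | g 0%R a != 0%R]| <= \rank (diag_mx g))%N.
Proof.
pose J := [pred a | g 0%R a != 0]; pose f (i : 'I_#|J|) := enum_val i : 'I_n.
pose P : 'M[C]_(#|J|, n) := rowsub f 1%:M.
have E : P *m diag_mx g *m P^T = diag_mx (\row_i g 0 (f i)).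
  apply/matrixP => i j; rewrite !mxE (bigD1 (f j)) //= big1 ?addr0 => [|p pj]; last first.
    by rewrite !mxE eq_sym (negbTE pj) mulr0.
  rewrite !mxE eqxx mulr1 (bigD1 (f i)) //= big1 ?addr0 => [|p pi]; last first.
    by rewrite !mxE eq_sym (negbTE pi) mul0r.
  by rewrite !mxE eqxx mul1r (inj_eq enum_val_inj).
have U : diag_mx (\row_i g 0 (f i)) \in unitmx.
  rewrite unitmxE det_diag unitfE; apply/prodf_neq0 => i _; rewrite mxE.
  by have := enum_valP i.
rewrite -[leqLHS](mxrank_unit U) -E.
by apply: leq_trans (mxrankM_maxl _ _) _; apply: mxrankM_maxr.
Qed.

(** Cauchy-Schwarz on the support; it turns a rank bound into the inequality that [gap] asks for. *)
Lemma sum_sq_le (I : finType) (s : I -> R) (k : nat) : (forall a, 0 <= s a) ->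
  (#|[pred a | s a != 0%R]| <= k)%N -> (\sum_a s a) ^+ 2 <= k%:R * \sum_a s a ^+ 2.
Proof.
move=> s0 ck; pose J := [pred a | s a != 0].
have Es : \sum_a s a = \sum_(a in J) s a.
  by rewrite [RHS]big_mkcond; apply: eq_bigr => a _; rewrite inE; case: eqP => //= ->.
have E2 : \sum_a s a ^+ 2 = \sum_(a in J) s a ^+ 2.
  rewrite [RHS]big_mkcond; apply: eq_bigr => a _; rewrite inE; case: eqP => //= ->.
  by rewrite expr0n.
apply: (@le_trans _ _ (#|J|%:R * \sum_a s a ^+ 2)); last first.
  by rewrite ler_wpM2r ?ler_nat //; apply: sumr_ge0 => a _; rewrite sqr_ge0.
rewrite Es E2 expr2 mulr_suml.
have -> : \sum_(a in J) s a * (\sum_(b in J) s b) =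
   \sum_(a in J) \sum_(b in J) s a * s b.
  by apply: eq_bigr => a _; rewrite mulr_sumr.
apply: (@le_trans _ _ (\sum_(a in J) \sum_(b in J) (s a ^+ 2 / 2 + s b ^+ 2 / 2))).
  apply: ler_sum => a _; apply: ler_sum => b _.
  by have := sqr_ge0 (s a - s b); rewrite sqrrB; lra.
under eq_bigr => a _ do rewrite big_split sumr_const /=.
rewrite big_split /= sumrMnl sumr_const -mulr_suml -mulrnDl -splitr mulr_natl.
exact: lexx.
Qed.

End Spectral.

(** * The low-rank gap against the base cone *)

Section Agreement.
Variables (R : realType).
Local Notation C := R[i].

(* Low-rank spectral gap: with [P = adj U *m diag s *m U], the sum is
   [\sum_i tr (P h_i P h_i)], and the hypothesis on [s] says that
   [P] behaves like an operator of rank at most [k]. *)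
Definition gap (k : nat) (lam : R) n N (h : 'I_n -> 'M[C]_N) :=
  forall (U : 'M[C]_N) (s : 'I_N -> R),
    U *m adj U = 1%:M -> adj U *m U = 1%:M -> (forall a, 0 <= s a) ->
    (\sum_a s a) ^+ 2 <= k%:R * \sum_a s a ^+ 2 ->
    \sum_i \sum_a \sum_b normsq ((U *m h i *m adj U) a b) * (s a * s b) <=
      lam ^+ 2 * \sum_a s a ^+ 2.

Section Core.
Variables (n k N : nat) (T : 'M[C]_k) (X : 'I_n -> 'M[C]_k).
Hypothesis sX : forall i, adj (X i) = X i.
Hypothesis base : forall u (w : 'I_n -> 'cV[C]_k),
  0 <= complex.Re (hform T u u) + \sum_i complex.Re (hform T (w i) (w i)) +
       2 * \sum_i complex.Re (hform (X i) u (w i)).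
Variables (z : 'I_N -> 'cV[C]_k) (g : 'I_N -> R).
Hypothesis zT : forall a b, hform T (z a) (z b) = (if a == b then g a else 0)%:C.

Local Notation M i a b := (hform (X i) (z a) (z b)).

Lemma core_g_ge0 a : 0 <= g a.
Proof.
have := base (z a) (fun=> 0); rewrite zT eqxx /=.
have h0 (A : 'M[C]_k) u : hform A u 0 = 0 by rewrite /hform mulmx0 mxE.
by rewrite !big1 ?mulr0 ?addr0 // => i _; rewrite h0.
Qed.

Lemma core_conj i a b : M i a b = conjc (M i b a).
Proof. by rewrite hform_conj sX. Qed.

(** In the inner product of [T] the [z a] are orthogonal with squared lengths [g a]; this is the
    condition that the squares sum to at most 1, evaluated at [z b] and compressed to their span. *)
Lemma core_row b : \sum_i \sum_a normsq (M i b a) / g a <= g b.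
Proof.
(* Coefficients obtained by completing the square over the span of the [z a]; where [g a = 0] the
   inverse is 0 and the component drops out. *)
pose w i : 'cV[C]_k := \sum_a (- conjc (M i b a) * (g a)^-1%:C) *: z a.
have h1 i : complex.Re (hform (X i) (z b) (w i)) = - \sum_a normsq (M i b a) / g a.
  rewrite hform_sumr cRe_sum -sumrN; apply: eq_bigr => a _.
  rewrite hformZr mulrAC mulNr [conjc _ * _]mulrC mulzconj mulNr cReN.
  by rewrite -rmorphM.
have h2 i : complex.Re (hform T (w i) (w i)) = \sum_a normsq (M i b a) / g a.
  rewrite hform_suml cRe_sum; apply: eq_bigr => a _.
  rewrite hform_sumr cRe_sum (bigD1 a) //= big1 ?addr0 => [|c ca]; last first.
    by rewrite hformZl hformZr zT eq_sym (negbTE ca) !mulr0.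
  rewrite hformZl hformZr zT eqxx mulrA [conjc _ * _]mulrC mulzconj -rmorphM /=.
  rewrite normsqM normsqN normsq_conj normsq_real -mulrA; congr (_ * _).
  have [->|g0] := eqVneq (g a) 0; first by rewrite mulr0 invr0.
  by rewrite expr2 -mulrA mulVf // mulr1.
have := base (z b) w; rewrite zT eqxx /=.
under eq_bigr => i _ do rewrite h2.
under [X in _ + 2 * X]eq_bigr => i _ do rewrite h1.
rewrite sumrN; lra.
Qed.

(** [z a] has length zero for [T], so otherwise a large multiple of it would make the base form
    negative. *)
Lemma core_zero i a b : g a = 0 -> normsq (M i b a) = 0.
Proof.
move=> ga0; apply/eqP; rewrite eq_le normsq_ge0 andbT; apply/ler_addgt0Pr => e e0.
rewrite add0r; pose t := (g b + 1) / e.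
have t0 : 0 < t by rewrite divr_gt0 // ltr_wpDl // core_g_ge0.
have h0 (A : 'M[C]_k) u : hform A u 0 = 0 by rewrite /hform mulmx0 mxE.
have := base (z b) (fun j => if j == i then (- conjc (M i b a) * t%:C) *: z a else 0).
rewrite zT eqxx /= (bigD1 i) //= eqxx hformZl hformZr zT eqxx ga0 mulr0 mulr0 /= add0r.
rewrite big1 ?addr0 => [|j /negbTE ->]; last by rewrite h0.
rewrite (bigD1 i) //= eqxx [X in 2 * (_ + X)]big1 ?addr0 => [|j /negbTE ->]; last first.
  by rewrite h0.
rewrite hformZr mulrAC mulNr [conjc _ * _]mulrC mulzconj mulNr cReN -rmorphM /= => h1.
have : normsq (M i b a) * t <= e * t.
  have -> : e * t = g b + 1 by rewrite /t mulrC divfK ?gt_eqF.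
  have := core_g_ge0 b; move: h1; rewrite /=; lra.
by rewrite ler_pM2r.
Qed.

Variables (lam : R) (h : 'I_n -> 'M[C]_N).
Hypothesis lam0 : 0 < lam.
Hypothesis hgap :
  \sum_i \sum_a \sum_b normsq (h i a b) * (Num.sqrt (g a) * Num.sqrt (g b)) <=
    lam ^+ 2 * \sum_a g a.

(** Young's inequality with weight [sa * sb / lam], followed by
    [(sa * sb)^-1 <= (sa^-2 + sb^-2) / 2]. The gap bounds the part in [h] by [lam * S], [core_row]
    on rows and columns bounds the part in [M] by [lam * S]; halved, this compensates the prefactor
    [lam^-1] exactly. *)
Lemma core_bound :
  0 <= \sum_a g a + lam^-1 * \sum_i \sum_a \sum_b complex.Re (h i a b * M i a b).
Proof.
pose S := \sum_a g a.
have term i a b : - (normsq (h i a b) * (Num.sqrt (g a) * Num.sqrt (g b)) / lam +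
    lam * ((normsq (M i a b) / g a + normsq (M i a b) / g b) / 2)) <=
    2 * complex.Re (h i a b * M i a b).
  have ga0 := core_g_ge0 a; have gb0 := core_g_ge0 b.
  have [z0|nz] := boolP ((g a == 0) || (g b == 0)).
    have M0 : normsq (M i a b) = 0.
      case/orP: z0 => /eqP e0; last exact: core_zero.
      by rewrite core_conj normsq_conj; apply: core_zero.
    have /eqP := M0; rewrite normsq_eq0 => /eqP ->; rewrite mulr0 /= [normsq 0]/normsq /=.
    rewrite expr0n addr0 !mul0r addr0 mul0r !mulr0 addr0 oppr_le0.
    by rewrite !mulr_ge0 ?normsq_ge0 ?sqrtr_ge0 // invr_ge0 ltW.
  move: nz; rewrite negb_or => /andP[ga gb].
  have pa : 0 < g a by rewrite lt_def ga.
  have pb : 0 < g b by rewrite lt_def gb.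
  set sa := Num.sqrt (g a); set sb := Num.sqrt (g b).
  have sa0 : 0 < sa by rewrite sqrtr_gt0.
  have sb0 : 0 < sb by rewrite sqrtr_gt0.
  have Ea : g a = sa ^+ 2 by rewrite sqr_sqrtr.
  have Eb : g b = sb ^+ 2 by rewrite sqr_sqrtr.
  have e0 : 0 < sa * sb / lam by rewrite divr_gt0 // mulr_gt0.
  have := young (- h i a b) (M i a b) e0; rewrite normsqN mulNr cReN.
  have : (sa * sb / lam)^-1 * normsq (M i a b) <=
     lam * ((normsq (M i a b) / g a + normsq (M i a b) / g b) / 2).
    rewrite -subr_ge0 Ea Eb.
    have -> : lam * ((normsq (M i a b) / sa ^+ 2 + normsq (M i a b) / sb ^+ 2) / 2) -
      (sa * sb / lam)^-1 * normsq (M i a b) =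
      lam / 2 * normsq (M i a b) * (sa^-1 - sb^-1) ^+ 2.
      by field; rewrite !gt_eqF.
    by rewrite mulr_ge0 ?sqr_ge0 // mulr_ge0 ?normsq_ge0 // divr_ge0 // ltW.
  have -> : normsq (h i a b) * (sa * sb) / lam = sa * sb / lam * normsq (h i a b) by ring.
  lra.
have rowS : \sum_i \sum_a \sum_b normsq (M i a b) / g b <= S.
  rewrite exchange_big /=; apply: ler_sum => b _; exact: core_row.
have colS : \sum_i \sum_a \sum_b normsq (M i a b) / g a <= S.
  apply: le_trans rowS; under eq_bigr => i _ do rewrite exchange_big /=.
  apply: ler_sum => i _; apply: ler_sum => b _; apply: ler_sum => a _.
  by rewrite core_conj normsq_conj.
have tot : - (lam^-1 * (\sum_i \sum_a \sum_b normsq (h i a b) *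
       (Num.sqrt (g a) * Num.sqrt (g b))) +
    lam / 2 * (\sum_i \sum_a \sum_b normsq (M i a b) / g a) +
    lam / 2 * (\sum_i \sum_a \sum_b normsq (M i a b) / g b)) <=
    2 * \sum_i \sum_a \sum_b complex.Re (h i a b * M i a b).
  rewrite !mulr_sumr -!big_split -sumrN; apply: ler_sum => i _ /=.
  rewrite !mulr_sumr -!big_split -sumrN; apply: ler_sum => a _ /=.
  rewrite !mulr_sumr -!big_split -sumrN; apply: ler_sum => b _ /=.
  apply: le_trans (term i a b); rewrite lerN2.
  by rewrite le_eqVlt; apply/orP; left; apply/eqP; ring.
move: tot rowS colS hgap; rewrite -/S.
set A := \sum_i _; set B := \sum_i _; set D := \sum_i _; set F := \sum_i _.
move=> tot rowS colS hg.
have h1 : lam^-1 * A <= lam * S.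
  by rewrite mulrC ler_pdivrMr //; apply: le_trans hg _; rewrite expr2 mulrAC.
have h2 : lam / 2 * B <= lam / 2 * S by rewrite ler_pM2l // divr_gt0.
have h3 : lam / 2 * D <= lam / 2 * S by rewrite ler_pM2l // divr_gt0.
have h4 : - (lam * S) <= F by lra.
have : lam^-1 * (- (lam * S)) <= lam^-1 * F by rewrite ler_pM2l ?invr_gt0.
rewrite mulrN mulKf ?gt_eqF //; lra.
Qed.

End Core.
End Agreement.

(** * The arrow-matrix base cone, and gap cones at low levels *)

Section Base.
Variables (R : realType) (n : nat).
Local Notation C := R[i].
Local Notation V := 'rV[C]_n.+1.

(** With coefficients [x_l] this gives the arrow matrix with [x_0] on the diagonal and the [x_i]
    along the first row and column; for [x_0 = 1] and selfadjoint [x_i] its Schur complement is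
    [1 - sum_i x_i^2]. *)
Definition base_tuple (l : 'I_n.+1) : 'M[C]_n.+1 :=
  if l == 0 then 1%:M else delta_mx 0 l + delta_mx l 0.

Lemma hform_delta N (p q : 'I_N) (u w : 'cV[C]_N) :
  hform (delta_mx p q) u w = conjc (u p 0) * w q 0.
Proof.
rewrite hformE (bigD1 p) //= [X in _ + X]big1 ?addr0 => [|r rp]; last first.
  by rewrite big1 // => s _; rewrite mxE (negbTE rp) mulr0 mul0r.
rewrite (bigD1 q) //= big1 ?addr0 => [|s sq]; last first.
  by rewrite mxE (negbTE sq) andbF mulr0 mul0r.
by rewrite mxE !eqxx mulr1.
Qed.

Lemma hform_base_tuple0 u w : hform (base_tuple 0) u w = hform 1%:M u w.
Proof. by rewrite /base_tuple eqxx. Qed.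

Lemma hform_base_tuple i u w : hform (base_tuple (lift ord0 i)) u w =
  conjc (u 0 0) * w (lift ord0 i) 0 + conjc (u (lift ord0 i) 0) * w 0 0.
Proof. by rewrite /base_tuple /= hformDm !hform_delta. Qed.

Lemma hform1E N (u w : 'cV[C]_N) : hform 1%:M u w = \sum_r conjc (u r 0) * w r 0.
Proof. by rewrite /hform mulmx1 mxE; apply: eq_bigr => r _; rewrite adjE. Qed.

Lemma base_tuple_bounded c : 1 <= c -> bounded_tuple c base_tuple.
Proof.
move=> c1; split.
- by rewrite /base_tuple eqxx.
- move=> l; rewrite /base_tuple; case: eqP => _; first exact: adj1.
  by rewrite adjD addrC; congr (_ + _); apply/matrixP => i j; rewrite !mxE andbC rmorph_nat.
- move=> l u w; apply: (@le_trans _ _ (vnormsq u + vnormsq w)); last first.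
    by rewrite ler_peMl // addr_ge0 // vnormsq_ge0.
  case: (unliftP 0 l) => [a ->|->]; last by rewrite hform_base_tuple0; apply: hform1_bound.
  rewrite hform_base_tuple.
  have vle (v : 'cV[C]_n.+1) : normsq (v 0 0) + normsq (v (lift ord0 a) 0) <= vnormsq v.
    rewrite /vnormsq big_ord_recl lerD2l (bigD1 a) //= lerDl.
    by apply: sumr_ge0 => ? _; apply: normsq_ge0.
  have := @young R (conjc (u 0 0)) (w (lift ord0 a) 0) 1 ltr01.
  have := @young R (conjc (u (lift ord0 a) 0)) (w 0 0) 1 ltr01.
  rewrite invr1 !mul1r !normsq_conj cReD; have := vle u; have := vle w; lra.
Qed.

Lemma rep_base_tuple_row v l : rep base_tuple v 0 l = v 0 l.
Proof.
rewrite /rep summxE (bigD1 l) //= big1 ?addr0 => [|j jl].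
  rewrite mxE /base_tuple; case: (eqVneq l 0) => [->|l0]; first by rewrite mxE eqxx mulr1.
  by rewrite !mxE !eqxx eq_sym (negbTE l0) /= addr0 mulr1.
rewrite mxE /base_tuple; case: (eqVneq j 0) => [j0|j0].
  by rewrite mxE -j0 (negbTE jl) mulr0.
by rewrite !mxE [0 == j]eq_sym (negbTE j0) eq_sym (negbTE jl) /= addr0 mulr0.
Qed.

(** The first row of [rep base_tuple v] is [v], so every coordinate is a matrix entry. *)
Lemma base_tuple_separating : separating base_tuple.
Proof.
move=> k t x t0 /bpos_mx h i j l; apply: normsq_le_of_forms => // a b.
have := h (fun p => if p == i then conjc a *: delta_mx 0 0 else 0)
          (fun q => if q == j then b *: delta_mx l 0 else 0).
by rewrite qform_delta !fam_normsq_delta conjcK normsq_conj mxE rep_base_tuple_row.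
Qed.

Definition coef k (x : 'M[V]_k) (l : 'I_n.+1) : 'M[C]_k := \matrix_(p, q) x p q 0 l.

Lemma coef_sa k (x : 'M[V]_k) : repPos base_tuple x ->
  forall l, adj (coef x l) = coef x l.
Proof.
move=> /mxposP[sa _] l; apply/matrixP => p q; rewrite adjE !mxE.
have := sa q p; rewrite !mxE => /matrixP/(_ 0 l); rewrite rep_base_tuple_row => ->.
rewrite -rep_star; last exact: (bounded_tuple_sa (base_tuple_bounded (lexx 1))).
by rewrite rep_base_tuple_row mxE.
Qed.

Lemma hform_coef k (x : 'M[V]_k) l u w :
  hform (coef x l) u w = \sum_p \sum_q x p q 0 l * (conjc (u p 0) * w q 0).
Proof.
rewrite hformE; apply: eq_bigr => p _; apply: eq_bigr => q _; rewrite mxE; ring.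
Qed.

Lemma base_form k (x : 'M[V]_k) : repPos base_tuple x ->
  forall u (w : 'I_n -> 'cV[C]_k),
  0 <= complex.Re (hform (coef x 0) u u) +
       \sum_i complex.Re (hform (coef x 0) (w i) (w i)) +
       2 * \sum_i complex.Re (hform (coef x (lift ord0 i)) u (w i)).
Proof.
move=> px u w; have sx := coef_sa px; have /mxposP[_ h] := px.
pose xi (p : 'I_k) : 'cV[C]_n.+1 :=
  \col_c (if unlift 0 c is Some i then w i p 0 else u p 0).
have xi0 p : xi p 0 0 = u p 0 by rewrite mxE unlift_none.
have xiS p i : xi p (lift ord0 i) 0 = w i p 0 by rewrite mxE liftK.
have := h xi; rewrite qform_rep big_ord_recl cReD.
have -> : complex.Re (\sum_i \sum_j x i j 0 0 * hform (base_tuple 0) (xi i) (xi j)) =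
  complex.Re (hform (coef x 0) u u) + \sum_i complex.Re (hform (coef x 0) (w i) (w i)).
  rewrite -cRe_sum -cReD; congr complex.Re.
  have -> : \sum_i hform (coef x 0) (w i) (w i) =
    \sum_p \sum_q x p q 0 0 * \sum_i (conjc (w i p 0) * w i q 0).
    under eq_bigr => i _ do rewrite hform_coef.
    rewrite exchange_big /=; apply: eq_bigr => p _; rewrite exchange_big /=.
    by apply: eq_bigr => q _; rewrite mulr_sumr.
  rewrite hform_coef -big_split /=; apply: eq_bigr => p _.
  rewrite -big_split /=; apply: eq_bigr => q _.
  rewrite hform_base_tuple0 hform1E big_ord_recl !xi0 mulrDr; congr (_ + _ * _).
  by apply: eq_bigr => i _; rewrite !xiS.
have -> // : complex.Re (\sum_(l < n) \sum_i \sum_j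
     x i j 0 (lift ord0 l) * hform (base_tuple (lift ord0 l)) (xi i) (xi j)) =
  2 * \sum_i complex.Re (hform (coef x (lift ord0 i)) u (w i)).
rewrite cRe_sum mulr_sumr; apply: eq_bigr => i _.
have -> : \sum_p \sum_q x p q 0 (lift ord0 i) * hform (base_tuple (lift ord0 i)) (xi p) (xi q) =
   hform (coef x (lift ord0 i)) u (w i) + hform (coef x (lift ord0 i)) (w i) u.
  rewrite !hform_coef -big_split /=; apply: eq_bigr => p _.
  rewrite -big_split /=; apply: eq_bigr => q _.
  by rewrite hform_base_tuple !xi0 !xiS mulrDr.
by rewrite cReD -[hform _ (w i) u]conjcK hform_conj sx cRe_conj; ring.
Qed.

Variables (N : nat) (lam : R) (h : 'I_n -> 'M[C]_N).
Hypothesis lam0 : 0 < lam.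
Hypothesis sh : forall i, adj (h i) = h i.

Definition scaled_tuple (l : 'I_n.+1) : 'M[C]_N :=
  if unlift 0 l is Some i then lam^-1%:C *: h i else 1%:M.

Lemma scaled_tuple0 : scaled_tuple 0 = 1%:M.
Proof. by rewrite /scaled_tuple unlift_none. Qed.

Lemma scaled_tupleS i : scaled_tuple (lift ord0 i) = lam^-1%:C *: h i.
Proof. by rewrite /scaled_tuple liftK. Qed.

Lemma scaled_tuple_sa l : adj (scaled_tuple l) = scaled_tuple l.
Proof.
rewrite /scaled_tuple; case: unlift => [i|]; last exact: adj1.
by rewrite adjZ conj_real sh.
Qed.

Lemma vnormsq_mul M (A : 'M[C]_M) (u : 'cV[C]_M) : vnormsq (A *m u) = complex.Re (hform (adj A *m A) u u).
Proof.
have := hform1 (A *m u); rewrite /hform mulmx1 adjM -!mulmxA => ->.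
by [].
Qed.

Hypothesis hh : \sum_i h i *m h i = 1%:M.

Lemma vnormsq_sum u : \sum_i vnormsq (h i *m u) = vnormsq u.
Proof.
have -> : vnormsq u = complex.Re (hform 1%:M u u) by rewrite hform1.
rewrite -hh hform_summ cRe_sum; apply: eq_bigr => i _.
by rewrite vnormsq_mul sh.
Qed.

Lemma vnormsq_mul_le i u : vnormsq (h i *m u) <= vnormsq u.
Proof.
rewrite -[leRHS]vnormsq_sum (bigD1 i) //= lerDl.
by apply: sumr_ge0 => ? _; apply: vnormsq_ge0.
Qed.

Lemma hform_mulr M (A : 'M[C]_M) u w : hform A u w = hform 1%:M u (A *m w).
Proof. by rewrite /hform mulmx1 mulmxA. Qed.

Lemma scaled_tuple_bounded : lam <= 1 -> bounded_tuple lam^-1 scaled_tuple.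
Proof.
move=> lam1; split; [exact: scaled_tuple0|exact: scaled_tuple_sa|move=> l u w].
have B0 : 0 <= vnormsq u + vnormsq w by rewrite addr_ge0 // vnormsq_ge0.
rewrite /scaled_tuple; case: unlift => [i|]; last first.
  by apply: le_trans (hform1_bound _ _) _; rewrite ler_peMl // invf_ge1.
rewrite hformZm cReMl mulrCA ler_pM2l ?invr_gt0 // hform_mulr.
by apply: le_trans (hform1_bound _ _) _; rewrite lerD2l vnormsq_mul_le.
Qed.

(* Rotate [C^N] so that the Gram matrix of the test vectors with respect to the
   unit coefficient is diagonal; its rank is at most [k]. *)
Lemma repPos_of_base k (x : 'M[V]_k) : gap k lam h -> repPos base_tuple x -> repPos scaled_tuple x.
Proof.
move=> hgap px; have sx := coef_sa px.
apply/mxposP; split=> [i j|xi].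
  rewrite !mxE -rep_star; last exact: scaled_tuple_sa.
  congr rep; apply/rowP => l; rewrite mxE.
  by have /matrixP/(_ j i) := sx l; rewrite adjE !mxE.
pose Z : 'M[C]_(k, N) := \matrix_(p, r) xi p r 0.
pose G l : 'M[C]_N := adj Z *m coef x l *m Z.
have sG l : adj (G l) = G l by rewrite /G !adjM adjK sx mulmxA.
have [W [g [WW WW' WG]]] := spectral_adj (sG 0).
pose Z' := Z *m adj W; pose z a := col a Z'.
have zE l a b : hform (coef x l) (z a) (z b) = (W *m G l *m adj W) a b.
  have -> : W *m G l *m adj W = adj Z' *m coef x l *m Z'.
    by rewrite /G /Z' adjM adjK !mulmxA.
  rewrite /z /hform; have -> : adj (col a Z') = row a (adj Z').
    by apply/matrixP => i j; rewrite !mxE.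
  rewrite -row_mul [LHS]mxE [RHS]mxE; apply: eq_bigr => p _.
  by rewrite [row _ _ _ _]mxE [col _ _ _ _]mxE.
pose gr a : R := complex.Re (g 0 a).
have bf := base_form px.
have greal a : g 0 a = (gr a)%:C.
  have := hform_conj (coef x 0) (z a) (z a); rewrite sx zE WG mxE eqxx mulr1n /gr.
  case: (g 0 a) => p q [] /eqP; rewrite -subr_eq0 -opprD oppr_eq0 => e.
  have -> : q = 0 by move/eqP: e; lra.
  by [].
have zT a b : hform (coef x 0) (z a) (z b) = (if a == b then gr a else 0)%:C.
  rewrite zE WG mxE; case: eqP => [->|_]; last by rewrite mulr0n.
  by rewrite mulr1n greal.
have sX i : adj (coef x (lift ord0 i)) = coef x (lift ord0 i) by apply: sx.
have gr0 a : 0 <= gr a := core_g_ge0 bf zT a.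
(* The form pairs [scaled_tuple l] with [G l] entrywise without conjugation; one factor is thus
   rotated by [W], the other by its conjugate. *)
pose U : 'M[C]_N := map_mx (@conjc R) W.
have UU : U *m adj U = 1%:M.
  have -> : U *m adj U = map_mx (@conjc R) (W *m adj W).
    by rewrite map_mxM; congr (_ *m _); apply/matrixP => i j; rewrite !mxE.
  by rewrite WW map_mx1.
have UU' : adj U *m U = 1%:M by apply: mulmx1C.
have rot (A B : 'M[C]_N) : \sum_r \sum_s A r s * B r s =
   \sum_a \sum_b (U *m A *m adj U) a b * (W *m B *m adj W) a b.
  have tr (P Q : 'M[C]_N) : \sum_r \sum_s P r s * Q r s = \tr (P^T *m Q).
    rewrite /mxtrace exchange_big /=; apply: eq_bigr => s _; rewrite mxE.
    by apply: eq_bigr => r _; rewrite mxE.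
  rewrite !tr !trmx_mul.
  have -> : U^T = adj W by apply/matrixP => i j; rewrite !mxE.
  have -> : (adj U)^T = W by apply/matrixP => i j; rewrite !mxE conjcK.
  rewrite !mulmxA -[_ *m adj W *m W]mulmxA WW' mulmx1 [RHS]mxtrace_mulC.
  by rewrite !mulmxA WW' mul1mx.
have GE l : \sum_p \sum_q x p q 0 l * hform (scaled_tuple l) (xi p) (xi q) =
   \sum_r \sum_s scaled_tuple l r s * G l r s.
  under eq_bigr => p _ do under eq_bigr => q _ do rewrite hformE mulr_sumr.
  under eq_bigr => p _ do rewrite exchange_big /=.
  rewrite exchange_big /=; apply: eq_bigr => r _.
  under eq_bigr => p _ do under eq_bigr => q _ do rewrite mulr_sumr.
  under eq_bigr => p _ do rewrite exchange_big /=.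
  rewrite exchange_big /=; apply: eq_bigr => s _.
  rewrite /G mxE mulr_sumr exchange_big /=; apply: eq_bigr => q _.
  rewrite mxE !(mulr_suml, mulr_sumr); apply: eq_bigr => p _.
  by rewrite adjE !mxE; ring.
rewrite qform_rep big_ord_recl GE rot scaled_tuple0 mulmx1 UU cReD WG.
have -> : complex.Re (\sum_a \sum_b (1%:M : 'M[C]_N) a b * (diag_mx g) a b) = \sum_a gr a.
  rewrite cRe_sum; apply: eq_bigr => a _; rewrite (bigD1 a) //= big1 ?addr0 => [|b ba].
    by rewrite !mxE eqxx mul1r mulr1n.
  by rewrite mxE eq_sym (negbTE ba) mul0r.
have -> : complex.Re (\sum_(i < n) \sum_p \sum_q x p q 0 (lift ord0 i) *
     hform (scaled_tuple (lift ord0 i)) (xi p) (xi q)) =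
   lam^-1 * \sum_i \sum_a \sum_b complex.Re ((U *m h i *m adj U) a b *
     hform (coef x (lift ord0 i)) (z a) (z b)).
  rewrite cRe_sum mulr_sumr; apply: eq_bigr => i _; rewrite GE rot scaled_tupleS.
  rewrite cRe_sum mulr_sumr; apply: eq_bigr => a _.
  rewrite cRe_sum mulr_sumr; apply: eq_bigr => b _.
  by rewrite -scalemxAr -scalemxAl mxE zE -mulrA cReMl.
apply: (core_bound sX bf zT lam0).
(* The gap is applied to the square root of the Gram matrix, so that [\sum_a s a ^+ 2] is the Gram
   trace. *)
have E2 : \sum_a gr a = \sum_a Num.sqrt (gr a) ^+ 2.
  by apply: eq_bigr => a _; rewrite sqr_sqrtr.
rewrite E2; apply: hgap => //.
apply: sum_sq_le => //.
have -> : #|[pred a | Num.sqrt (gr a) != 0]| = #|[pred a | g 0 a != 0]|.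
  apply: eq_card => a; rewrite !inE sqrtr_eq0 -ltNge lt_def gr0 andbT.
  by rewrite greal eq_complex /= eqxx andbT.
apply: leq_trans (rank_diag_count g) _; rewrite -WG /G.
apply: leq_trans (mxrankM_maxl _ _) _; apply: leq_trans (mxrankM_maxr _ _) _.
by apply: leq_trans (mxrankM_maxr _ _) _; apply: rank_leq_row.
Qed.

End Base.

(** * Failure of exactness *)

Section Compression.
Variable R : realType.
Local Notation C := R[i].

Lemma conj_munitZ (X : matrixOrder R) k m (A : 'M[C]_(m, k)) t :
  adj A *m A = 1%:M ->
  lmulm (adj A) (rmulm (munitZ X m t) A) = munitZ X k t.
Proof.
move=> AA; apply/matrixP => i j; rewrite conjmE mxE.
have E : \sum_p conjc (A p i) * A p j = (i == j)%:R.
  have /matrixP/(_ i j) := AA; rewrite !mxE => <-.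
  by apply: eq_bigr => p _; rewrite adjE.
transitivity ((\sum_p conjc (A p i) * A p j) *: (t%:C *: mo_unit X)).
  rewrite scaler_suml; apply: eq_bigr => p _.
  rewrite (bigD1 p) //= big1 ?addr0 => [|q qp]; first by rewrite mxE eqxx mulr1n.
  by rewrite mxE eq_sym (negbTE qp) mulr0n scaler0.
by rewrite E; case: (i == j); rewrite ?scale1r ?scale0r.
Qed.

Lemma fam_normsq_act k m N (A : 'M[C]_(m, k)) (xi : 'I_k -> 'cV[C]_N) :
  adj A *m A = 1%:M -> fam_normsq (mxact A xi) = fam_normsq xi.
Proof.
move=> AA; have := qform_munitZ 1 (mxact A xi).
rewrite -qform_conjm conj_munitZ // qform_munitZ !mul1r => ->.
by [].
Qed.

Lemma bpos_compress k m N t (A B : 'M[C]_(m, k)) (x : 'M['M[C]_N]_m) :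
  adj A *m A = 1%:M -> adj B *m B = 1%:M ->
  bpos (X := mx_order R N) t x ->
  bpos (X := mx_order R N) t (lmulm (X := mx_order R N) (adj A)
    (rmulm (X := mx_order R N) x B)).
Proof.
move=> AA BB /bpos_mx h; apply/bpos_mx => xi eta.
by rewrite qform_conjm -(fam_normsq_act xi AA) -(fam_normsq_act eta BB).
Qed.

Lemma bpos_mx_le k N (t s : R) (x : 'M['M[C]_N]_k) : t <= s ->
  bpos (X := mx_order R N) t x -> bpos (X := mx_order R N) s x.
Proof.
move=> ts /bpos_mx h; apply/bpos_mx => xi eta; apply: le_trans (h xi eta) _.
by rewrite lerD2r lerD // ler_wpM2r // fam_normsq_ge0.
Qed.

(* A factorization through [M_k] as in Smith's lemma: vectors of
   [C^m (x) C^k] live on [C^k (x) C^k] up to an isometry. *)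
Lemma bpos_of_compressions k m t (x : 'M['M[C]_k]_m) : (k <= m)%N ->
  (forall A B : 'M[C]_(m, k), adj A *m A = 1%:M -> adj B *m B = 1%:M ->
    bpos (X := mx_order R k) t (lmulm (X := mx_order R k) (adj A)
      (rmulm (X := mx_order R k) x B))) ->
  bpos (X := mx_order R k) t x.
Proof.
move=> km h; apply/bpos_mx => xi eta.
have fac (zeta : 'I_m -> 'cV[C]_k) : exists (A : 'M[C]_(m, k)) zeta',
    adj A *m A = 1%:M /\ zeta = mxact A zeta'.
  have [A [S [E AA]]] := thin_factor (\matrix_(p, r) zeta p r 0 : 'M[C]_(m, k)) km.
  exists A, (fun a => \col_r S a r); split=> //; apply/funext => p; apply/colP => r.
  rewrite /mxact summxE; have /matrixP/(_ p r) := E; rewrite !mxE => ->.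
  by apply: eq_bigr => a _; rewrite !mxE.
have [A [xi' [AA ->]]] := fac xi; have [B [eta' [BB ->]]] := fac eta.
rewrite (fam_normsq_act xi' AA) (fam_normsq_act eta' BB) -qform_conjm.
by move: (h A B AA BB) => /bpos_mx.
Qed.

End Compression.

(** * A sequence of gap cones and the failure of exactness *)

Section Family.
Variables (R : realType) (n : nat) (lam : R) (Nn : nat -> nat).
Local Notation C := R[i].
Local Notation V := 'rV[C]_n.+1.
Variables (h : forall m, 'I_n -> 'M[C]_(Nn m)) (kap : nat -> nat).
Hypotheses (lam0 : 0 < lam) (lam1 : lam < 1).
Hypothesis sh : forall m i, adj (h m i) = h m i.
Hypothesis hh : forall m, \sum_i h m i *m h m i = 1%:M.
Hypothesis hgap : forall m, gap (kap m) lam (h m).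
Hypothesis kap_mono : forall m m', (m <= m')%N -> (kap m <= kap m')%N.
Hypothesis kap_ge : forall m, (m <= kap m)%N.
Hypothesis Nkap : forall j m, (j < m)%N -> (Nn j + Nn j <= kap m)%N.
Hypothesis kapN : forall m, (kap m <= Nn m)%N.
Hypothesis Npos : forall m, (0 < Nn m)%N.

Definition fam_dim (o : option nat) : nat := if o is Some m then Nn m else n.+1.
Definition fam_tuple (o : option nat) : 'I_n.+1 -> 'M[C]_(fam_dim o) :=
  match o with Some m => scaled_tuple lam (h m) | None => @base_tuple R n end.

Lemma fam_tuple_bounded o : bounded_tuple lam^-1 (fam_tuple o).
Proof.
case: o => [m|]; last by apply: base_tuple_bounded; rewrite invf_ge1 // ltW.
exact: (scaled_tuple_bounded lam0 (sh m) (hh m) (ltW lam1)).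
Qed.

Lemma fam_tuple_separating : separating (fam_tuple None).
Proof. exact: base_tuple_separating. Qed.

Lemma lamV_ge0 : 0 <= lam^-1.
Proof. by rewrite invr_ge0 ltW. Qed.

Local Notation fam_order := (tuple_order fam_tuple None).
Definition fam_system (T : set (option nat)) := tuple_system lamV_ge0 fam_tuple_bounded fam_tuple_separating T.

Lemma gap_le k m : (k <= kap m)%N -> gap k lam (h m).
Proof.
move=> km U s U1 U2 s0 hs; apply: hgap => //; apply: le_trans hs _.
by rewrite ler_wpM2r ?ler_nat //; apply: sumr_ge0 => a _; rewrite sqr_ge0.
Qed.

Lemma repPos_fam_of_base k m (x : 'M[V]_k) : (k <= kap m)%N ->
  repPos (fam_tuple None) x -> repPos (fam_tuple (Some m)) x.
Proof. by move=> km px; exact: (repPos_of_base lam0 (sh m) (gap_le km) px). Qed.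

(** A cone of index at least [M] follows from the base cone at levels up to [kap M], so membership
    of such indices changes nothing there. *)
Lemma fam_order_agree M (T1 T2 : set (option nat)) :
  (forall m, (m < M)%N -> (T1 (Some m) <-> T2 (Some m))) ->
  forall k, (k <= kap M)%N -> mo_pos (fam_order T1) k = mo_pos (fam_order T2) k.
Proof.
have sub (T T' : set (option nat)) :
    (forall m, (m < M)%N -> (T (Some m) <-> T' (Some m))) ->
    forall k, (k <= kap M)%N -> forall x, mo_pos (fam_order T) k x -> mo_pos (fam_order T') k x.
  move=> hTT k kM x hx [m|]; last by move=> _; apply: hx; left.
  move=> [//|iT]; have [mM|Mm] := ltnP m M; first by apply: hx; right; apply/hTT.
  apply: repPos_fam_of_base; first exact: leq_trans kM (kap_mono Mm).
  by apply: hx; left.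
move=> h12 k kM; apply/seteqP; split=> x; first exact: (sub T1 T2).
by apply: (sub T2 T1) => // m mM; have [] := h12 m mM.
Qed.

Lemma repB_block o k t (x : 'M[V]_k) T :
  repB (fam_tuple o) t x <-> repPos (fam_tuple o)
    (block_mx (munitZ (fam_order T) k t) x (mstar (X := fam_order T) x) (munitZ (fam_order T) k t)).
Proof.
rewrite /repPos /repB /bpos map_block_mx.
by rewrite (map_rep_munitZ None fam_tuple_bounded) (map_rep_mstar None fam_tuple_bounded).
Qed.

(** The test element [s sum_i conj(h_i^m) (x) e_i]. Conjugation makes its pairing with the [h_i^m]
    on the maximally entangled vector equal to [s sum_i tr(h_i^m h_i^m)]; [s] serves to rescale into
    a unit ball. *)
Definition conj_tuple m (s : R) : 'M[V]_(Nn m) := \matrix_(p, q)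
  \row_l (if unlift 0 l is Some i then s%:C * conjc (h m i p q) else 0).

Lemma conj_tuple0 m s p q : conj_tuple m s p q 0 0 = 0.
Proof. by rewrite !mxE unlift_none. Qed.

Lemma conj_tupleS m s p q i : conj_tuple m s p q 0 (lift ord0 i) = s%:C * conjc (h m i p q).
Proof. by rewrite !mxE liftK. Qed.

Lemma qform_conj_tuple o m s xi eta : qform (map_mx (rep (fam_tuple o)) (conj_tuple m s)) xi eta =
  s%:C * \sum_(i < n) \sum_p \sum_q conjc (h m i p q) *
     hform (fam_tuple o (lift ord0 i)) (xi p) (eta q).
Proof.
rewrite qform_rep big_ord_recl big1 ?add0r => [|p _]; last first.
  by rewrite big1 // => q _; rewrite conj_tuple0 mul0r.
rewrite mulr_sumr; apply: eq_bigr => i _; rewrite mulr_sumr; apply: eq_bigr => p _.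
by rewrite mulr_sumr; apply: eq_bigr => q _; rewrite conj_tupleS mulrA.
Qed.

(** The arrow shape couples slot 0 with slot [i] only. Each [cj i] is moved onto the slot 0 vector,
    where the squares sum to 1, before Cauchy-Schwarz. *)
Lemma conj_tuple_base m : repB (fam_tuple None) 1 (conj_tuple m 1).
Proof.
apply/bpos_mx => xi eta; rewrite !mul1r qform_conj_tuple mul1r.
pose cj i : 'M[C]_(Nn m) := map_mx (@conjc R) (h m i).
have cjs i : adj (cj i) = cj i.
  apply/matrixP => p q; rewrite adjE !mxE.
  by have /matrixP/(_ p q) := sh m i; rewrite adjE => <-.
have cj1 : \sum_i cj i *m cj i = 1%:M.
  have /(congr1 (map_mx (@conjc R))) := hh m; rewrite map_mx1 => <-.
  by rewrite raddf_sum; apply: eq_bigr => i _; rewrite /= map_mxM.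
pose X c : 'cV[C]_(Nn m) := \col_p xi p c 0.
pose Y c : 'cV[C]_(Nn m) := \col_p eta p c 0.
have nsE (zeta : 'I_(Nn m) -> 'cV[C]_n.+1) :
    fam_normsq zeta = vnormsq (\col_p zeta p 0 0 : 'cV[C]_(Nn m)) +
      \sum_i vnormsq (\col_p zeta p (lift ord0 i) 0 : 'cV[C]_(Nn m)).
  rewrite /fam_normsq /vnormsq; under eq_bigr => p _ do rewrite big_ord_recl.
  rewrite big_split /=; congr (_ + _).
    by apply: eq_bigr => p _; rewrite mxE.
  by rewrite exchange_big /=; apply: eq_bigr => i _; apply: eq_bigr => p _; rewrite mxE.
have -> : \sum_(i < n) \sum_p \sum_q conjc (h m i p q) *
     hform (fam_tuple None (lift ord0 i)) (xi p) (eta q) =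
   \sum_i (hform (cj i) (X 0) (Y (lift ord0 i)) + hform (cj i) (X (lift ord0 i)) (Y 0)).
  apply: eq_bigr => i _; rewrite !hformE -big_split /=; apply: eq_bigr => p _.
  rewrite -big_split /=; apply: eq_bigr => q _.
  by rewrite (hform_base_tuple i) !mxE; ring.
have bnd i u w : - (vnormsq (cj i *m u) + vnormsq w) <= 2 * complex.Re (hform (cj i) u w).
  have := hform1_bound (cj i *m u) (- w); rewrite vnormsqN hformNr cReN.
  have -> : hform 1%:M (cj i *m u) w = hform (cj i) u w.
    by rewrite /hform mulmx1 adjM cjs.
  lra.
have bnd2 i u w : - (vnormsq u + vnormsq (cj i *m w)) <= 2 * complex.Re (hform (cj i) u w).
  have := hform1_bound u (- (cj i *m w)); rewrite vnormsqN hformNr cReN -hform_mulr; lra.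
rewrite !nsE -/(X 0) -/(Y 0).
have : - (vnormsq (X 0) + \sum_i vnormsq (Y (lift ord0 i)) +
          (\sum_i vnormsq (X (lift ord0 i)) + vnormsq (Y 0))) <=
  2 * complex.Re (\sum_i (hform (cj i) (X 0) (Y (lift ord0 i)) +
    hform (cj i) (X (lift ord0 i)) (Y 0))).
  rewrite -(vnormsq_sum cjs cj1 (X 0)) -(vnormsq_sum cjs cj1 (Y 0)) -!big_split /=.
  rewrite cRe_sum mulr_sumr -sumrN; apply: ler_sum => i _.
  have := bnd i (X 0) (Y (lift ord0 i)); have := bnd2 i (X (lift ord0 i)) (Y 0).
  rewrite cReD; lra.
rewrite /X /Y; lra.
Qed.

(** Exchanging the tensor factors, with conjugation, turns this into the bound on [conj_tuple j] in
    the cone of [m]. That bound is tested at level [Nn j + Nn j <= kap m], where it follows from the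
    base cone. *)
Lemma conj_tuple_cross j m : (j < m)%N -> repB (fam_tuple (Some j)) 1 (conj_tuple m 1).
Proof.
move=> jm.
have := conj_tuple_base j => /(repB_block _ _ _ set0) hb.
have : repB (fam_tuple (Some m)) 1 (conj_tuple j 1).
  by apply/(repB_block _ _ _ set0); apply: repPos_fam_of_base => //; exact: Nkap.
move=> /bpos_mx H; apply/bpos_mx => xi eta.
pose sw (zeta : 'I_(Nn m) -> 'cV[C]_(Nn j)) : 'I_(Nn j) -> 'cV[C]_(Nn m) :=
  fun p => \col_r conjc (zeta r p 0).
have ns_sw zeta : fam_normsq (sw zeta) = fam_normsq zeta.
  rewrite /fam_normsq /vnormsq exchange_big /=; apply: eq_bigr => r _; apply: eq_bigr => p _.
  by rewrite mxE normsq_conj.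
have := H (sw xi) (sw eta); rewrite !ns_sw !qform_conj_tuple !mul1r.
set a := \sum_i _; set b := \sum_i _.
suff -> : a = conjc b by rewrite cRe_conj.
rewrite /a /b rmorph_sum /=; apply: eq_bigr => i _; rewrite !scaled_tupleS.
under eq_bigr => p _ do under eq_bigr => q _ do
  rewrite hformZm hformE !mulr_sumr.
under eq_bigr => p _ do under eq_bigr => q _ do
  under eq_bigr => r _ do rewrite !mulr_sumr.
under eq_bigr => p _ do rewrite exchange_big /=.
rewrite exchange_big /= rmorph_sum /=; apply: eq_bigr => r _.
under eq_bigr => p _ do rewrite exchange_big /=.
rewrite exchange_big /= rmorph_sum /=; apply: eq_bigr => s _.
rewrite hformZm hformE !mulr_sumr rmorph_sum /=; apply: eq_bigr => p _.
rewrite !mulr_sumr rmorph_sum /=; apply: eq_bigr => q _.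
by rewrite !conjcM !conjcK !mxE !conjcK conj_real; ring.
Qed.

(** The basis vectors [e p] form the maximally entangled vector, of squared norm [Nn m]; the form
    takes the value [s * Nn m / lam] on it. *)
Lemma conj_tuple_lower m s t : 0 <= s -> repB (fam_tuple (Some m)) t (conj_tuple m s) -> s / lam <= t.
Proof.
move=> s0 /bpos_mx H.
pose e (p : 'I_(Nn m)) : 'cV[C]_(Nn m) := delta_mx p 0.
have hfe (A : 'M[C]_(Nn m)) p q : hform A (e p) (e q) = A p q.
  rewrite hformE (bigD1 p) //= [X in _ + X]big1 ?addr0 => [|r rp]; last first.
    by rewrite big1 // => x _; rewrite /e mxE (negbTE rp) rmorph0 !mul0r.
  rewrite (bigD1 q) //= big1 ?addr0 => [|r rq]; last first.
    by rewrite /e [X in _ * X]mxE (negbTE rq) mulr0.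
  by rewrite /e !mxE !eqxx rmorph1 mul1r mulr1.
have nse : fam_normsq e = (Nn m)%:R.
  rewrite /fam_normsq -[in RHS](card_ord (Nn m)) -sumr_const; apply: eq_bigr => p _.
  have := hform1 (e p); rewrite hfe mxE eqxx => /(congr1 (@complex.Re R)) /= <-.
  by [].
have := H e (fun p => - e p); rewrite fam_normsqN nse qformNr cReN qform_conj_tuple cReMl.
have -> : \sum_(i < n) \sum_p \sum_q conjc (h m i p q) *
   hform (fam_tuple (Some m) (lift ord0 i)) (e p) (e q) = (lam^-1 * (Nn m)%:R)%:C.
  have E : \sum_(i < n) \sum_p \sum_q conjc (h m i p q) * h m i p q = (Nn m)%:R.
    have /(congr1 mxtrace) := hh m; rewrite mxtrace1 => <-.
    rewrite raddf_sum; apply: eq_bigr => i _; rewrite /mxtrace /=.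
    rewrite exchange_big /=; apply: eq_bigr => p _; rewrite mxE; apply: eq_bigr => q _.
    by have /matrixP/(_ p q) := sh m i; rewrite adjE => ->.
  rewrite rmorphM rmorph_nat -E mulr_sumr; apply: eq_bigr => i _.
  rewrite mulr_sumr; apply: eq_bigr => p _; rewrite mulr_sumr; apply: eq_bigr => q _.
  by rewrite hfe /= scaled_tupleS mxE; ring.
rewrite /= => h1.
have N0 : 0 < (Nn m)%:R :> R by rewrite ltr0n.
have : 0 <= (Nn m)%:R * (t - s / lam).
  have -> : (Nn m)%:R * (t - s / lam) = (Nn m)%:R * t - s * (lam^-1 * (Nn m)%:R) by ring.
  lra.
by rewrite pmulr_rge0 // subr_ge0.
Qed.

Lemma fam_system_fd T : finite_dim (fam_system T).
Proof.
exists n.+1, (fun i => delta_mx 0 i : V) => x; exists (fun i => (x : V) 0 i).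
exact: (row_sum_delta (x : V)).
Qed.

Lemma cb_bound (E F : matrixOrder R) D (f : E -> F) (a : R) k (x : 'M[E]_k) :
  (cb_norm D f <= a%:E)%E -> (forall i j, D (x i j)) -> mnorm x <= 1 ->
  mnorm (map_mx f x : 'M[F]_k) <= a.
Proof.
move=> cb Dx x1; rewrite -lee_fin; apply: le_trans cb.
by apply: ereal_sup_ubound; exists k, x.
Qed.

Lemma fam_system_unit T : mnorm (X := fam_system T) ((mo_unit (fam_system T))%:M : 'M[_]_1) = 1.
Proof.
have b1 : bpos (X := fam_order T) 1 ((vunit R n)%:M : 'M[V]_1).
  apply/(tuple_order_bpos None fam_tuple_bounded) => o _; apply: bpos_of_bound => xi eta.
  rewrite mul1r /qform /fam_normsq !big_ord1 !mxE mulr1n rep_unit (bounded_tuple0 (fam_tuple_bounded o)).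
  exact: hform1_bound.
apply/eqP; rewrite eq_le (mnorm_le ler01 b1) //= leNgt; apply/negP => lt1.
have [r [_ r1 /(tuple_order_bpos None fam_tuple_bounded)]] := mnorm_lt ler01 b1 lt1.
move=> /(_ None (or_introl erefl)) hr; suff : 1 <= r by rewrite leNgt r1.
have E : map_mx (rep (fam_tuple None)) ((vunit R n)%:M : 'M[V]_1) = ((1%:M : 'M[C]_n.+1)%:M : 'M[_]_1).
  apply/matrixP => p q; rewrite !ord1 !mxE !mulr1n rep_unit.
  exact: (bounded_tuple0 (fam_tuple_bounded None)).
by move: hr; rewrite /repB E; exact: bpos_mx_unit.
Qed.

(** The system is taken as its own subsystem. Given a map to [M_d], an index [m] in [T] is chosen
    beyond what level [2d] can see: the image of the test element is then bounded through the
    smaller indices only, while its preimage has to obey the cone of [m]. *)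
Lemma fam_system_not_exact (T : set (option nat)) :
  (forall M, exists2 m, (M <= m)%N & T (Some m)) -> ~ one_exact (fam_system T).
Proof.
move=> Tinf ex.
have idE : @os_embedding R (fam_system T) (fam_system T) idfun.
  by split; [|by []|by []|move=> k x; rewrite map_mx_id].
have [D [phi [psi [phi1 phiK cv]]]] := ex _ _ idE (fam_system_fd T).
have lamV1 : (1 < lam^-1%:E)%E by rewrite lte_fin invf_gt1.
have [i hi] : exists i, (cb_norm setT (phi i) * cb_norm (range (phi i)) (psi i) < lam^-1%:E)%E.
  have [M _ hM] := cv _ (open_ereal_lt' lamV1).
  by exists M; apply: (hM M); exact: leqnn.
set d := D i in phi psi phi1 phiK cv hi; set f := phi i in hi; set g := psi i in hi.
have fK : cancel f g := phiK i.
have f1 : f (mo_unit (fam_system T)) = 1%:M := phi1 i.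
have d0 : (0 < d)%N.
  rewrite lt0n; apply/eqP => d0.
  have /eqP := os_unit_neq0 (os_axioms (fam_system T)); apply.
  apply: (can_inj fK); apply/matrixP => p; have := ltn_ord p.
  by rewrite [X in (_ < X)%N -> _]d0.
have fu : map_mx f ((mo_unit (fam_system T))%:M : 'M[_]_1) = ((1%:M : 'M[C]_d)%:M : 'M[_]_1).
  by apply/matrixP => p q; rewrite !ord1 !mxE !mulr1n.
have gu : map_mx g ((1%:M : 'M[C]_d)%:M : 'M[_]_1) = ((mo_unit (fam_system T))%:M : 'M[_]_1).
  by apply/matrixP => p q; rewrite !ord1 !mxE !mulr1n -f1 fK.
have A1 : (1%:E <= cb_norm setT f)%E.
  apply: ereal_sup_ubound; exists 1%N, ((mo_unit (fam_system T))%:M : 'M[_]_1).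
  by split=> //; rewrite ?fam_system_unit // fu mnorm_mx_unit.
have B1 : (1%:E <= cb_norm (range f) g)%E.
  apply: ereal_sup_ubound; exists 1%N, ((1%:M : 'M[C]_d)%:M : 'M[_]_1); split.
  - move=> p q; rewrite !ord1 mxE mulr1n; exists (mo_unit (fam_system T)) => //.
  - by rewrite mnorm_mx_unit.
  - by rewrite gu fam_system_unit.
have [a [b [Ea Eb a1 b1 ab1]]] : exists a b : R, [/\ cb_norm setT f = a%:E,
    cb_norm (range f) g = b%:E, 1 <= a, 1 <= b & a * b < lam^-1].
  move: A1 B1 hi; case: (cb_norm setT f) => [a||] //; last first.
    by move=> _ B1; rewrite gt0_mulye //; apply: lt_le_trans B1; rewrite lte_fin.
  case: (cb_norm (range f) g) => [b||] // a1; last first.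
    by move=> _; rewrite gt0_muley //; apply: lt_le_trans a1; rewrite lte_fin.
  move=> b1 hab; exists a, b; split=> //.
have [e e0 [e1 abe]] : exists2 e : R, 0 < e & e <= 1 /\ (a + e) * (b + e) < lam^-1.
  (* For [e <= 1] the product grows by [e * (a + b + e) <= e * (a + b + 1)], which the choice of [e]
     keeps below the slack [u]. *)
  pose u := lam^-1 - a * b; have u0 : 0 < u by rewrite subr_gt0.
  have s0 : 0 < u + a + b + 1 by lra.
  exists (u / (u + a + b + 1)); first by rewrite divr_gt0.
  set e := u / _; have e0 : 0 < e by rewrite divr_gt0.
  have e1 : e <= 1 by rewrite ler_pdivrMr // mul1r; lra.
  have eu : e * (u + a + b + 1) = u by rewrite divfK // gt_eqF.
  split=> //; have -> : lam^-1 = a * b + u by rewrite /u addrC subrK.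
  nra.
have [m mM Tm] := Tinf (d + d)%N.
(* Up to level [kap m] this set gives the same cones as [T]; at level [Nn m] it is the one for which
   the test element is known to have norm at most 1. *)
pose T' := [set o | T o /\ if o is Some j then (j < m)%N else True].
have agr : forall k, (k <= kap m)%N -> mo_pos (fam_order T) k = mo_pos (fam_order T') k.
  apply: fam_order_agree => j jm; split=> [Tj|[]//]; by split.
have dk : (d + d <= kap m)%N by apply: leq_trans mM (kap_ge m).
have y1 : bpos (X := fam_order T') 1 (conj_tuple m 1).
  apply/(tuple_order_bpos None fam_tuple_bounded) => -[j|]; last by move=> _; exact: conj_tuple_base.
  by move=> [//|[_ jm]]; exact: conj_tuple_cross.
have fy : bpos (X := mx_order R d) (a + e) (map_mx f (conj_tuple m 1 : 'M[fam_system T]_(Nn m))).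
  apply: bpos_of_compressions => [|A B AA BB].
    by apply: leq_trans (kapN m); apply: leq_trans dk; exact: leq_addr.
  pose y : 'M[fam_system T]_d := lmulm (X := fam_order T) (adj A) (rmulm (X := fam_order T) (conj_tuple m 1) B).
  have -> : lmulm (X := mx_order R d) (adj A)
      (rmulm (X := mx_order R d) (map_mx f (conj_tuple m 1 : 'M[fam_system T]_(Nn m))) B) = map_mx f y.
    apply/matrixP => p q; rewrite (@conjmE R (mx_order R d)) mxE (@conjmE R (fam_order T)).
    rewrite raddf_sum; apply: eq_bigr => r _; rewrite raddf_sum; apply: eq_bigr => s _.
    by rewrite mxE; symmetry; exact: linearZZ.
  have y'1 : bpos (X := fam_order T') 1 y.
    apply/(tuple_order_bpos None fam_tuple_bounded) => o oT; rewrite /repB (map_rep_conjm o A B).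
    by apply: bpos_compress => //; exact: ((tuple_order_bpos None fam_tuple_bounded _ _ _).1 y1 o oT).
  have yT : bpos (X := fam_order T) 1 y by rewrite /bpos agr.
  have mf : mnorm (map_mx f y : 'M[mx_order R d]_d) <= a.
    apply: (cb_bound (D := setT)) => //; first by rewrite Ea.
    exact: mnorm_le ler01 yT.
  have [t t0 bt] := mx_bpos_ex (map_mx f y).
  have lta : mnorm (map_mx f y : 'M[mx_order R d]_d) < a + e.
    by apply: le_lt_trans mf _; rewrite ltrDl.
  have [r [_ ra br]] := mnorm_lt t0 bt lta.
  exact: bpos_mx_le (ltW ra) br.
(* Scaling by [s] puts the image into the unit ball, where the bound [b] on the inverse applies. *)
pose s := (a + e)^-1; have ae0 : 0 < a + e by lra.
have s0 : 0 < s by rewrite invr_gt0.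
have yE : (conj_tuple m s : 'M[fam_system T]_(Nn m)) = map_mx ( *:%R s%:C) (conj_tuple m 1 : 'M[fam_system T]_(Nn m)).
  apply/matrixP => p q; rewrite [RHS]mxE; apply/rowP => l; rewrite !mxE.
  by case: unlift => [j|]; rewrite ?mulr0 // mul1r.
have fs : bpos (X := mx_order R d) 1 (map_mx f (conj_tuple m s : 'M[fam_system T]_(Nn m))).
  apply/bpos_mx => xi eta; have /bpos_mx/(_ xi eta) H := fy.
  have -> : qform (map_mx f (conj_tuple m s : 'M[fam_system T]_(Nn m))) xi eta =
      s%:C * qform (map_mx f (conj_tuple m 1 : 'M[fam_system T]_(Nn m))) xi eta.
    rewrite yE /qform mulr_sumr; apply: eq_bigr => p _; rewrite mulr_sumr.
    by apply: eq_bigr => q _; rewrite !mxE linearZ hformZm.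
  rewrite cReMl.
  have -> : 1 * fam_normsq xi + 1 * fam_normsq eta = s * ((a + e) * fam_normsq xi + (a + e) * fam_normsq eta).
    by rewrite /s; field; rewrite gt_eqF.
  by rewrite [2 * _]mulrCA -mulrDr mulr_ge0 // ltW.
have ms : mnorm (conj_tuple m s : 'M[fam_system T]_(Nn m)) <= b.
  have -> : (conj_tuple m s : 'M[fam_system T]_(Nn m)) =
     map_mx g (map_mx f (conj_tuple m s : 'M[fam_system T]_(Nn m))).
    by apply/matrixP => p q; rewrite [RHS]mxE [X in _ = g X]mxE fK.
  apply: (cb_bound (D := range f)); first by rewrite Eb.
    by move=> p q; rewrite mxE; exists ((conj_tuple m s : 'M[fam_system T]_(Nn m)) p q).
  exact: mnorm_le ler01 fs.
have ltb : mnorm (X := fam_order T) (conj_tuple m s) < b + e.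
  by apply: le_lt_trans ms _; rewrite ltrDl.
have [r [_ rb /(tuple_order_bpos None fam_tuple_bounded)]] := tuple_order_lt lamV_ge0 fam_tuple_bounded ltb.
move=> /(_ (Some m) (or_intror Tm)) /(conj_tuple_lower (ltW s0)).
rewrite /s mulrC ler_pdivrMr //.
by apply/negP; rewrite -ltNge; apply: lt_trans abe; rewrite mulrC ltr_pM2l.
Qed.

End Family.

(** * A quantum expander *)

Section Character.
Variables (R : realType) (M : nat).
Local Notation C := R[i].
Local Notation N := (M.*2.+3).
Local Notation Zn := 'I_(M.*2.+1).+2.

Definition ang : R := 2 * pi / N%:R.
Definition chi_nat (k : nat) : C := cos (ang * k%:R) +i* sin (ang * k%:R).
Definition chi (a : Zn) : C := chi_nat a.

Lemma chi_natD j k : chi_nat (j + k) = chi_nat j * chi_nat k.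
Proof.
rewrite /chi_nat natrD mulrDr cosD sinD; apply/eqP; rewrite eq_complex /=.
by apply/andP; split; apply/eqP; ring.
Qed.

Lemma chi_natN : chi_nat N = 1.
Proof.
rewrite /chi_nat /ang divfK ?pnatr_eq0 //.
have -> : 2 * pi = pi *+ 2 :> R by rewrite mulr_natl.
by rewrite cos2pi sin2pi.
Qed.

Lemma chi_nat0 : chi_nat 0 = 1.
Proof. by rewrite /chi_nat mulr0 cos0 sin0. Qed.

Lemma chi_nat_mod k : chi_nat (k %% N) = chi_nat k.
Proof.
rewrite {2}(divn_eq k N) chi_natD.
suff -> : chi_nat (k %/ N * N) = 1 by rewrite mul1r.
by elim: (k %/ N)%N => [|j IH]; rewrite ?mul0n ?chi_nat0 // mulSn chi_natD chi_natN mul1r.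
Qed.

Lemma chiD (a b : Zn) : chi (a + b) = chi a * chi b.
Proof. by rewrite /chi /= chi_nat_mod chi_natD. Qed.

Lemma chi0 : chi 0 = 1.
Proof. exact: chi_nat0. Qed.

Lemma normsq_chi a : normsq (chi a) = 1.
Proof. by rewrite /normsq /chi /= cos2Dsin2. Qed.

Lemma chiNK a : chi a * chi (- a) = 1.
Proof. by rewrite -chiD subrr chi0. Qed.

Lemma conj_chi a : conjc (chi a) = chi (- a).
Proof.
have := chiNK a => h; rewrite -[LHS]mulr1 -h mulrA [conjc _ * _]mulrC mulzconj normsq_chi.
by rewrite mul1r.
Qed.

Lemma ang_bounds (a : Zn) (x y : R) : x * N%:R <= a%:R * 2 -> a%:R * 2 <= y * N%:R ->
  x * pi <= ang * a%:R <= y * pi.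
Proof.
move=> h1 h2; have N0 : 0 < N%:R :> R by rewrite ltr0n.
have p0 := pi_gt0 R.
have -> : ang * a%:R = (a%:R * 2) / N%:R * pi by rewrite /ang; ring.
by rewrite !ler_pM2r // ler_pdivlMr // ler_pdivrMr // h1 h2.
Qed.

Lemma chi_eq1 a : (chi a == 1) = (a == 0).
Proof.
apply/eqP/eqP => [h|->]; last exact: chi0.
apply/eqP; apply: contraT => a0; exfalso.
have a1 : (0 < a)%N by rewrite lt0n; apply: contra a0 => /eqP a0; apply/eqP/val_inj.
have : complex.Re (chi a) = 1 by rewrite h.
rewrite /chi /=.
have -> : ang * a%:R = (ang * a%:R / 2) *+ 2.
  by rewrite mulr2n -splitr.
rewrite cos_mulr2n cos2sin2.
have s0 : 0 < sin (ang * a%:R / 2).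
  apply: sin_gt0_pi.
  have p0 := pi_gt0 R; have N0 : 0 < N%:R :> R by rewrite ltr0n.
  have -> : ang * a%:R / 2 = a%:R / N%:R * pi
    by rewrite /ang; move: (N%:R) N0 => z z0; field; rewrite gt_eqF.
  apply/andP; split; first by rewrite mulr_gt0 // divr_gt0 // ltr0n.
  by rewrite gtr_pMl // ltr_pdivrMr // mul1r ltr_nat.
have : 0 < sin (ang * a%:R / 2) ^+ 2 by rewrite exprn_gt0.
by rewrite mulr2n; lra.
Qed.

(** On the half circle opposite to 1 the real part is nonpositive, and [|1 - z|^2 = 2 - 2 Re z] on
    the unit circle. *)
Lemma chi_far (a : Zn) : (N <= 4 * a)%N -> (4 * a <= 3 * N)%N -> 2 <= normsq (1 - chi a).
Proof.
move=> h1 h2.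
have E : normsq (1 - chi a) = 2 - 2 * complex.Re (chi a).
  have := normsq_chi a; rewrite /normsq; case: (chi a) => x y /=; lra.
suff : complex.Re (chi a) <= 0 by rewrite E; lra.
rewrite /chi /=.
have H1 : (1/2) * N%:R <= a%:R * 2 :> R.
  have : (N%:R <= (4 * a)%:R :> R) by rewrite ler_nat.
  by rewrite natrM; lra.
have H2 : a%:R * 2 <= (3/2) * N%:R :> R.
  have : ((4 * a)%:R <= (3 * N)%:R :> R) by rewrite ler_nat.
  by rewrite !natrM; lra.
have /andP[] := ang_bounds H1 H2; set t := ang * _ => t1 t2.
have := @cos_ge0_pihalf R (t - pi).
have -> : cos (t - pi) = - cos t by rewrite cosB cospi sinpi mulr0 addr0 mulrN1.
rewrite oppr_ge0; apply; apply/andP; split; lra.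
Qed.

Lemma chi_orth a : \sum_l chi (a * l) = if a == 0 then N%:R else 0.
Proof.
case: eqP => [->|/eqP a0].
  under eq_bigr => l _ do rewrite mul0r chi0.
  by rewrite sumr_const card_ord.
set S := \sum_l _.
have : chi a * S = S.
  rewrite /S mulr_sumr [RHS](reindex_inj (addrI 1)) /=; apply: eq_bigr => l _.
  by rewrite mulrDr mulr1 chiD.
move/eqP; rewrite -subr_eq0 -{2}[S]mul1r -mulrBl mulf_eq0 subr_eq0 chi_eq1 (negbTE a0) /=.
by move/eqP.
Qed.

Lemma parseval1 (x : Zn -> C) :
  \sum_b normsq (\sum_l chi (- (b * l)) * x l) = N%:R * \sum_l normsq (x l).
Proof.
apply: (@complexI R); rewrite rmorphM rmorph_nat !rmorph_sum /=.
transitivity (\sum_(b : Zn) \sum_(l : Zn) \sum_(m : Zn)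
    chi (- (b * l)) * x l * conjc (chi (- (b * m)) * x m)).
  apply: eq_bigr => b _; rewrite -mulzconj rmorph_sum /= mulr_suml.
  by apply: eq_bigr => l _; rewrite mulr_sumr.
rewrite exchange_big mulr_sumr /=; apply: eq_bigr => l _.
rewrite exchange_big /= (bigD1 l) //= [X in _ + X]big1 ?addr0 => [|m ml].
  rewrite -mulzconj; transitivity (\sum_(b : Zn) x l * conjc (x l)).
    apply: eq_bigr => b _; rewrite conjcM conj_chi opprK.
    by rewrite mulrACA -chiD addNr chi0 mul1r.
  by rewrite sumr_const card_ord mulr_natl.
transitivity (\sum_(b : Zn) chi ((m - l) * b) * (x l * conjc (x m))).
  apply: eq_bigr => b _; rewrite conjcM conj_chi opprK mulrACA -chiD; congr (chi _ * _).
  by ring.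
by rewrite -mulr_suml chi_orth subr_eq0 (negbTE ml) mul0r.
Qed.

(** The trace of [P] against the adjoint of the Weyl operator [e_l |-> chi (v.2 * l) e_(l + v.1)]:
    up to normalization, the coordinate of [P] in the Weyl basis. *)
Definition weyl_coef (P : 'M[C]_(M.*2.+3)) (v : Zn * Zn) : C :=
  \sum_l chi (- (v.2 * l)) * P (l + v.1) l.

Definition frobsq (P : 'M[C]_(M.*2.+3)) : R := \sum_j \sum_l normsq (P j l).

Lemma parseval P : \sum_v normsq (weyl_coef P v) = N%:R * frobsq P.
Proof.
rewrite -(pair_big xpredT xpredT (fun a b => normsq (weyl_coef P (a, b)))) /=.
rewrite /frobsq [in RHS]exchange_big mulr_sumr /=.
transitivity (\sum_a N%:R * \sum_l normsq (P (l + a) l)).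
  by apply: eq_bigr => a _; exact: (parseval1 (fun l => P (l + a) l)).
rewrite -mulr_sumr exchange_big mulr_sumr; apply: eq_bigr => l _; congr (_ * _).
by rewrite [RHS](reindex_inj (addrI l)).
Qed.

Lemma weyl_coefB P Q v : weyl_coef (P - Q) v = weyl_coef P v - weyl_coef Q v.
Proof.
rewrite /weyl_coef -sumrB; apply: eq_bigr => l _; rewrite !mxE; ring.
Qed.

(** A modulation [uZ], a quadratic phase [uD] and the Fourier transform [uF]. Conjugation by them
    permutes the Weyl operators up to phases, by the identity, a shear and a quarter turn of
    [(Z/N)^2]. *)
Definition uZ : 'M[C]_(M.*2.+3) := diag_mx (\row_j chi j).
(** The inverse of 2 modulo [N]; this is why the dimension [2M + 3] is odd. *)
Definition half : Zn := M.+2%:R.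
Definition uD : 'M[C]_(M.*2.+3) := diag_mx (\row_j chi (half * j * j)).
Definition uF : 'M[C]_(M.*2.+3) := \matrix_(j, l) ((Num.sqrt N%:R)^-1%:C * chi (j * l)).

Lemma half2 : half + half = 1.
Proof.
rewrite /half -natrD; apply/val_inj.
rewrite (Zp_nat (M.*2.+1)) /=.
have -> : (M.+2 + M.+2 = N + 1)%N by rewrite -addnn; lia.
by rewrite modnDl.
Qed.

Definition Ad N' (u P : 'M[C]_N') : 'M[C]_N' := u *m P *m adj u.

Lemma Ad_diag (d : Zn -> C) P j l :
  Ad (diag_mx (\row_j d j)) P j l = d j * P j l * conjc (d l).
Proof.
rewrite /Ad mxE (bigD1 l) //= big1 ?addr0 => [|s sl].
  rewrite adjE !mxE eqxx mulr1n; congr (_ * _).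
  rewrite (bigD1 j) //= big1 ?addr0 => [|r rj]; first by rewrite !mxE eqxx mulr1n.
  by rewrite !mxE eq_sym (negbTE rj) mulr0n mul0r.
by rewrite adjE !mxE eq_sym (negbTE sl) mulr0n conjc0 mulr0.
Qed.

Lemma weyl_coef_Z P v : weyl_coef (Ad uZ P) v = chi v.1 * weyl_coef P v.
Proof.
rewrite /weyl_coef mulr_sumr; apply: eq_bigr => l _; rewrite Ad_diag conj_chi chiD.
by rewrite -[LHS]mulr1 -(chiNK l); have := chiNK l; move: (chi l) (chi (- l)) => x y xy; ring: xy.
Qed.

(** The quadratic phase linearizes: [half * ((l + a)^2 - l^2) = half * a^2 + a * l], and the linear
    term shifts the frequency. *)
Lemma weyl_coef_D P v : weyl_coef (Ad uD P) v = chi (half * v.1 * v.1) * weyl_coef P (v.1, v.2 - v.1).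
Proof.
rewrite /weyl_coef mulr_sumr; apply: eq_bigr => l _ /=; rewrite Ad_diag conj_chi.
rewrite !mulrA -!chiD mulrAC -chiD; congr (chi _ * _).
have -> : - (v.2 * l) + half * (l + v.1) * (l + v.1) - half * l * l =
  half * v.1 * v.1 - v.2 * l + (half + half) * v.1 * l by ring.
by rewrite half2; ring.
Qed.

Lemma sqrtN_sq : (Num.sqrt N%:R)^-1%:C * (Num.sqrt N%:R)^-1%:C = (N%:R : R)^-1%:C.
Proof. by rewrite -rmorphM /= -invfM -expr2 sqr_sqrtr. Qed.

Lemma invNN : (N%:R : R)^-1%:C * N%:R = 1 :> C.
Proof.
have -> : N%:R = (N%:R : R)%:C :> C by rewrite rmorph_nat.
by rewrite -rmorphM mulVf ?pnatr_eq0.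
Qed.

Lemma weyl_coef_F P v : weyl_coef (Ad uF P) v = chi (v.1 * v.2) * weyl_coef P (v.2, - v.1).
Proof.
case: v => a b; rewrite /weyl_coef /=.
have AdE j l : Ad uF P j l = (N%:R : R)^-1%:C * \sum_s \sum_r chi (j * r - l * s) * P r s.
  rewrite /Ad mxE mulr_sumr; apply: eq_bigr => s _.
  rewrite mxE mulr_suml mulr_sumr; apply: eq_bigr => r _.
  rewrite adjE !mxE conjcM conj_real conj_chi chiD -sqrtN_sq; ring.
under eq_bigr => l _ do rewrite AdE.
transitivity (\sum_s \sum_r (N%:R : R)^-1%:C * P r s *
     \sum_l chi (- (b * l)) * chi ((l + a) * r - l * s)).
  transitivity (\sum_l \sum_s \sum_r (N%:R : R)^-1%:C * P r s *
     (chi (- (b * l)) * chi ((l + a) * r - l * s))).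
    apply: eq_bigr => l _; rewrite !mulr_sumr; apply: eq_bigr => s _.
    by rewrite !mulr_sumr; apply: eq_bigr => r _; ring.
  rewrite exchange_big /=; apply: eq_bigr => s _; rewrite exchange_big /=.
  by apply: eq_bigr => r _; rewrite mulr_sumr.
rewrite mulr_sumr; apply: eq_bigr => s _.
rewrite (bigD1 (s + b)) //= [X in _ + X]big1 ?addr0 => [|r rsb].
  transitivity ((N%:R : R)^-1%:C * P (s + b) s * \sum_(l : Zn) chi (a * (s + b))).
    congr (_ * _); apply: eq_bigr => l _; rewrite -chiD; congr chi; ring.
  rewrite sumr_const card_ord -[X in _ * X](mulr_natl (chi (a * (s + b)))).
  rewrite mulrACA invNN mul1r mulrC mulrA -chiD.
  by congr (chi _ * _); ring.
have -> : \sum_l chi (- (b * l)) * chi ((l + a) * r - l * s) =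
   chi (a * r) * \sum_l chi ((r - (s + b)) * l).
  rewrite mulr_sumr; apply: eq_bigr => l _; rewrite -!chiD; congr chi; ring.
by rewrite chi_orth subr_eq0 (negbTE rsb) !mulr0.
Qed.

Lemma unit_diag (d : Zn -> C) : (forall j, normsq (d j) = 1) ->
  diag_mx (\row_j d j) *m adj (diag_mx (\row_j d j)) = 1%:M.
Proof.
move=> d1; rewrite -[X in X *m _]mulmx1 -/(Ad _ _); apply/matrixP => j l.
rewrite Ad_diag !mxE; case: eqP => [->|_]; last by rewrite mulr0 mul0r.
by rewrite mulr1 mulzconj d1.
Qed.

Lemma unit_uF : uF *m adj uF = 1%:M.
Proof.
apply/matrixP => j l; rewrite mxE [RHS]mxE.
transitivity ((N%:R : R)^-1%:C * \sum_s chi ((j - l) * s)).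
  rewrite mulr_sumr; apply: eq_bigr => s _.
  rewrite adjE !mxE conjcM conj_real conj_chi mulrBl chiD -sqrtN_sq; ring.
rewrite chi_orth subr_eq0; case: eqP => _; last by rewrite mulr0.
exact: invNN.
Qed.

End Character.

(** * Mass transport on [(Z/N)^2] under the shear and the rotation *)

Section Expander.
Variables (R : realType) (M : nat).
Local Notation C := R[i].
Local Notation N := (M.*2.+3).
Local Notation Zn := 'I_(M.*2.+1).+2.
Implicit Types (a b : Zn) (v : Zn * Zn).

Lemma val_Zadd a b : nat_of_ord (a + b) = if (a + b < N)%N then (a + b)%N else (a + b - N)%N.
Proof.
have := ltn_ord a; have := ltn_ord b => /= hb ha; case: ifP => h /=.
  by rewrite modn_small.
have -> : (a + b = (a + b - N) + N)%N by lia.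
by rewrite modnDr modn_small; lia.
Qed.

Lemma val_Zopp a : nat_of_ord (- a) = if nat_of_ord a == 0 then 0 else (N - a)%N.
Proof.
have ha := ltn_ord a; rewrite /=; case: eqP => h; first by rewrite h subn0 modnn.
by rewrite modn_small //; lia.
Qed.

Definition cabs a : nat := minn a (N - a).
Definition is_pos a := (0 < a <= M.+1)%N.
Definition is_neg a := (M.+1 < a)%N.
Definition same_sign v := (is_pos v.1 && is_pos v.2) || (is_neg v.1 && is_neg v.2).
(** The arc treated by [chi_far]. Off it, residues have absolute value below [N / 4], so sums and
    differences of two of them do not wrap around. *)
Definition far a := (N <= 4 * a)%N && (4 * a <= 3 * N)%N.
Definition wide v := (cabs v.2 < cabs v.1)%N.
Definition tall v := (cabs v.1 < cabs v.2)%N.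
Definition near_origin v := ~~ far v.1 && ~~ far v.2.

Definition shear v : Zn * Zn := (v.1, v.2 - v.1).
Definition turn v : Zn * Zn := (v.2, - v.1).

Lemma shear_inj : injective shear.
Proof.
move=> [a b] [a' b'] h; have : a = a' := congr1 fst h; have : b - a = b' - a' := congr1 snd h.
by move=> /[swap] -> /addIr ->.
Qed.

Lemma turn_inj : injective turn.
Proof.
move=> [a b] [a' b'] h; have : b = b' := congr1 fst h; have : - a = - a' := congr1 snd h.
by move=> /oppr_inj -> ->.
Qed.

Lemma val_Zsub a b : nat_of_ord (b - a) = if (a <= b)%N then (b - a)%N else (b + N - a)%N.
Proof.
rewrite val_Zadd val_Zopp; have := ltn_ord a; have := ltn_ord b.
by case: eqP => h; case: ifP; case: ifP; lia.
Qed.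

Ltac unfold_cones := rewrite /same_sign /near_origin /wide /tall /cabs /is_pos /is_neg /far; cbn [fst snd shear turn].

(** Without wrap-around, [|b - a| = |a| + |b|] when the signs do not agree. The next lemma is the
    mirror image: the inverse shear adds [a] to a coordinate of the same sign. *)
Lemma shear_opposite v : ~~ same_sign v && near_origin v -> ~~ same_sign (shear v) && ~~ wide (shear v).
Proof.
case: v => a b; unfold_cones; rewrite val_Zsub; have := ltn_ord a; have := ltn_ord b.
case: ifP; lia.
Qed.

Lemma shear_same v : same_sign (shear v) && near_origin (shear v) -> same_sign v && ~~ wide v.
Proof.
case: v => a b; unfold_cones; rewrite val_Zsub; have := ltn_ord a; have := ltn_ord b.
case: ifP; lia.
Qed.

Lemma turn_tall v : tall v -> wide (turn v).
Proof.
case: v => a b; unfold_cones; rewrite val_Zopp; have := ltn_ord a; have := ltn_ord b.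
case: ifP; lia.
Qed.

Definition on_diag v := (v.1 == v.2) && (v.1 != 0).
Definition on_antidiag v := (v.1 == - v.2) && (v.1 != 0).

Lemma neq0_val a : (a != 0) = (0 < a)%N.
Proof. by rewrite lt0n. Qed.

Lemma shear_diag v : on_diag v -> wide (shear v).
Proof.
case: v => a b; rewrite /on_diag neq0_val /= => /andP[/eqP <- a0].
unfold_cones; rewrite subrr /=; have := ltn_ord a; lia.
Qed.

Lemma shear_antidiag v : on_antidiag (shear v) -> wide v.
Proof.
case: v => a b; rewrite /on_antidiag neq0_val; cbn [fst snd shear]; move=> /andP[/eqP chi0 a0].
have -> : b = 0.
  have : a + 0 = a - b by rewrite addr0 {1}chi0 opprB.
  by move=> /addrI/esym/eqP; rewrite oppr_eq0 => /eqP.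
unfold_cones; rewrite /=; have := ltn_ord a; lia.
Qed.

Lemma cones_cover v : [|| v == (0, 0), wide v, tall v, on_diag v | on_antidiag v].
Proof.
case: v => a b; rewrite /on_diag /on_antidiag; unfold_cones.
rewrite xpair_eqE -!val_eqE -[val (- b)]/(nat_of_ord (- b)) val_Zopp /=.
have := ltn_ord a; have := ltn_ord b; case: ifP; lia.
Qed.

(** The constants are [1 + 1/10] and [1 + 10]. The first must be near 1: with [c] in its place,
    [expander0] closes only if [(1 + 3 * c) * (c - 1) < c]. *)
Lemma normsq_cmp (x y : C) : normsq x <= 11 / 10 * normsq y + 11 * normsq (x - y).
Proof.
case: x y => [a b] [c d]; rewrite /normsq /=.
have := sqr_ge0 (a - c - c / 10); have := sqr_ge0 (b - d - d / 10).
have := sqr_ge0 (a - c); have := sqr_ge0 (b - d); nra.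
Qed.

Section Compare.
Variables (f ph : Zn * Zn -> C) (sg : Zn * Zn -> Zn * Zn).
Hypothesis sg_inj : injective sg.
Hypothesis ph1 : forall v, normsq (ph v) = 1.
Local Notation mu Q := (\sum_(v | Q v) normsq (f v)).
Local Notation E := (\sum_v normsq (f v - ph v * f (sg v))).

Lemma defect_sum_ge (Q : pred (Zn * Zn)) : \sum_(v | Q v) normsq (f v - ph v * f (sg v)) <= E.
Proof.
by rewrite [leRHS](bigID Q) /= lerDl; apply: sumr_ge0 => ? _; apply: normsq_ge0.
Qed.

Lemma mu_le (Q Q' : pred (Zn * Zn)) (g : Zn * Zn -> R) : (forall v, 0 <= g v) ->
  (forall v, Q v -> Q' v) -> \sum_(v | Q v) g v <= \sum_(v | Q' v) g v.
Proof.
move=> g0 h; rewrite big_mkcond [leRHS]big_mkcond; apply: ler_sum => v _.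
by case: ifP => [/h ->//|_]; case: ifP.
Qed.

Lemma cmp_fwd (Q Q' : pred (Zn * Zn)) : (forall v, Q v -> Q' (sg v)) ->
  mu Q <= 11 / 10 * mu Q' + 11 * E.
Proof.
move=> h; rewrite [\sum_(v | Q' v) _](reindex_inj sg_inj) /=.
apply: (@le_trans _ _ (\sum_(v | Q v) (11 / 10 * normsq (f (sg v)) +
    11 * normsq (f v - ph v * f (sg v))))).
  apply: ler_sum => v _; apply: le_trans (normsq_cmp _ (ph v * f (sg v))) _.
  by rewrite normsqM ph1 mul1r.
rewrite big_split /= -!mulr_sumr; apply: lerD; last by rewrite ler_pM2l // defect_sum_ge.
by rewrite ler_pM2l ?divr_gt0 //; apply: (mu_le (g := fun v => normsq (f (sg v)))) => // v; exact: normsq_ge0.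
Qed.

Lemma cmp_bwd (Q Q' : pred (Zn * Zn)) : (forall v, Q (sg v) -> Q' v) ->
  mu Q <= 11 / 10 * mu Q' + 11 * E.
Proof.
move=> h; rewrite [\sum_(v | Q v) _](reindex_inj sg_inj) /=.
apply: (@le_trans _ _ (\sum_(v | Q (sg v)) (11 / 10 * normsq (f v) +
    11 * normsq (f v - ph v * f (sg v))))).
  apply: ler_sum => v _; have -> : normsq (f (sg v)) = normsq (ph v * f (sg v)) by rewrite normsqM ph1 mul1r.
  apply: le_trans (normsq_cmp _ (f v)) _.
  by rewrite -[normsq (_ - f v)]normsqN opprB.
rewrite big_split /= -!mulr_sumr; apply: lerD; last first.
  by rewrite ler_pM2l // (defect_sum_ge (fun v => Q (sg v))).
by rewrite ler_pM2l ?divr_gt0 //; apply: (mu_le (g := fun v => normsq (f v))) => // v; exact: normsq_ge0.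
Qed.

End Compare.

Definition defect (u P : 'M[C]_N) : R := frobsq (P - Ad u P).

Lemma defectE u P (ph : Zn * Zn -> C) sg :
  (forall v, weyl_coef (Ad u P) v = ph v * weyl_coef P (sg v)) ->
  \sum_v normsq (weyl_coef P v - ph v * weyl_coef P (sg v)) = N%:R * defect u P.
Proof.
by move=> h; rewrite -parseval; apply: eq_bigr => v _; rewrite weyl_coefB h.
Qed.

(* The measure [normsq (weyl_coef P v)] on [(Z/N)^2] is almost invariant under the shear
   [shear] and the rotation [turn] and almost supported near the origin, where
   these maps move all the mass away from itself; so it is small off [0]. *)
Lemma expander0 P : weyl_coef P (0, 0) = 0 ->
  frobsq P <= 200 * (defect (uZ R M) P + defect (uD R M) P + defect (uF R M) P).
Proof.
move=> P0; pose f v := weyl_coef P v; pose mu (Q : pred (Zn * Zn)) := \sum_(v | Q v) normsq (f v).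
have muE Q : mu Q = \sum_v if Q v then normsq (f v) else 0 by rewrite /mu big_mkcond.
have f0 v : 0 <= normsq (f v) by apply: normsq_ge0.
have EZ := defectE (sg := id) (weyl_coef_Z P); have ED := defectE (sg := shear) (weyl_coef_D P).
have EF := defectE (sg := turn) (weyl_coef_F P).
set dZ := defect _ P in EZ *; set dD := defect _ P in ED *; set dF := defect _ P in EF *.
have phD v : normsq (chi R (half M * v.1 * v.1)) = 1 by apply: normsq_chi.
have phF v : normsq (chi R (v.1 * v.2)) = 1 by apply: normsq_chi.
have m1 : mu (fun v => ~~ same_sign v && near_origin v) <=
    11 / 10 * mu (fun v => ~~ same_sign v && ~~ wide v) + 11 * (N%:R * dD).
  by rewrite -ED; apply: cmp_fwd => //; [exact: shear_inj|exact: shear_opposite].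
have m2 : mu (fun v => same_sign v && near_origin v) <=
    11 / 10 * mu (fun v => same_sign v && ~~ wide v) + 11 * (N%:R * dD).
  by rewrite -ED; apply: cmp_bwd => //; [exact: shear_inj|exact: shear_same].
have m3 : mu tall <= 11 / 10 * mu wide + 11 * (N%:R * dF).
  by rewrite -EF; apply: cmp_fwd => //; [exact: turn_inj|exact: turn_tall].
have m4 : mu on_diag <= 11 / 10 * mu wide + 11 * (N%:R * dD).
  by rewrite -ED; apply: cmp_fwd => //; [exact: shear_inj|exact: shear_diag].
have m5 : mu on_antidiag <= 11 / 10 * mu wide + 11 * (N%:R * dD).
  by rewrite -ED; apply: cmp_bwd => //; [exact: shear_inj|exact: shear_antidiag].
have m6 : mu (fun v => far v.2) <= 11 / 10 * mu (fun v => far v.1) + 11 * (N%:R * dF).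
  by rewrite -EF; apply: cmp_fwd => //; exact: turn_inj.
have m7 : 2 * mu (fun v => far v.1) <= N%:R * dZ.
  rewrite -EZ mulr_sumr [leRHS](bigID (fun v => far v.1)) /=.
  apply: (@le_trans _ _ (\sum_(v | far v.1) normsq (weyl_coef P v - chi R v.1 * weyl_coef P v))).
    apply: ler_sum => v /andP[h1 h2].
    rewrite -[X in X - _]mul1r -mulrBl normsqM.
    by apply: ler_wpM2r; [exact: normsq_ge0|exact: chi_far].
  by rewrite lerDl; apply: sumr_ge0 => ? _; apply: normsq_ge0.
have T : mu xpredT = N%:R * frobsq P by rewrite /mu parseval.
have s1 : mu xpredT <= mu wide + mu tall + mu on_diag + mu on_antidiag.
  rewrite !muE -!big_split /=; apply: ler_sum => v _.
  have := cones_cover v; have [-> _|_ /=] := eqVneq v (0, 0).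
    by rewrite /f P0 /normsq /= expr0n addr0 !if_same !addr0.
  have := f0 v; move: (normsq _) => x x0.
  by case: (wide v); case: (tall v); case: (on_diag v); case: (on_antidiag v) => //= _; lra.
have s2 : mu xpredT <= mu (fun v => ~~ same_sign v && near_origin v) +
    mu (fun v => same_sign v && near_origin v) + mu (fun v => far v.1) + mu (fun v => far v.2).
  rewrite !muE -!big_split /=; apply: ler_sum => v _.
  have := f0 v; move: (normsq _) => x x0; rewrite /near_origin.
  by case: (same_sign v); case: (far v.1); case: (far v.2) => /=; lra.
have s3 : mu xpredT = mu wide + mu (fun v => ~~ same_sign v && ~~ wide v) +
    mu (fun v => same_sign v && ~~ wide v).
  rewrite !muE -!big_split /=; apply: eq_bigr => v _.
  by case: (same_sign v); case: (wide v) => /=; lra.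
have fr0 u : 0 <= N%:R * defect u P.
  by rewrite mulr_ge0 //; do 2 (apply: sumr_ge0 => ? _); apply: normsq_ge0.
have := fr0 (uZ R M); have := fr0 (uD R M); have := fr0 (uF R M).
rewrite -/dZ -/dD -/dF => z1 z2 z3.
have N0 : 0 < N%:R :> R by rewrite ltr0n.
(* By [s2] and [s3] the wide mass is at most 1/11 of the total plus defects; by [s1] the total is at
   most 43/10 of the wide mass plus defects. As 43/110 < 1 this closes; the largest resulting
   coefficient is about 178. *)
rewrite -(ler_pM2l N0) -T; lra.
Qed.

End Expander.

(** * From three unitaries to selfadjoint matrices with a low-rank gap *)

Section Gap.
Variable R : realType.
Local Notation C := R[i].

Lemma frobsq_trace M (A : 'M[C]_(M.*2.+3)) : adj A = A -> (frobsq A)%:C = \tr (A *m A).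
Proof.
move=> sA; rewrite /frobsq /mxtrace rmorph_sum; apply: eq_bigr => j _.
rewrite rmorph_sum mxE; apply: eq_bigr => l _ /=.
by rewrite -mulzconj -adjE sA.
Qed.

Lemma Ad_sa N (u P : 'M[C]_N) : adj P = P -> adj (Ad u P) = Ad u P.
Proof. by move=> sP; rewrite /Ad !adjM adjK sP mulmxA. Qed.

Lemma defect_trace M (u P : 'M[C]_(M.*2.+3)) : adj P = P -> u *m adj u = 1%:M ->
  (defect u P)%:C = 2 * \tr (P *m P) - 2 * \tr (P *m Ad u P).
Proof.
move=> sP uu; have uu' : adj u *m u = 1%:M by apply: mulmx1C.
rewrite /defect frobsq_trace; last by rewrite adjD adjN Ad_sa // sP.
rewrite mulmxBl !mulmxBr !raddfB /= [\tr (Ad u P *m P)]mxtrace_mulC.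
have -> : \tr (Ad u P *m Ad u P) = \tr (P *m P).
  rewrite /Ad !mulmxA mxtrace_mulC !mulmxA uu' mul1mx.
  by rewrite -[P *m adj u *m u]mulmxA uu' mulmx1.
ring.
Qed.

(** Conjugation fixes the scalar part of [P]. Removing it kills the Weyl coefficient at the origin,
    which is the trace, and costs exactly [t ^+ 2 / N] of the squared norm. *)
Lemma expander M (P : 'M[C]_(M.*2.+3)) (t : R) : adj P = P -> \tr P = t%:C ->
  frobsq P - t ^+ 2 / (M.*2.+3)%:R <=
  200 * (defect (uZ R M) P + defect (uD R M) P + defect (uF R M) P).
Proof.
move=> sP tP; set N := M.*2.+3.
pose s : C := (t / N%:R)%:C; pose P' := P - s%:M.
have ss : adj (s%:M : 'M[C]_N) = s%:M.
  apply/matrixP => i j; rewrite !mxE eq_sym; case: eqP => _; last by rewrite !mulr0n conjc0.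
  by rewrite !mulr1n conj_real.
have sP' : adj P' = P' by rewrite /P' adjD adjN sP ss.
have Nn : N%:R != 0 :> C by rewrite pnatr_eq0.
have NnR : N%:R != 0 :> R by rewrite pnatr_eq0.
have sN : s * N%:R = t%:C.
  have -> : N%:R = (N%:R : R)%:C :> C by rewrite rmorph_nat.
  by rewrite /s -rmorphM /= divfK.
have trs : \tr (s%:M : 'M[C]_N) = t%:C by rewrite mxtrace_scalar -mulr_natr.
have def u : u *m adj u = 1%:M -> defect u P' = defect u P.
  move=> uu; rewrite /defect; congr frobsq; rewrite /P' /Ad mulmxBr mulmxBl.
  by rewrite mul_mx_scalar -scalemxAl uu scalemx1 opprB addrA subrK.
have froE : frobsq P' = frobsq P - t ^+ 2 / N%:R.
  apply: (@complexI R); rewrite rmorphB /= !frobsq_trace // /P'.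
  rewrite mulmxBl !mulmxBr !mul_scalar_mx mul_mx_scalar !raddfB /= !mxtraceZ tP trs.
  have -> : (t ^+ 2 / N%:R)%:C = s * t%:C.
    by rewrite -rmorphM; congr (_%:C); rewrite expr2 mulrAC.
  ring.
rewrite -froE -!def; first last.
- by apply: unit_diag => j; apply: normsq_chi.
- by apply: unit_diag => j; apply: normsq_chi.
- exact: unit_uF.
apply: expander0; rewrite /weyl_coef /=.
have -> : \sum_l chi R (- (0 * l)) * P' (l + 0) l = \tr P'.
  by apply: eq_bigr => l _; rewrite mul0r oppr0 chi0 mul1r addr0.
by rewrite /P' raddfB /= tP trs subrr.
Qed.

(** Real and imaginary parts of three unitaries, up to sign, since selfadjoint matrices are
    required; the factor [1 / (2 sqrt 3)] makes the squares sum to 1. *)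
Definition parts N (u : 'I_3 -> 'M[C]_N) (i : 'I_(3 + 3)) : 'M[C]_N :=
  let c := ((2 * Num.sqrt 3)^-1 : R)%:C in
  match fintype.split i with
  | inl j => c *: (u j + adj (u j))
  | inr j => (c * 'i%C) *: (u j - adj (u j))
  end.

Lemma big_parts N (u : 'I_3 -> 'M[C]_N) (F : 'M[C]_N -> C) :
  \sum_i F (parts u i) = \sum_j (F (((2 * Num.sqrt 3)^-1 : R)%:C *: (u j + adj (u j))) +
     F ((((2 * Num.sqrt 3)^-1 : R)%:C * 'i%C) *: (u j - adj (u j)))).
Proof.
rewrite big_split_ord big_split /=; congr (_ + _); apply: eq_bigr => j _; congr F.
  by rewrite /parts (fintype.unsplitK (inl j)).
by rewrite /parts (fintype.unsplitK (inr j)).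
Qed.

Lemma parts_sa N (u : 'I_3 -> 'M[C]_N) i : adj (parts u i) = parts u i.
Proof.
rewrite /parts; case: fintype.split => j.
  by rewrite adjZ conj_real adjD adjK addrC.
rewrite adjZ adjD adjN adjK conjcM conj_real.
have -> : conjc 'i%C = - 'i%C :> C by rewrite /= ; apply/eqP; rewrite eq_complex /= oppr0 !eqxx.
by rewrite mulrN scaleNr -scalerN opprD opprK addrC.
Qed.

Lemma part_scale_sq : ((2 * Num.sqrt 3)^-1 : R)%:C * ((2 * Num.sqrt 3)^-1 : R)%:C = (12^-1 : R)%:C.
Proof.
rewrite -rmorphM /=; congr (_%:C); rewrite -invfM; congr (_^-1).
have : Num.sqrt 3 ^+ 2 = 3 :> R by rewrite sqr_sqrtr.
by rewrite expr2 => h; rewrite mulrACA h; ring.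
Qed.

Lemma imaginary_sq : 'i%C * 'i%C = -1 :> C.
Proof. by apply/eqP; rewrite eq_complex /=; apply/andP; split; apply/eqP; ring. Qed.

(** The terms [u P u] and [adj u P adj u] occur with opposite signs in the two products, as
    [i^2 = -1]. *)
Lemma part_sandwich N (u P : 'M[C]_N) (c := ((2 * Num.sqrt 3)^-1 : R)%:C) :
  (c *: (u + adj u)) *m P *m (c *: (u + adj u)) +
  ((c * 'i%C) *: (u - adj u)) *m P *m ((c * 'i%C) *: (u - adj u)) =
  (6^-1 : R)%:C *: (u *m P *m adj u + adj u *m P *m u).
Proof.
rewrite -!scalemxAl -!scalemxAr !scalerA mulrACA imaginary_sq part_scale_sq.
rewrite !(mulmxDl, mulmxDr, mulmxBl, mulmxBr) mulrN1 scaleNr -scalerBr.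
have -> : (6^-1 : R)%:C = (12^-1 : R)%:C *+ 2 :> C.
  by rewrite -rmorphMn /=; congr (_%:C); rewrite -mulr_natr; field.
rewrite -scalerMnl scalerMnr; congr (_ *: _).
rewrite !mulNmx !mulmxN.
move: (u *m P *m u) (u *m P *m adj u) (adj u *m P *m u) (adj u *m P *m adj u) => a b c' d.
by apply/matrixP => i j; rewrite !mulr2n !mxE; ring.
Qed.

Lemma mxtrace_sandwich N (P u w : 'M[C]_N) :
  \tr (P *m (w *m P *m u)) = \tr (P *m (u *m P *m w)).
Proof. by rewrite -!mulmxA [in LHS]mulmxA mxtrace_mulC !mulmxA. Qed.

Lemma parts_sq N (u : 'I_3 -> 'M[C]_N) : (forall j, u j *m adj (u j) = 1%:M) ->
  \sum_i parts u i *m parts u i = 1%:M.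
Proof.
move=> uu; have uu' j : adj (u j) *m u j = 1%:M by apply: mulmx1C.
rewrite big_split_ord /= -big_split /=.
transitivity (\sum_(j < 3) (3^-1 : R)%:C *: (1%:M : 'M[C]_N)).
  apply: eq_bigr => j _; have := part_sandwich (u j) 1%:M; cbv zeta; rewrite !mulmx1 uu uu'.
  rewrite /parts (fintype.unsplitK (inl j)) (fintype.unsplitK (inr j)) => ->.
  rewrite -mulr2n -scalerMnr scalerMnl; congr (_ *: _).
  by rewrite -rmorphMn /=; congr (_%:C); rewrite -mulr_natr; field.
rewrite sumr_const card_ord scalerMnl -[RHS]scale1r; congr (_ *: _).
by rewrite -rmorphMn /= -mulr_natr mulVf ?pnatr_eq0.
Qed.

(** Since [2k <= N], removing the scalar part of [P] leaves at least half of [S], the squared norm.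
    The defects thus sum to at least [S / 400], and one sixth of them is lost in the sum: this is
    the origin of [24 * 100]. *)
Lemma parts_gap k M (mu : R) : (2 * k <= M.*2.+3)%N -> 0 <= mu ->
  24 * (100 * (1 - mu)) <= 1 -> gap k (Num.sqrt mu) (parts (fun j : 'I_3 =>
    if (val j == 0)%N then uZ R M else if (val j == 1)%N then uD R M else uF R M)).
Proof.
set u := fun j : 'I_3 => _; set N := M.*2.+3 => kN mu0 hmu U s UU UU' s0 hs.
have uu j : u j *m adj (u j) = 1%:M.
  rewrite /u; case: ifP => _; first by apply: unit_diag => l; apply: normsq_chi.
  by case: ifP => _; [apply: unit_diag => l; apply: normsq_chi|exact: unit_uF].
pose D : 'M[C]_N := diag_mx (\row_a (s a)%:C).
pose P := adj U *m D *m U.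
have sD : adj D = D.
  apply/matrixP => a b; rewrite !mxE eq_sym; case: eqP => [->|_].
    by rewrite !mulr1n conj_real.
  by rewrite !mulr0n conjc0.
have sP : adj P = P by rewrite /P !adjM adjK sD mulmxA.
have trP : \tr P = (\sum_a s a)%:C.
  rewrite /P mxtrace_mulC mulmxA UU mul1mx mxtrace_diag rmorph_sum.
  by apply: eq_bigr => a _; rewrite mxE.
have trPP : \tr (P *m P) = (\sum_a s a ^+ 2)%:C.
  rewrite /P !mulmxA mxtrace_mulC !mulmxA UU mul1mx -[D *m U *m adj U]mulmxA UU mulmx1.
  rewrite mul_diag_mx rmorph_sum; apply: eq_bigr => a _.
  by rewrite !mxE eqxx mulr1n -rmorphM expr2.
have term (g : 'M[C]_N) : adj g = g ->
   (\sum_a \sum_b normsq ((U *m g *m adj U) a b) * (s a * s b))%:C = \tr (P *m (g *m P *m g)).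
  move=> sg; pose G := U *m g *m adj U.
  have sG : adj G = G by rewrite /G !adjM adjK sg mulmxA.
  have -> : \tr (P *m (g *m P *m g)) = \tr (D *m G *m (D *m G)).
    by rewrite /P /G !mulmxA [RHS]mxtrace_mulC !mulmxA.
  rewrite -/G; clearbody G.
  rewrite /mxtrace rmorph_sum; apply: eq_bigr => a _; rewrite rmorph_sum mxE.
  apply: eq_bigr => b _ /=; rewrite !mul_diag_mx !mxE.
  have -> : G b a = conjc (G a b) by rewrite -adjE sG.
  by rewrite mulrACA mulzconj -!rmorphM /= mulrC.
rewrite sqr_sqrtr //.
have froP : frobsq P = \sum_a s a ^+ 2.
  by apply: (@complexI R); rewrite frobsq_trace // trPP.
have tot : \sum_i \sum_a \sum_b normsq ((U *m parts u i *m adj U) a b) * (s a * s b) =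
   \sum_a s a ^+ 2 - 6^-1 * \sum_j defect (u j) P.
  apply: (@complexI R); rewrite rmorph_sum.
  transitivity (\sum_i \tr (P *m (parts u i *m P *m parts u i))).
    by apply: eq_bigr => i _; exact: term (parts_sa u i).
  rewrite (big_parts u (fun g => \tr (P *m (g *m P *m g)))) rmorphB rmorphM /= rmorph_sum /=.
  transitivity (\sum_(j < 3) ((3^-1 : R)%:C * (\sum_a s a ^+ 2)%:C -
      (6^-1 : R)%:C * (defect (u j) P)%:C)).
    apply: eq_bigr => j _; rewrite -mxtraceD -mulmxDr part_sandwich.
    rewrite defect_trace // -trPP -scalemxAr mxtraceZ mulmxDr raddfD /=.
    have -> : \tr (P *m (adj (u j) *m P *m u j)) = \tr (P *m Ad (u j) P).
      exact: mxtrace_sandwich.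
    rewrite -/(Ad (u j) P); move: (\tr _) (\tr _) => x y.
    have -> : (3^-1 : R)%:C = (6^-1 : R)%:C * 2 :> C.
      have -> : 2 = (2 : R)%:C :> C by rewrite rmorph_nat.
      by rewrite -rmorphM /=; congr (_%:C); field.
    ring.
  rewrite sumrB sumr_const card_ord -mulr_sumr; congr (_ - _); last by rewrite rmorph_sum.
  rewrite -mulrnAl.
  have -> : (3^-1 : R)%:C *+ 3 = 1 :> C.
    by rewrite -rmorphMn /= -mulr_natr mulVf ?pnatr_eq0.
  by rewrite mul1r rmorph_sum.
rewrite tot; have := expander sP trP; rewrite froP.
have -> : \sum_j defect (u j) P = defect (uZ R M) P + defect (uD R M) P + defect (uF R M) P.
  by rewrite !big_ord_recl big_ord0 addr0 addrA.
have N0 : 0 < N%:R :> R by rewrite ltr0n.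
set S := \sum_a s a ^+ 2; set d := _ + _ + _ => h.
have S0 : 0 <= S by apply: sumr_ge0 => a _; apply: sqr_ge0.
have : (\sum_a s a) ^+ 2 / N%:R <= S / 2.
  rewrite ler_pdivrMr //; apply: le_trans hs _; rewrite mulrAC -mulrA mulrC -/S.
  have : (2 * k)%:R <= N%:R :> R by rewrite ler_nat.
  rewrite natrM => h1; rewrite mulrC; nra.
rewrite -/N in h; have := ler_wpM2r S0 hmu; lra.
Qed.

Lemma gap_exists : exists n (lam : R), [/\ 0 < lam, lam < 1 &
  forall k, exists N (h : 'I_n -> 'M[C]_N), [/\ (k <= N)%N /\ (0 < N)%N,
    forall i, adj (h i) = h i, \sum_i h i *m h i = 1%:M & gap k lam h]].
Proof.
pose mu : R := 1 - (24 * 100)^-1.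
have mu0 : 0 < mu.
  rewrite subr_gt0 invf_lt1; first by rewrite -natrM (ltr_nat _ 1).
  by rewrite mulr_gt0.
have mu1 : mu < 1 by rewrite gtrBl invr_gt0 mulr_gt0.
have hmu : 24 * (100 * (1 - mu)) <= 1.
  by rewrite /mu opprB addrC subrK mulrA mulfV // mulf_neq0 // pnatr_eq0.
exists (3 + 3)%N, (Num.sqrt mu); split.
- by rewrite sqrtr_gt0.
- by rewrite -[ltRHS]sqrtr1 ltr_sqrt.
move=> k; exists (k.*2.+3)%N; eexists; split; last first.
- by apply: (@parts_gap k k mu _ (ltW mu0) hmu); rewrite -mul2n; lia.
- apply: parts_sq => j; case: ifP => _; first by apply: unit_diag => l; apply: normsq_chi.
  by case: ifP => _; [apply: unit_diag => l; apply: normsq_chi|exact: unit_uF].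
- by move=> i; apply: parts_sa.
- by split=> //; lia.
Qed.

End Gap.

(** * The diagonal argument *)

Section Sequence.
Variables (R : realType) (n : nat) (lam : R).
Local Notation C := R[i].

Lemma family_exists :
  (forall k, exists N (h : 'I_n -> 'M[C]_N), [/\ (k <= N)%N /\ (0 < N)%N,
    forall i, adj (h i) = h i, \sum_i h i *m h i = 1%:M & gap k lam h]) ->
  exists (Nn : nat -> nat) (h : forall m, 'I_n -> 'M[C]_(Nn m)) (kap : nat -> nat),
    [/\ forall m i, adj (h m i) = h m i,
        forall m, \sum_i h m i *m h m i = 1%:M,
        forall m, gap (kap m) lam (h m) &
        [/\ forall m m', (m <= m')%N -> (kap m <= kap m')%N,
            forall m, (m <= kap m)%N,
            forall j m, (j < m)%N -> (Nn j + Nn j <= kap m)%N &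
            forall m, (kap m <= Nn m)%N /\ (0 < Nn m)%N]].
Proof.
move=> H; pose N k := projT1 (cid (H k)).
pose h k : 'I_n -> 'M[C]_(N k) := projT1 (cid (projT2 (cid (H k)))).
have hP k : [/\ (k <= N k)%N /\ (0 < N k)%N, forall i, adj (h k i) = h k i,
   \sum_i h k i *m h k i = 1%:M & gap k lam (h k)].
  exact: (projT2 (cid (projT2 (cid (H k))))).
clearbody h; clearbody N.
(* Twice the previous dimension is what the exchange of tensor factors requires; the successor gives
   [m <= kap m]. *)
pose kap := fix kap m := if m is m'.+1 then (kap m' + (N (kap m') + N (kap m'))).+1 else 0%N.
have kapS m : kap m.+1 = (kap m + (N (kap m) + N (kap m))).+1 by [].
have mono m m' : (m <= m')%N -> (kap m <= kap m')%N.
  elim: m' => [|m' IH]; first by rewrite leqn0 => /eqP ->.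
  rewrite leq_eqVlt => /orP[/eqP -> //|]; rewrite ltnS => /IH; rewrite kapS; lia.
exists (fun m => N (kap m)), (fun m => h (kap m)), kap; split.
- by move=> m i; case: (hP (kap m)).
- by move=> m; case: (hP (kap m)).
- by move=> m; case: (hP (kap m)).
split=> // [m|j m jm|m].
- by elim: m => [//|m IH]; rewrite kapS; lia.
- by apply: leq_trans (mono _ _ jm); rewrite kapS; lia.
- by case: (hP (kap m)).
Qed.

End Sequence.

(** * Diagonalization over finite sets of indices *)

Section Diagonal.
Variables (R : realType) (n : nat) (lam : R) (Nn : nat -> nat).
Local Notation C := R[i].
Variables (h : forall m, 'I_n -> 'M[C]_(Nn m)) (kap : nat -> nat).
Hypotheses (lam0 : 0 < lam) (lam1 : lam < 1).
Hypothesis sh : forall m i, adj (h m i) = h m i.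
Hypothesis hh : forall m, \sum_i h m i *m h m i = 1%:M.
Hypothesis hgap : forall m, gap (kap m) lam (h m).
Hypothesis kap_mono : forall m m', (m <= m')%N -> (kap m <= kap m')%N.
Hypothesis kap_ge : forall m, (m <= kap m)%N.
Hypothesis Nkap : forall j m, (j < m)%N -> (Nn j + Nn j <= kap m)%N.
Hypothesis kapN : forall m, (kap m <= Nn m)%N.
Hypothesis Npos : forall m, (0 < Nn m)%N.

Definition esys := fam_system lam0 lam1 sh hh.

Definition initial_set (L : seq nat) : set (option nat) := [set o | List.In o (map Some L)].

Lemma esys_agree M (T1 T2 : set (option nat)) K :
  (forall m, (m < M)%N -> (T1 (Some m) <-> T2 (Some m))) -> (K <= M)%N ->
  cones_agree (mo_pos (esys T1)) (mo_pos (esys T2)) K.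
Proof.
move=> hT KM k kK; apply: (fam_order_agree lam0 sh hgap kap_mono hT).
by apply: leq_trans kK _; apply: leq_trans KM (kap_ge M).
Qed.

Variables (G : nat -> seq domain) (phi : forall m, nat -> formula R (G m)).
Variable delta : nat -> R -> R.
Hypothesis phi_ge0 : forall m j (X : operatorSystem R) (v : env X (G m)),
  env_dom v -> 0 <= eval (phi m j) v.
Hypothesis delta_gt0 : forall m e, 0 < e -> 0 < delta m e.
Hypothesis phi_unif : forall m j (X : operatorSystem R) (v w : env X (G m)) (e : R),
  env_dom v -> env_dom w -> 0 < e -> env_close (delta m e) v w ->
  `|eval (phi m j) v - eval (phi m j) w| <= e.

Definition omits (X : operatorSystem R) := forall m,
  sup [set r | exists2 v : env X (G m), env_dom v &
          r = inf (range (fun j => eval (phi m j) v))] = 0.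

Lemma inf_eval_ge0 m (X : operatorSystem R) (v : env X (G m)) : env_dom v ->
  0 <= inf (range (fun j => eval (phi m j) v)).
Proof.
move=> vd; apply: lb_le_inf; first by exists (eval (phi m 0) v); exists 0%N.
by move=> _ [j _ <-]; apply: phi_ge0.
Qed.

Lemma inf_eval_le m (X : operatorSystem R) (v : env X (G m)) j : env_dom v ->
  inf (range (fun j => eval (phi m j) v)) <= eval (phi m j) v.
Proof.
move=> vd; apply: ge_inf; last by exists j.
by exists 0 => _ [i _ <-]; apply: phi_ge0.
Qed.

Lemma esys_net T m (e : R) : 0 < e ->
  exists (F : finType) (w : F -> env (esys T) (G m)),
  (forall f, env_dom (w f)) /\
  forall v, env_dom v -> exists f, env_close e v (w f).
Proof. exact: env_net. Qed.

Lemma omits_witness T m (v : env (esys T) (G m)) (e : R) : omits (esys T) ->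
  env_dom v -> 0 < e -> exists j, eval (phi m j) v < e.
Proof.
move=> om vd e0.
have [F [w [wd wc]]] := esys_net T m (delta_gt0 m ltr01).
(* The supremum of an unbounded set is 0 by convention, so [omits] bounds nothing by itself. A
   finite net and the modulus of continuity of [phi m 0] provide an upper bound. *)
have ub : has_ubound [set r | exists2 v : env (esys T) (G m), env_dom v &
          r = inf (range (fun j => eval (phi m j) v))].
  exists (\sum_f `|eval (phi m 0) (w f)| + 1) => _ [u ud ->].
  apply: le_trans (inf_eval_le 0 ud) _; have [f hform] := wc u ud.
  have := phi_unif 0 ud (wd f) ltr01 hform; rewrite ler_norml => /andP[_ h1].
  have h2 : `|eval (phi m 0) (w f)| <= \sum_f `|eval (phi m 0) (w f)|.
    by rewrite [leRHS](bigD1 f) //= lerDl; apply: sumr_ge0.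
  have := ler_norm (eval (phi m 0) (w f)); lra.
have : inf (range (fun j => eval (phi m j) v)) < e.
  apply: le_lt_trans e0; rewrite -(om m); apply: ub_le_sup => //.
  by exists v.
move=> /inf_lt []; first by exists (eval (phi m 0) v); exists 0%N.
by move=> _ [j _ <-] hj; exists j.
Qed.

(* A finite net of the domain has finitely many witnesses, which see only
   finitely many matrix levels. *)
Lemma finite_level_net L m (e : R) : omits (esys (initial_set L)) -> 0 < e ->
  exists B, forall T : set (option nat),
    (forall p, (p < B)%N -> (T (Some p) <-> initial_set L (Some p))) ->
    forall v : env (esys T) (G m), env_dom v ->
      exists j, eval (phi m j) v <= 2 * e.
Proof.
(* The net is fixed before the witnesses [j] are known; this is possible because [delta m] does not
   depend on [j]. *)
move=> om e0; have [F [w [wd wc]]] := esys_net (initial_set L) m (delta_gt0 m e0).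
have /choice[j hj] : forall f, exists j, eval (phi m j) (w f) < e.
  by move=> f; apply: omits_witness.
pose B0 := (context_level (G m) + context_level (G m))%N.
pose B1 f := (formula_level (phi m (j f)) + formula_level (phi m (j f)))%N.
exists (maxn B0 (\max_f B1 f)) => T hT v vd.
have ag K : (K <= maxn B0 (\max_f B1 f))%N ->
  cones_agree (mo_pos (esys T)) (mo_pos (esys (initial_set L))) K by apply: esys_agree.
have ag0 := ag _ (leq_maxl _ _).
have vd' : @env_dom R (esys (initial_set L)) (G m) v.
  exact: (@env_dom_agree R _ _ _ _ _ (os_axioms (esys T)) (os_axioms (esys (initial_set L))) _ ag0 v).1 vd.
have [f hform] := wc v vd'.
have wd' : @env_dom R (esys T) (G m) (w f).
  exact: (@env_dom_agree R _ _ _ _ _ (os_axioms (esys T)) (os_axioms (esys (initial_set L))) _ ag0 (w f)).2 (wd f).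
have cl : @env_close R (esys T) (delta m e) (G m) v (w f).
  exact: (@env_close_agree R _ _ _ _ _ (os_axioms (esys T)) (os_axioms (esys (initial_set L))) _ _ ag0 v (w f)).2 hform.
exists (j f); have := phi_unif (j f) vd wd' e0 cl.
have -> : eval (X := esys T) (phi m (j f)) (w f) = eval (X := esys (initial_set L)) (phi m (j f)) (w f).
  apply: (@eval_agree R _ _ _ _ _ (os_axioms (esys T)) (os_axioms (esys (initial_set L)))).
  apply: ag; apply: leq_trans (leq_maxr _ _).
  exact: (leq_bigmax_cond (F := B1)).
rewrite ler_norml => /andP[_]; have := hj f; lra.
Qed.

Hypothesis om_fin : forall L, omits (esys (initial_set L)).

Lemma finite_level L i : exists B, forall T : set (option nat),
    (forall p, (p < B)%N -> (T (Some p) <-> initial_set L (Some p))) ->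
    forall m, (m <= i)%N -> forall v : env (esys T) (G m), env_dom v ->
      exists j, eval (phi m j) v <= 2 * i.+1%:R^-1.
Proof.
have e0 : 0 < i.+1%:R^-1 :> R by rewrite invr_gt0 ltr0n.
have /choice[B hB] := fun m => finite_level_net m (om_fin L) e0.
exists (\max_(m < i.+1) B m) => T hT m mi; apply: hB => p pB; apply: hT.
apply: leq_trans pB _.
exact: (leq_bigmax_cond (F := fun m : 'I_i.+1 => B m) (Ordinal (mi : (m < i.+1)%N))).
Qed.

Lemma diagonal : exists T : set (option nat),
  (forall M, exists2 m, (M <= m)%N & T (Some m)) /\ omits (esys T).
Proof.
have /choice[bnd hbnd] := fun Li : seq nat * nat => finite_level Li.1 Li.2.
(* The state is the list of chosen indices with a lower bound for the next one. The bound makes the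
   sequence strictly increasing; [bnd] protects the witnesses of stage [i']. *)
pose st := fix st i : seq nat * nat := if i is i'.+1 then
  let p := maxn (bnd ((st i').1, i')) (st i').2 in (p :: (st i').1, p.+1) else ([::], 0%N).
pose p i := maxn (bnd ((st i).1, i)) (st i).2.
have st1 i : (st i.+1).1 = p i :: (st i).1 by [].
have st2 i : (st i.+1).2 = (p i).+1 by [].
have qp i : ((st i).2 <= p i)%N by apply: leq_maxr.
have p_mono i j : (i <= j)%N -> (p i <= p j)%N.
  elim: j => [|j IH]; first by rewrite leqn0 => /eqP ->.
  rewrite leq_eqVlt => /orP[/eqP -> //|]; rewrite ltnS => /IH pij.
  by apply: leq_trans pij _; apply: leq_trans (qp j.+1); rewrite st2; lia.
have p_ge i : (i <= p i)%N.
  elim: i => [//|i IH]; apply: leq_trans (qp i.+1); rewrite st2; lia.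
pose T := [set o | exists i, o = Some (p i)].
exists T; split; first by move=> M; exists (p M); [exact: p_ge|exists M].
have finP i o : initial_set (st i).1 o <-> exists2 j, (j < i)%N & o = Some (p j).
  elim: i => [|i IH]; first by split=> [[]|[]].
  have finS : initial_set (st i.+1).1 o <-> Some (p i) = o \/ initial_set (st i).1 o by rewrite st1.
  rewrite finS; split=> [[<-|/IH[j ji ->]]|[j ji oj]].
  - by exists i.
  - by exists j => //; apply: ltnW.
  - move: ji; rewrite ltnS leq_eqVlt => /orP[/eqP ji|ji]; first by left; rewrite oj ji.
    by right; apply/IH; exists j.
(* Below [p i] the set [T] agrees with the list of stage [i], as all later choices are at least
   [p i]. Each [m] is served by every stage [i >= m], hence at arbitrary precision. *)
have key i m : (m <= i)%N -> forall v : env (esys T) (G m), env_dom v ->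
    exists j, eval (phi m j) v <= 2 * i.+1%:R^-1.
  apply: (hbnd ((st i).1, i)) => q qB; have qp' : (q < p i)%N.
    by apply: leq_trans qB _; apply: leq_maxl.
  split=> [[j [ej]]|/finP[j _ ->]]; last by exists j.
  apply/finP; exists j; last by rewrite ej.
  by rewrite ltnNge; apply/negP => /p_mono; rewrite -ej leqNgt qp'.
move=> m; set A := [set r | _].
have A0 r : A r -> r = 0.
  move=> [v vd ->]; apply/eqP; rewrite eq_le inf_eval_ge0 // andbT.
  apply/ler_addgt0Pr => e e0; rewrite add0r.
  have [k hk] : exists k, 2 * k.+1%:R^-1 <= e :> R.
    exists (Num.truncn (2 / e)); rewrite ler_pdivrMr ?ltr0n // mulrC -ler_pdivrMr //.
    apply: ltW; have := truncn_itv (divr_ge0 (ler0n R 2) (ltW e0)).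
    by move=> /andP[].
  have [j hj] := key (maxn m k) m (leq_maxl _ _) v vd.
  apply: le_trans (inf_eval_le j vd) _; apply: le_trans hj _; apply: le_trans hk.
  by rewrite ler_pM2l // lef_pV2 ?posrE ?ltr0n // ler_nat ltnS leq_maxr.
have [->|/set0P[r Ar]] := eqVneq A set0; first exact: sup0.
suff -> : A = [set 0] by rewrite sup1.
by apply/seteqP; split=> [s /A0 //|_ ->]; rewrite -(A0 r).
Qed.

End Diagonal.

Theorem mainTheorem2 (R : realType) : ~ uniformly_definable (@one_exact R).
Proof.
move=> [G [phi [pos mod iffK]]].
have [n [lam [lam0 lam1 /family_exists]]] := gap_exists R.
move=> [Nn [h [kap [sh hh hgap [kmono kge Nkap kN]]]]].
have kapN m := (kN m).1; have Npos m := (kN m).2.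
have /choice[delta hd] : forall m, exists d : R -> R, (forall e, 0 < e -> 0 < d e) /\
    forall j (X : operatorSystem R) (v w : env X (G m)) (e : R),
      env_dom v -> env_dom w -> 0 < e -> env_close (d e) v w ->
      `|eval (phi m j) v - eval (phi m j) w| <= e.
  by move=> m; have [d d1 d2] := mod m; exists d.
have om_fin L : omits phi (esys lam0 lam1 sh hh (initial_set L)).
  by apply/iffK; exact: finite_one_exact.
have [T [Tinf om]] := diagonal hgap kmono kge pos (fun m => (hd m).1)
  (fun m => (hd m).2) om_fin.
apply: (fam_system_not_exact hgap kmono kge Nkap kapN Npos Tinf).
by apply/iffK; exact: om.
Qed.
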